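(* Let $m$ and $n>1$ be positive integers, and set $d=mn$. Then there are infinitely many number fields $K$ of degree $d=[K:\mathbb{Q}]$ such that $$\frac{1}{\sqrt{2d}}\,|\Delta_K|^{\frac{1}{2d(n-1)}}\leq \delta(K/\mathbb{Q})\leq (2d)^2\,|\Delta_K|^{\frac{1}{2d(n-1)}}.$$ More precisely, these bounds hold for each $K=\mathbb{Q}(2^{1/m},(p/q)^{1/n})$ where $p$ and $q$ are primes satisfying $m<p<q<2p$.
   Context: For a number field $K$ and $\alpha\in K$, the absolute multiplicative Weil height is $H(\alpha)=\prod_{v\in M_K}\max\{1,|\alpha|_v\}^{d_v/[K:\mathbb{Q}]}$, where $M_K$ is the set of places of $K$, $|\cdot|_v$ is the representative of $v$ extending the usual Archimedean absolute value or a usual $p$-adic absolute value on $\mathbb{Q}$, and $d_v=[K_v:\mathbb{Q}_v]$ is the local degree. It does not depend on the number field $K$ containing $\alpha$. For an extension $K/F$ of number fields, $\delta(K/F)=\min\{H(\alpha): K=F(\alpha)\}$ (the minimum exists by Northcott's theorem). $\Delta_K$ is the discriminant of $K$. The symbols $2^{1/m}$ and $(p/q)^{1/n}$ denote an $m$-th root of $2$ and an $n$-th root of $p/q$ in $\overline{\mathbb{Q}}$. *)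

(* Defs.v *)
From HB Require Import structures.
From mathcomp Require Import all_boot all_order all_algebra all_field.
From mathcomp Require Import boolp classical_sets functions fsbigop reals exp.

Set Implicit Arguments.
Unset Strict Implicit.
Unset Printing Implicit Defensive.
Import Order.TTheory GRing.Theory Num.Theory.
Local Open Scope classical_set_scope.
Local Open Scope ring_scope.

(* A number field is a K : fieldExtType rat, of degree \dim {:K}. *)

Section AbsoluteValues.
Variable R : realType.

Definition is_absolute_value (L : fieldType) (v : L -> R) : Prop :=
  [/\ forall x, 0 <= v x,
      forall x, v x = 0 <-> x = 0,
      forall x y, v (x * y) = v x * v y
    & forall x y, v (x + y) <= v x + v y].

(* |x|_p = p ^ (- ord_p x), where ord_p x = ord_p (numq x) - ord_p (denq x). *)
Definition padic_abs (p : nat) (x : rat) : R :=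
  if x == 0 then 0
  else p%:R ^ ((logn p `|denq x|%N)%:Z - (logn p `|numq x|%N)%:Z).

Definition std_abs_rat (w : rat -> R) : Prop :=
  (forall x, w x = `|ratr x|) \/
  exists2 p, prime p & forall x, w x = padic_abs p x.

(* The set M_K: each place is identified with its unique representative
   extending a standard absolute value of the rationals. *)
Definition places (K : fieldExtType rat) : set (K -> R) :=
  [set v | is_absolute_value v /\ std_abs_rat (fun x : rat => v x%:A)].

Arguments places K : clear implicits.

Definition abs_complete (L : fieldType) (w : L -> R) : Prop :=
  forall u : nat -> L,
    (forall e, 0 < e ->
       exists N, forall i j, (N <= i)%N -> (N <= j)%N -> w (u i - u j) < e) ->
  exists l, forall e, 0 < e ->
    exists N, forall i, (N <= i)%N -> w (u i - l) < e.

Definition abs_closure (L : fieldType) (w : L -> R) (A : set L) : set L :=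
  [set y | forall e, 0 < e -> exists2 x, A x & w (y - x) < e].

Definition is_completion (K L : fieldType) (v : K -> R) (w : L -> R)
    (f : {rmorphism K -> L}) : Prop :=
  [/\ is_absolute_value w, forall x, w (f x) = v x,
      abs_closure w (range f) = setT & abs_complete w].

Definition has_degree_over (L : fieldType) (F : set L) (n : nat) : Prop :=
  exists b : 'I_n -> L, forall y : L,
    exists! c : 'rV[L]_n, (forall i, F (c 0 i)) /\ y = \sum_i c 0 i * b i.

(* n = [K_v : Q_v]: K_v is a completion (L, w) of (K, v), and Q_v, the
   completion of Q at the place below v, is the closure of Q in K_v. *)
Definition is_local_degree (K : fieldExtType rat) (v : K -> R) (n : nat) :
    Prop :=
  exists (L : fieldType) (w : L -> R) (f : {rmorphism K -> L}),
    is_completion v w f /\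
    has_degree_over (abs_closure w (range (ratr : rat -> L))) n.

Definition local_degree (K : fieldExtType rat) (v : K -> R) : nat :=
  xget 0%N (is_local_degree v).

(* \big over a set multiplies the finitely many factors that differ from 1;
   a has absolute value > 1 at only finitely many places. *)
Definition weil_height (K : fieldExtType rat) (a : K) : R :=
  \big[*%R/1]_(v \in places K)
    Num.max 1 (v a) `^ ((local_degree v)%:R / (\dim {:K})%:R).

Definition generator_heights (K : fieldExtType rat) : set R :=
  [set weil_height a | a in [set a : K | <<1; a>>%VS = {:K}%VS]].

(* delta(K/Q), the least element of generator_heights K (not merely its
   infimum); the default 0 is not attained since such heights are >= 1. *)
Definition delta (K : fieldExtType rat) : R :=
  xget 0 (generator_heights K `&` lbound (generator_heights K)).

End AbsoluteValues.

Section Discriminant.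
Variable K : fieldExtType rat.

Definition field_trace (x : K) : rat :=
  \tr (passmx.mxof (vbasis {:K}) (vbasis {:K}) (amull x)).

Definition is_integral (x : K) : Prop :=
  integralOver (intmul 1 : int -> K) x.

Definition is_integral_basis (w : 'I_(\dim {:K}) -> K) : Prop :=
  (forall i, is_integral (w i)) /\
  forall x, is_integral x ->
    exists! c : {ffun 'I_(\dim {:K}) -> int}, x = \sum_i w i *~ c i.

Definition basis_discriminant (w : 'I_(\dim {:K}) -> K) : rat :=
  \det (\matrix_(i, j) field_trace (w i * w j)).

Definition discriminant : rat :=
  xget 0 [set basis_discriminant w | w in is_integral_basis].

End Discriminant.

Arguments delta R K : clear implicits.

(* Main.v *)
Require Import Defs.
From HB Require Import structures.
From mathcomp Require Import all_boot all_order all_algebra all_field.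
From mathcomp Require Import boolp classical_sets functions fsbigop reals exp.
From mathcomp Require Import ring lra zify.
From mathcomp Require Import perm cyclic complex.

Set Implicit Arguments.
Unset Strict Implicit.
Unset Printing Implicit Defensive.
Import Order.TTheory GRing.Theory Num.Theory.
Local Open Scope classical_set_scope.
Local Open Scope ring_scope.

(** Let K = Q(a, b) with a^m = 2 and b^n = p/q.  The primes p and q are unramified
    in Q(a) and totally ramified in K / Q(a), which gives [K : Q] = mn and
    (pq)^(m(n-1)) <= |disc K|.  Since H(a + b)^(mn) <= 3^(mn) q^m and q < 2p, and
    a + b generates K, the upper bound for delta(K/Q) follows.

    For the lower bound let al be a generator of least height.  Locally at each
    prime, disc K is compared with the discriminant of the products a^i al^j: after
    clearing the content of the minimal polynomial of al over Q(a) this costs a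
    factor a0^(2(n-1)), where a0 is the leading coefficient of the primitive integer
    multiple of the characteristic polynomial of al.  The archimedean absolute value
    of that discriminant is bounded through its Vandermonde factors,
    and a0 prod_s max(1, |s al|) = H(al)^(mn).

    Heights are computed through the embeddings s of K into a field E containing all
    conjugates: if u extends a standard absolute value w of Q to E, the places of K
    over w are the u o s, and [K_v : Q_v] is the number of s with v = u o s. *)

(** The height is defined through completions but computed in E, and the bridge is a double count:
    each local degree is at least the multiplicity of its place among the u o s, while the sum of
    local degrees over w is at most [K : Q], the number of all s. Both inequalities are therefore
    equalities. The condition m < p makes p prime to disc(X^m - 2) = +- m^m 2^(m-1), hence
    unramified in Q(a), and it leaves the n-th root of p/q to carry all the ramification at p; the
    same holds at q with b^-1. The condition q < 2p gives q^2 < 2pq, so that q^m in the height of a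
    + b costs only 2^(m/2) (pq)^(m/2), which the discriminant pays for. Q(a) may have class number
    greater than 1, so a polynomial over Q(a) has no content that is a number of Q(a). At a single
    prime weak approximation supplies one, which is why discriminants are compared prime by prime
    and the results are assembled into a divisibility of integers. The lower bound |disc K| >= p
    also separates the fields: choosing p beyond all earlier discriminants gives pairwise
    non-isomorphic fields. *)

(** * Growth estimates *)

(** With h = r - 1, Bernoulli gives r^k > k h, so r^(2k) exceeds (k h)^2, which is quadratic in k
    and overtakes C (2k + 1). *)
Lemma exp_beats_linear (R : realType) (r C : R) :
  1 < r -> exists N : nat, C * N.+1%:R < r ^+ N.
Proof.
move=> r1; pose h := r - 1; have h0 : 0 < h by rewrite subr_gt0.
have bern (k : nat) : 1 + k%:R * h <= r ^+ k.
  elim: k => [|k IH]; first by rewrite mul0r addr0 expr0.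
  have er : r = 1 + h by rewrite /h; ring.
  move: IH; rewrite exprS er.
  have k0 : (0 : R) <= k%:R by [].
  rewrite -natr1 => IH.
  have : (1 + h) * (1 + k%:R * h) <= (1 + h) * (1 + h) ^+ k.
    by rewrite ler_pM2l // ltr_wpDl.
  by apply: le_trans; nra.
have [k hk] : exists k : nat, (`|C| * 3 + 3) / (h ^+ 2) < k%:R.
  exists (Num.trunc ((`|C| * 3 + 3) / (h ^+ 2))).+1.
  exact: truncnS_gt.
have k0 : (0 < k)%N.
  rewrite lt0n; apply/eqP => k0; move: hk; rewrite k0.
  apply/negP; rewrite -leNgt divr_ge0 ?exprn_ge0 ?(ltW h0) //.
  by rewrite addr_ge0 // mulr_ge0.
exists (k + k)%N; rewrite exprD.
have hk2 : k%:R * h < r ^+ k by apply: lt_le_trans (bern k); rewrite ltrDr.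
have kh0 : 0 < k%:R * h by rewrite mulr_gt0 // ltr0n.
apply: (@le_lt_trans _ _ ((k%:R * h) * (k%:R * h))); last first.
  by apply: ltr_pM => //; exact: ltW.
move: hk; rewrite ltr_pdivrMr ?exprn_gt0 // => hk.
have k1 : (1 : R) <= k%:R by rewrite ler1n.
have CC : C <= `|C| by apply: ler_norm.
have C0 := normr_ge0 C.
apply: (@le_trans _ _ (`|C| * (3 * k%:R))).
  have e : (k + k).+1%:R = k%:R + k%:R + 1 :> R by rewrite -natr1 natrD.
  rewrite e; apply: (@le_trans _ _ (`|C| * (k%:R + k%:R + 1))).
    by rewrite ler_wpM2r //; lra.
  by rewrite ler_wpM2l //; lra.
by nra.
Qed.

(** Taking N-th roots makes a factor linear in N disappear. This turns estimates on sums of N + 1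
    terms into sharp inequalities. *)
Lemma le_of_exp_le (R : realType) (C A B : R) : 0 <= A -> 0 <= B ->
  (forall N : nat, A ^+ N <= C * N.+1%:R * B ^+ N) -> A <= B.
Proof.
move=> A0 B0 h; rewrite leNgt; apply/negP => BA.
have [B00|Bn0] := eqVneq B 0.
  by have := h 1%N; rewrite !expr1 B00 mulr0 => /(lt_le_trans BA); rewrite B00 ltxx.
have Bp : 0 < B by rewrite lt_def Bn0.
have [|N hN] := @exp_beats_linear R (A / B) C; first by rewrite ltr_pdivlMr // mul1r.
have := h N; rewrite leNgt => /negP; apply.
by rewrite -ltr_pdivlMr ?exprn_gt0 // -expr_div_n.
Qed.

Lemma inv_succ_lt (R : realType) (e : R) : 0 < e ->
  exists N, forall i, (N <= i)%N -> i.+1%:R^-1 < e.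
Proof.
move=> e0; exists (Num.trunc e^-1) => i Ni.
rewrite invf_plt ?posrE ?ltr0Sn //; apply: lt_le_trans (truncnS_gt _) _.
by rewrite ler_nat.
Qed.

(** * Absolute values and the ultrametric inequality *)

Section AbsoluteValue.
Variables (R : realType) (L : fieldType) (v : L -> R).
Hypothesis hv : is_absolute_value v.

Lemma av_ge0 x : 0 <= v x. Proof. by case: hv. Qed.

Lemma av_eq0 x : (v x == 0) = (x == 0).
Proof. by case: hv => _ h _ _; apply/eqP/eqP => /h. Qed.

Lemma av0 : v 0 = 0. Proof. by apply/eqP; rewrite av_eq0. Qed.

Lemma av_gt0 x : x != 0 -> 0 < v x.
Proof. by move=> x0; rewrite lt_def av_eq0 x0 av_ge0. Qed.

Lemma avM x y : v (x * y) = v x * v y. Proof. by case: hv. Qed.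

Lemma avD x y : v (x + y) <= v x + v y. Proof. by case: hv. Qed.

Lemma av1 : v 1 = 1.
Proof.
have v1 : v 1 != 0 by rewrite av_eq0 oner_eq0.
by apply: (mulfI v1); rewrite -avM !mulr1.
Qed.

Lemma avX x n : v (x ^+ n) = v x ^+ n.
Proof. by elim: n => [|n IH]; rewrite ?expr0 ?av1 // !exprS avM IH. Qed.

Lemma avN x : v (- x) = v x.
Proof.
have e : v (- x) ^+ 2 = v x ^+ 2 by rewrite -!avX sqrrN.
by apply/eqP; rewrite -(eqrXn2 (n := 2)) ?av_ge0 // e.
Qed.

Lemma avB x y : v (x - y) = v (y - x).
Proof. by rewrite -avN opprB. Qed.

Lemma avV x : v x^-1 = (v x)^-1.
Proof.
have [->|x0] := eqVneq x 0; first by rewrite invr0 av0 invr0.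
have vx : v x != 0 by rewrite av_eq0.
by apply: (mulfI vx); rewrite -avM !divff // av1.
Qed.

Lemma av_sum (I : Type) (r : seq I) (P : pred I) (F : I -> L) :
  v (\sum_(i <- r | P i) F i) <= \sum_(i <- r | P i) v (F i).
Proof.
elim/big_rec2: _ => [|i y x _ IH]; first by rewrite av0.
by apply: le_trans (avD _ _) _; rewrite lerD2l.
Qed.

Lemma av_prod (I : Type) (r : seq I) (P : pred I) (F : I -> L) :
  v (\prod_(i <- r | P i) F i) = \prod_(i <- r | P i) v (F i).
Proof. exact: (big_morph v avM av1). Qed.

Lemma av_dist x y z : v (x - z) <= v (x - y) + v (y - z).
Proof. by have := avD (x - y) (y - z); rewrite addrA subrK. Qed.

Lemma av_dist_lt x y z e1 e2 :
  v (x - y) < e1 -> v (y - z) < e2 -> v (x - z) < e1 + e2.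
Proof. by move=> h1 h2; apply: le_lt_trans (av_dist x y z) _; apply: ltrD. Qed.

Lemma av_sub_dist x y : `|v x - v y| <= v (x - y).
Proof.
rewrite ler_norml; apply/andP; split.
  by have := avD (y - x) x; rewrite subrK avB; lra.
by have := avD (x - y) y; rewrite subrK; lra.
Qed.

Definition ultrametric := forall x y, v (x + y) <= Num.max (v x) (v y).

(** The binomial expansion of (x + y)^N has N + 1 terms of value at most B^N; [le_of_exp_le] removes
    the factor N + 1. *)
Lemma ultrametric_of_nat : (forall n : nat, v n%:R <= 1) -> ultrametric.
Proof.
move=> hn x y; set B := Num.max _ _.
have B0 : 0 <= B by rewrite le_max av_ge0.
apply: (@le_of_exp_le R 1); rewrite ?av_ge0 // => N.
rewrite -avX exprDn; apply: le_trans (av_sum _ _ _) _.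
apply: le_trans (_ : \sum_(i < N.+1) B ^+ N <= _); last first.
  by rewrite sumr_const card_ord mul1r -(mulr_natl (B ^+ N)).
apply: ler_sum => i _; rewrite -mulr_natl !avM !avX.
apply: le_trans (_ : 1 * (B ^+ (N - i) * B ^+ i) <= _); last first.
  by rewrite mul1r -exprD subnK // -ltnS.
apply: ler_pM => //; rewrite ?mulr_ge0 ?exprn_ge0 ?av_ge0 //.
by apply: ler_pM; rewrite ?exprn_ge0 ?av_ge0 //; apply: lerXn2r;
  rewrite ?nnegrE ?av_ge0 // /B le_max lexx ?orbT.
Qed.

Section Ultrametric.
Hypothesis hu : ultrametric.

Lemma ultra_sum (I : Type) (r : seq I) (P : pred I) (F : I -> L) B : 0 <= B ->
  (forall i, P i -> v (F i) <= B) -> v (\sum_(i <- r | P i) F i) <= B.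
Proof.
move=> B0 hB; elim/big_rec: _ => [|i x Pi IH]; first by rewrite av0.
by apply: le_trans (hu _ _) _; rewrite ge_max IH hB.
Qed.

Lemma ultra_sum_lt (I : Type) (r : seq I) (P : pred I) (F : I -> L) B : 0 < B ->
  (forall i, P i -> v (F i) < B) -> v (\sum_(i <- r | P i) F i) < B.
Proof.
move=> B0 hB; elim/big_rec: _ => [|i x Pi IH]; first by rewrite av0.
by apply: le_lt_trans (hu _ _) _; rewrite gt_max IH hB.
Qed.

Lemma ultraB x y : v (x - y) <= Num.max (v x) (v y).
Proof. by apply: le_trans (hu _ _) _; rewrite avN. Qed.

Lemma ultra_eq x y : v y < v x -> v (x + y) = v x.
Proof.
move=> yx; apply/eqP; rewrite eq_le; apply/andP; split.
  by apply: le_trans (hu _ _) _; rewrite ge_max lexx ltW.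
have := ultraB (x + y) y; rewrite addrK le_max => /orP[//|].
by rewrite leNgt yx.
Qed.

Lemma ultra_nat n : v n%:R <= 1.
Proof.
elim: n => [|n IH]; first by rewrite av0.
by rewrite -natr1; apply: le_trans (hu _ _) _; rewrite av1 ge_max IH lexx.
Qed.

Lemma ultra_int (z : int) : v z%:~R <= 1.
Proof. by case: z => n; rewrite ?NegzE ?mulrNz ?avN; apply: ultra_nat. Qed.

End Ultrametric.
End AbsoluteValue.

Lemma av_comp (R : realType) (L M : fieldType) (v : M -> R)
    (f : {rmorphism L -> M}) : is_absolute_value v -> is_absolute_value (v \o f).
Proof.
move=> hv; split=> [x|x|x y|x y] /=; first exact: av_ge0.
- split=> [/eqP|->]; last by rewrite rmorph0 av0.
  by rewrite av_eq0 // fmorph_eq0 => /eqP.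
- by rewrite rmorphM avM.
- by rewrite rmorphD avD.
Qed.

(** * Standard absolute values of the rationals *)

Section PadicAbsoluteValue.
Variables (R : realType) (p : nat).
Hypothesis pp : prime p.
Local Notation w := (@padic_abs R p).

Let p_gt0 : 0 < p%:R :> R. Proof. by rewrite ltr0n prime_gt0. Qed.
Let p_neq0 : p%:R != 0 :> R. Proof. by rewrite gt_eqF. Qed.
Let p_gt1 : 1 < p%:R :> R. Proof. by rewrite ltr1n prime_gt1. Qed.

Lemma padic_abs_frac (a b : int) : a != 0 -> b != 0 ->
  w (a%:~R / b%:~R) = p%:R ^ ((logn p `|b|%N)%:Z - (logn p `|a|%N)%:Z).
Proof.
move=> a0 b0; rewrite /padic_abs.
have bq : b%:~R != 0 :> rat by rewrite intr_eq0.
have aq : a%:~R != 0 :> rat by rewrite intr_eq0.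
set x := _ / _; have x0 : x != 0 by rewrite mulf_neq0 ?invr_eq0.
rewrite (negPf x0); congr (_ ^ _).
have e : numq x * b = a * denq x.
  apply: (@intr_inj rat); rewrite !rmorphM /= numqE.
  by rewrite mulrAC {1}/x divfK.
have n0 : numq x != 0 by rewrite numq_eq0.
have := congr1 (fun z => logn p `|z|%N) e; rewrite /= !abszM.
rewrite !lognM ?absz_gt0 ?denq_eq0 // => ee; lia.
Qed.

Lemma padic_abs_int (a : int) : a != 0 -> w a%:~R = p%:R ^- logn p `|a|%N.
Proof.
move=> a0; have := padic_abs_frac a0 (oner_neq0 _); rewrite divr1 => ->.
by rewrite absz1 logn1 sub0r exprnN.
Qed.

Lemma padic_abs_nat (n : nat) : (0 < n)%N -> w n%:R = p%:R ^- logn p n.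
Proof. by rewrite lt0n; exact: (padic_abs_int (a := n%:Z)). Qed.

Lemma padic_abs_value : is_absolute_value w.
Proof.
have w0 : w 0 = 0 by rewrite /padic_abs eqxx.
have wpos x : x != 0 -> 0 < w x.
  by move=> x0; rewrite /padic_abs (negPf x0) exprz_gt0.
have fr (x : rat) : x != 0 -> exists a b : int,
    [/\ a != 0, b != 0 & x = a%:~R / b%:~R].
  by move=> x0; exists (numq x), (denq x); rewrite numq_eq0 denq_eq0 divq_num_den.
have wM x y : w (x * y) = w x * w y.
  have [->|x0] := eqVneq x 0; first by rewrite mul0r w0 mul0r.
  have [->|y0] := eqVneq y 0; first by rewrite mulr0 w0 mulr0.
  have [a [b [a0 b0 ->]]] := fr x x0; have [c [e [c0 e0 ->]]] := fr y y0.
  rewrite mulrACA -invfM -!rmorphM /= !padic_abs_frac ?mulf_neq0 //.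
  rewrite -expfzDr // !abszM !lognM ?absz_gt0 //; congr (_ ^ _); lia.
have wint (z : int) : w z%:~R <= 1.
  have [->|z0] := eqVneq z 0; first by rewrite w0.
  rewrite padic_abs_int //; by rewrite invf_le1 ?exprn_gt0 // exprn_ege1 // ltW.
have wV x : x != 0 -> w x^-1 = (w x)^-1.
  move=> x0; have w1 : w 1 = 1.
    by have := padic_abs_int (oner_neq0 int); rewrite absz1 logn1 expr0 invr1.
  have wx : w x != 0 by rewrite gt_eqF ?wpos.
  by apply: (mulfI wx); rewrite -wM !divff.
(* Dividing by the larger of the two terms reduces the ultrametric inequality to w (1 + z) <= 1 for
   w z <= 1. *)
have key x y : w y <= w x -> w (x + y) <= w x.
  move=> yx; have [x0|x0] := eqVneq x 0.
    suff -> : y = 0 by rewrite addr0.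
    by apply/eqP/negP => /negP /wpos; rewrite ltNge (le_trans yx) // x0 w0.
  have -> : x + y = x * (1 + y / x) by rewrite mulrDr mulr1 mulrCA divff ?mulr1.
  rewrite wM ger_pMr ?wpos //.
  set z := y / x; have wz : w z <= 1.
    by rewrite wM wV // ler_pdivrMr ?wpos // mul1r.
  have [->|z0] := eqVneq z 0.
    by rewrite addr0; exact: (wint 1).
  (* w z <= 1, so p does not divide the reduced denominator of z. *)
  have pb : logn p `|denq z|%N = 0%N.
    move: wz; rewrite /padic_abs (negPf z0); case: (posnP (logn p `|denq z|%N)) => [//|lp].
    have cop := coprime_num_den z.
    have pdb : (p %| `|denq z|)%N by move: lp; rewrite logn_gt0 mem_primes => /and3P[].
    have pna : logn p `|numq z|%N = 0%N.
      apply/eqP; rewrite -leqn0 leqNgt logn_gt0.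
      rewrite mem_primes pp absz_gt0 numq_eq0 z0 /=; apply/negP => pda.
      have : (p %| gcdn `|numq z| `|denq z|)%N by rewrite dvdn_gcd pda pdb.
      by rewrite (eqP cop) dvdn1 => /eqP p1; move: pp; rewrite p1.
    by rewrite pna subr0 -exprnP leNgt exprn_egt1 // -lt0n lp.
  have dz : (denq z)%:~R != 0 :> rat by rewrite intr_eq0 denq_eq0.
  have -> : 1 + z = (denq z + numq z)%:~R / (denq z)%:~R.
    by rewrite rmorphD /= mulrDl divff // divq_num_den.
  rewrite wM wV // [w (denq z)%:~R]padic_abs_int ?denq_eq0 // pb expr0 invr1 invr1 mulr1.
  exact: wint.
split=> // [x|x|x y].
- by have [->|/wpos/ltW//] := eqVneq x 0; rewrite w0.
- split=> [wx|->//]; apply/eqP; apply/negP => /negP/wpos.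
  by rewrite wx ltxx.
- have [yx|xy] := leP (w y) (w x).
    apply: le_trans (key _ _ yx) _; rewrite lerDl.
    by have [->|/wpos/ltW//] := eqVneq y 0; rewrite w0.
  rewrite addrC; apply: le_trans (key _ _ (ltW xy)) _; rewrite lerDr.
  by have [->|/wpos/ltW//] := eqVneq x 0; rewrite w0.
Qed.

Lemma padic_abs_nat_le1 (n : nat) : w n%:R <= 1.
Proof.
case: n => [|n]; first by rewrite (av0 padic_abs_value).
by rewrite padic_abs_nat // invf_le1 ?exprn_gt0 // exprn_ege1 // ltW.
Qed.

Lemma padic_ultrametric : ultrametric w.
Proof. exact: (ultrametric_of_nat padic_abs_value padic_abs_nat_le1). Qed.

Lemma padic_abs_prime : w p%:R = p%:R^-1.
Proof. by rewrite padic_abs_nat ?prime_gt0 // logn_prime // eqxx. Qed.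

Lemma padic_abs_coprime (n : nat) : (0 < n)%N -> ~~ (p %| n)%N -> w n%:R = 1.
Proof.
move=> n0 pn; rewrite padic_abs_nat // (_ : logn p n = 0%N) ?expr0 ?invr1 //.
by apply/eqP; rewrite -leqn0 leqNgt logn_gt0 mem_primes pp n0.
Qed.

Lemma padic_abs_prime_expz (z : int) : w (p%:R ^ z) = p%:R ^ - z.
Proof.
have hp := padic_abs_value; case: z => n; last rewrite NegzE opprK.
  by rewrite -exprnP (avX hp) padic_abs_prime // exprVn exprnN.
by rewrite -exprnN (avV hp) (avX hp) padic_abs_prime exprVn invrK.
Qed.

Lemma padic_abs_expz (x : rat) : x != 0 -> exists z : int, w x = p%:R ^ z.
Proof. by move=> x0; rewrite /padic_abs (negPf x0); eexists. Qed.

End PadicAbsoluteValue.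

Lemma rat_int_of_padic (R : realType) (x : rat) :
  (forall p, prime p -> padic_abs R p x <= 1) -> exists z : int, x = z%:~R.
Proof.
move=> h; have [->|x0] := eqVneq x 0; first by exists 0.
exists (numq x); rewrite numqE.
suff -> : denq x = 1 by rewrite mulr1.
have : `|denq x|%N = 1%N.
  apply/eqP; rewrite eqn_leq absz_gt0 denq_eq0 andbT leqNgt; apply/negP => d1.
  have pp := pdiv_prime d1; set p := pdiv _ in pp.
  have pdb : (p %| `|denq x|)%N by apply: pdiv_dvd.
  have pna : logn p `|numq x|%N = 0%N.
    apply/eqP; rewrite -leqn0 leqNgt logn_gt0.
    rewrite mem_primes pp absz_gt0 numq_eq0 x0 /=; apply/negP => pda.
    have : (p %| gcdn `|numq x| `|denq x|)%N by rewrite dvdn_gcd pda pdb.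
    by rewrite (eqP (coprime_num_den x)) dvdn1 => /eqP p1; move: pp; rewrite p1.
  have := h p pp; rewrite /padic_abs (negPf x0) pna subr0 -exprnP leNgt.
  rewrite exprn_egt1 ?ltr1n ?prime_gt1 // -lt0n logn_gt0 mem_primes pp pdb.
  by rewrite absz_gt0 denq_eq0.
by have := denq_gt0 x; case: (denq x) => // n _ /= ->.
Qed.

(** The local inequalities say that a divides b. *)
Lemma leq_of_padic (R : realType) (a b : nat) : (0 < a)%N -> (0 < b)%N ->
  (forall p, prime p -> padic_abs R p b%:R <= padic_abs R p a%:R) -> (a <= b)%N.
Proof.
move=> a0 b0 h; apply: dvdn_leq => //; apply/dvdn_partP => // p.
rewrite mem_primes => /and3P[pp _ _].
rewrite p_part pfactor_dvdn //; have := h p pp.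
rewrite !padic_abs_nat // lef_pV2 ?posrE ?exprn_gt0 ?ltr0n ?prime_gt0 //.
by rewrite ler_eXn2l // ltr1n prime_gt1.
Qed.

(** The product formula for a positive integer. It reassembles the finite part of a height into a
    leading coefficient. *)
Lemma prod_padic_abs (R : realType) (a : nat) : (0 < a)%N ->
  \prod_(p <- primes a) padic_abs R p a%:R = a%:R^-1.
Proof.
move=> a0; transitivity (\prod_(p <- primes a) (p ^ logn p a)%:R^-1 :> R).
  rewrite !big_seq; apply: eq_bigr => p; rewrite mem_primes => /and3P[pp _ _].
  by rewrite padic_abs_nat // natrX.
rewrite prodfV -natr_prod; congr (_%:R^-1).
rewrite [RHS](prod_prime_decomp a0) prime_decompE big_map.
by apply: eq_bigr.
Qed.

Section StandardAbsoluteValue.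
Variables (R : realType) (w : rat -> R).
Hypothesis hw : std_abs_rat w.

Lemma std_abs_value : is_absolute_value w.
Proof.
case: hw => [h|[p pp h]]; last by rewrite (_ : w = padic_abs R p) ?funeqE //;
  apply: padic_abs_value.
split=> [x|x|x y|x y]; rewrite !h //.
- split=> [/eqP|->]; last by rewrite rmorph0 normr0.
  by rewrite normr_eq0 fmorph_eq0 => /eqP.
- by rewrite rmorphM normrM.
- by rewrite rmorphD ler_normD.
Qed.

(** The values of a p-adic absolute value are discrete, so none need lie between A and B; passing to
    k-th powers widens the gap until one fits. The r found serves to move a threshold between two
    values to 1. *)
Lemma std_abs_separates (A B : R) : 0 <= A -> A < B ->
  exists (k : nat) (r : rat), [/\ (0 < k)%N, r != 0, A ^+ k < w r & w r < B ^+ k].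
Proof.
move=> A0 AB; have B0 : 0 < B by apply: le_lt_trans AB.
case: hw => [h|[p pp h]].
  have [r] := rat_in_itvoo AB; rewrite in_itv /= => /andP[Ar rB].
  exists 1%N, r; have r0 : 0 < ratr r :> R by apply: le_lt_trans Ar.
  split=> //; last 2 first.
  - by rewrite h gtr0_norm // expr1.
  - by rewrite h gtr0_norm // expr1.
  by apply: contraTneq r0 => ->; rewrite rmorph0 ltxx.
have p0 : 0 < p%:R :> R by rewrite ltr0n prime_gt0.
have p1 : 1 < p%:R :> R by rewrite ltr1n prime_gt1.
(* A^k < B^k / (2p) for some k, and [B^k / (2p), B^k / 2] contains a power of p. *)
have [k hk] : exists k : nat, (0 < k)%N /\ A ^+ k * (2 * p%:R) < B ^+ k.
  have [A00|An0] := eqVneq A 0.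
    by exists 1%N; rewrite A00 !expr1 mul0r.
  have Ap : 0 < A by rewrite lt_def An0.
  have [|N hN] := @exp_beats_linear R (B / A) (2 * p%:R).
    by rewrite ltr_pdivlMr // mul1r.
  exists N; move: hN; rewrite expr_div_n ltr_pdivlMr ?exprn_gt0 // => hN.
  case: N hN => [|N] hN.
    move: hN; rewrite !expr0 !mulr1 => hN; have : 2 * 1 <= 2 * p%:R :> R.
      by rewrite ler_pM2l // ltW.
    by lra.
  split=> //; rewrite mulrC; apply: le_lt_trans hN.
  rewrite ler_wpM2r ?exprn_ge0 // ler_peMr ?ler1n //.
  by rewrite mulr_ge0 // ltW.
case: hk => k0 hk.
have Bk : 0 < B ^+ k by rewrite exprn_gt0.
have [z /andP[z1 z2]] : exists z : int, p%:R ^ z <= B ^+ k / 2 < p%:R ^ (z + 1).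
  have y0 : 0 < B ^+ k / 2 by rewrite divr_gt0.
  have [N hN] := @exp_beats_linear R p%:R (B ^+ k / 2)^-1 p1.
  have [M hM] := @exp_beats_linear R p%:R (p%:R ^+ N * (B ^+ k / 2)) p1.
  have N1 : 1 <= p%:R ^+ N * (B ^+ k / 2).
    rewrite -ler_pdivrMr // mul1r ltW //; apply: le_lt_trans hN.
    by rewrite ler_peMr ?ler1n // invr_ge0 ltW.
  have ex : exists n : nat, p%:R ^+ N * (B ^+ k / 2) < p%:R ^+ n.
    exists M; apply: le_lt_trans hM.
    by rewrite ler_peMr ?ler1n // (le_trans ler01).
  case: (ex_minnP ex) => [[|n] hn mn]; first by move: hn; rewrite expr0 ltNge N1.
  exists (n%:Z - N%:Z).
  rewrite (_ : n%:Z - N%:Z + 1 = n.+1%:Z - N%:Z); last by lia.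
  rewrite !expfzDr ?gt_eqF // -!exprnN -!exprnP.
  rewrite ler_pdivrMr ?exprn_gt0 // ltr_pdivlMr ?exprn_gt0 // mulrC hn andbT.
  by rewrite leNgt; apply/negP => /mn; rewrite ltnn.
exists k, (p%:R ^ (- z)); rewrite h padic_abs_prime_expz // opprK; split=> //.
- by rewrite expfz_neq0 // pnatr_eq0 -lt0n prime_gt0.
- move: z2; rewrite expfzDr ?gt_eqF // expr1z ltr_pdivrMr // => z2.
  have := lt_trans hk z2; rewrite -mulrA [p%:R * 2]mulrC ltr_pM2r //.
  by rewrite mulr_gt0.
- by apply: le_lt_trans z1 _; rewrite ltr_pdivrMr // ltr_pMr // ltr1n.
Qed.

End StandardAbsoluteValue.

(** * Completion of a field at an absolute value *)

Section Limits.
Variable R : realType.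

Definition tends (u : nat -> R) (l : R) :=
  forall e, 0 < e -> exists N, forall i, (N <= i)%N -> `|u i - l| < e.

Lemma tends_unique u l m : tends u l -> tends u m -> l = m.
Proof.
move=> hl hm; apply/eqP; rewrite -subr_eq0 -normr_le0; apply/ler_addgt0Pl => e e0.
have [N hN] := hl (e / 2) ltac:(lra); have [M hM] := hm (e / 2) ltac:(lra).
have := hN _ (leq_maxl N M); have := hM _ (leq_maxr N M).
set z := u _ => h1 h2; rewrite addr0.
have -> : l - m = (z - m) - (z - l) by ring.
by apply: le_trans (ler_normB _ _) _; lra.
Qed.

(** The limit is the supremum of the eventual lower bounds of the sequence. *)
Lemma real_cauchy_tends (u : nat -> R) :
  (forall e, 0 < e -> exists N, forall i j, (N <= i)%N -> (N <= j)%N ->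
     `|u i - u j| < e) -> exists l, tends u l.
Proof.
move=> hu; pose A : set R := [set x | exists N, forall i, (N <= i)%N -> x <= u i].
have bnd e : 0 < e -> exists N,
    A (u N - e) /\ (forall x, A x -> x <= u N + e) /\
    forall i, (N <= i)%N -> `|u i - u N| < e.
  move=> e0; have [N hN] := hu _ e0; exists N; split; last split.
  - exists N => i Ni; have := hN i N Ni (leqnn N).
    by rewrite ltr_norml => /andP[]; lra.
  - move=> x [M hM]; have := hM _ (leq_maxr N M).
    have := hN _ N (leq_maxl N M) (leqnn N).
    by rewrite ltr_norml => /andP[]; lra.
  - by move=> i Ni; apply: hN.
have supA : has_sup A.
  have [N [AN [uN _]]] := bnd 1 ltr01.
  by split; [exists (u N - 1) | exists (u N + 1)].
exists (sup A) => e e0; have [N [AN [uN hN]]] := bnd (e / 2) ltac:(lra).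
exists N => i Ni.
have s1 : u N - e / 2 <= sup A by apply: ub_le_sup => //; case: supA.
have s2 : sup A <= u N + e / 2 by apply: ge_sup => //; case: supA.
by have := hN i Ni; rewrite !ltr_norml => /andP[? ?]; apply/andP; split; lra.
Qed.

End Limits.

Section Completion.
Local Open Scope quotient_scope.
Variables (R : realType) (K : fieldType) (v : K -> R).
Hypothesis hv : is_absolute_value v.

Definition cauchy_seq (u : nat -> K) := forall e : R, 0 < e ->
  exists N, forall i j, (N <= i)%N -> (N <= j)%N -> v (u i - u j) < e.

Definition cauchy_pred : {pred nat -> K} := fun u => `[< cauchy_seq u >].

Lemma cauchy_bounded u : cauchy_seq u -> exists2 B : R, 0 < B & forall i, v (u i) <= B.
Proof.
move=> hu; have [N hN] := hu 1 ltr01.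
exists (1 + v (u N) + \sum_(i < N) v (u i)).
  by rewrite !ltr_wpDr ?sumr_ge0 ?av_ge0 // => i _; apply: av_ge0.
move=> i; have [Ni|iN] := leqP N i.
  apply: le_trans (_ : v (u N) + v (u i - u N) <= _).
    by have := avD hv (u N) (u i - u N); rewrite addrC subrK.
  have := hN i N Ni (leqnn N).
  have : 0 <= \sum_(i < N) v (u i) by rewrite sumr_ge0 // => j _; apply: av_ge0.
  by lra.
rewrite (bigD1 (Ordinal iN)) //=.
have := av_ge0 hv (u N).
have : 0 <= \sum_(j < N | j != Ordinal iN) v (u j).
  by rewrite sumr_ge0 // => j _; apply: av_ge0.
by lra.
Qed.

Lemma cauchy_pred_subring : subring_closed cauchy_pred.
Proof.
split.
- apply/asboolP => e e0; exists 0%N => i j _ _.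
  by rewrite (_ : _ - _ = 0) ?av0 // subrr.
- move=> a b /asboolP ha /asboolP hb; apply/asboolP => e e0.
  have [N hN] := ha (e / 2) ltac:(lra); have [M hM] := hb (e / 2) ltac:(lra).
  exists (maxn N M) => i j; rewrite !geq_max => /andP[Ni Mi] /andP[Nj Mj].
  have := hN i j Ni Nj; have := hM j i Mj Mi.
  have := avD hv (a i - a j) (b j - b i).
  have -> : a i - a j + (b j - b i) = (a - b) i - (a - b) j.
    by rewrite !fctE; ring.
  by lra.
- move=> a b /asboolP ha /asboolP hb; apply/asboolP => e e0.
  have [A A0 hA] := cauchy_bounded ha; have [B B0 hB] := cauchy_bounded hb.
  have [N hN] := ha (e / (2 * B)) ltac:(by rewrite divr_gt0 // mulr_gt0).
  have [M hM] := hb (e / (2 * A)) ltac:(by rewrite divr_gt0 // mulr_gt0).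
  exists (maxn N M) => i j; rewrite !geq_max => /andP[Ni Mi] /andP[Nj Mj].
  have -> : (a * b) i - (a * b) j = (a i - a j) * b i + a j * (b i - b j).
    by rewrite !fctE; ring.
  apply: le_lt_trans (avD hv _ _) _; rewrite !(avM hv).
  have := hN i j Ni Nj; have := hM i j Mi Mj.
  rewrite !ltr_pdivlMr ?mulr_gt0 // => h1 h2.
  have k1 : v (a i - a j) * v (b i) <= v (a i - a j) * B by rewrite ler_wpM2l ?av_ge0.
  have k2 : v (a j) * v (b i - b j) <= A * v (b i - b j) by rewrite ler_wpM2r ?av_ge0.
  lra.
Qed.

HB.instance Definition _ :=
  GRing.isSubringClosed.Build (nat -> K) cauchy_pred cauchy_pred_subring.

Record cseq := CSeq { cseq_val :> nat -> K; _ : cauchy_pred cseq_val }.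
HB.instance Definition _ := [isSub for cseq_val].
HB.instance Definition _ := [Choice of cseq by <:].
HB.instance Definition _ := [SubChoice_isSubComNzRing of cseq by <:].

Lemma cseqP (u : cseq) : cauchy_seq u.
Proof. by case: u => u hu; apply/asboolP. Qed.

Definition null_seq (u : nat -> K) := forall e : R, 0 < e ->
  exists N, forall i, (N <= i)%N -> v (u i) < e.

Definition null_pred : {pred cseq} := fun u => `[< null_seq u >].

Lemma null_pred_ideal : idealr_closed null_pred.
Proof.
split.
- by apply/asboolP => e e0; exists 0%N => i _; rewrite (_ : _ i = 0) ?av0.
- apply/negP => /asboolP h; have [N hN] := h 1 ltr01.
  by have := hN N (leqnn N); rewrite (_ : _ N = 1) ?av1 // ltxx.
move=> a x y /asboolP hx /asboolP hy; apply/asboolP => e e0.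
have [A A0 hA] := cauchy_bounded (cseqP a).
have [N hN] := hx (e / (2 * A)) ltac:(by rewrite divr_gt0 // mulr_gt0).
have [M hM] := hy (e / 2) ltac:(lra).
exists (maxn N M) => i; rewrite !geq_max => /andP[Ni Mi].
rewrite (_ : _ i = a i * x i + y i) //.
apply: le_lt_trans (avD hv _ _) _; rewrite !(avM hv).
have := hN i Ni; have := hM i Mi; rewrite !ltr_pdivlMr ?mulr_gt0 // => h1 h2.
have k : v (a i) * v (x i) <= A * v (x i) by rewrite ler_wpM2r ?av_ge0.
lra.
Qed.

HB.instance Definition _ := isIdealr.Build cseq null_pred null_pred_ideal.

Definition completion := {ideal_quot null_pred}.
HB.instance Definition _ := GRing.ComNzRing.on completion.

Definition to_completion (u : cseq) : completion := \pi_(completion) u.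

Lemma to_completionB u u' : to_completion u - to_completion u' = to_completion (u - u').
Proof. by rewrite /to_completion rmorphB. Qed.

Lemma to_completionM u u' : to_completion u * to_completion u' = to_completion (u * u').
Proof. by rewrite /to_completion rmorphM. Qed.

Lemma to_completionD u u' : to_completion u + to_completion u' = to_completion (u + u').
Proof. by rewrite /to_completion rmorphD. Qed.

Lemma to_completion1 : to_completion 1 = 1.
Proof. exact: rmorph1. Qed.

Lemma to_completion_surj x : exists u, x = to_completion u.
Proof. by exists (repr x); rewrite /to_completion reprK. Qed.

Lemma to_completion_eq0 u : to_completion u = 0 <-> null_seq u.
Proof.
rewrite -(rmorph0 \pi_(completion)).
split=> [/eqP|h].
  by rewrite /to_completion -Quotient.idealrBE subr0 => /asboolP.
by apply/eqP; rewrite /to_completion -Quotient.idealrBE subr0; apply/asboolP.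
Qed.

(** A Cauchy sequence that is not null stays away from 0 eventually, so its termwise inverse is
    Cauchy. The finitely many zero terms are harmless, as 0^-1 = 0 and only the tail matters. *)
Lemma completion_inverse (x : completion) : x != 0 -> exists y, y * x = 1.
Proof.
have [u ->] := to_completion_surj x => /eqP u0.
have [d d0 [N hN]] : exists2 d, 0 < d & exists N, forall i, (N <= i)%N -> d <= v (u i).
  apply: contrapT => H; apply: u0; apply/to_completion_eq0 => e e0.
  have [N hN] := cseqP u (e := e / 2) ltac:(lra).
  exists N => i Ni; rewrite ltNge; apply/negP => ei; apply: H.
  exists (e / 2); first by lra.
  exists N => j Nj; have := av_sub_dist hv (u i) (u j); have := hN i j Ni Nj.
  by have := ler_norm (v (u i) - v (u j)); lra.
have cinv : cauchy_seq (fun i => (u i)^-1).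
  move=> e e0; have dd : 0 < e * d ^+ 2 by rewrite mulr_gt0 ?exprn_gt0.
  have [M hM] := cseqP u dd.
  exists (maxn N M) => i j; rewrite !geq_max => /andP[Ni Mi] /andP[Nj Mj].
  have ui := hN i Ni; have uj := hN j Nj.
  have ui0 : u i != 0 by rewrite -(av_eq0 hv) gt_eqF // (lt_le_trans d0).
  have uj0 : u j != 0 by rewrite -(av_eq0 hv) gt_eqF // (lt_le_trans d0).
  have -> : (u i)^-1 - (u j)^-1 = (u j - u i) / (u i * u j) by field; apply/andP.
  rewrite !(avM hv) (avV hv) (avM hv) ltr_pdivrMr ?mulr_gt0 ?(lt_le_trans d0) //.
  apply: lt_le_trans (hM j i Mj Mi) _; rewrite ler_wpM2l ?(ltW e0) //.
  by rewrite expr2 ler_pM // ltW.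
exists (to_completion (CSeq (introT (asboolP _) cinv))).
rewrite to_completionM; apply/eqP; rewrite -subr_eq0; apply/eqP.
rewrite -to_completion1 to_completionB.
apply/to_completion_eq0 => e e0; exists N => i Ni.
have ui0 : u i != 0 by rewrite -(av_eq0 hv) gt_eqF // (lt_le_trans d0) // hN.
rewrite (_ : cseq_val _ _ = 0) ?av0 //.
by apply/eqP; rewrite subr_eq0; apply/eqP; exact: mulVf.
Qed.

Definition completion_inv (x : completion) : completion :=
  if x == 0 then 0 else xget 0 [set y | y * x = 1].

Lemma completion_mulVf (x : completion) : x != 0 -> completion_inv x * x = 1.
Proof.
move=> x0; rewrite /completion_inv (negPf x0).
have [y yx] := completion_inverse x0.
exact: (@xgetPex _ 0 [set y | y * x = 1] (ex_intro _ y yx)).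
Qed.

Lemma completion_inv0 : completion_inv 0 = 0.
Proof. by rewrite /completion_inv eqxx. Qed.

HB.instance Definition _ :=
  GRing.ComNzRing_isField.Build completion completion_mulVf completion_inv0.

Definition completion_abs (x : completion) : R :=
  xget 0 [set l | tends (fun i => v (repr x i)) l].

(** The limit is taken along a chosen representative, but any other one differs from it by a null
    sequence. *)
Lemma completion_absP (u : cseq) :
  tends (fun i => v (u i)) (completion_abs (to_completion u)).
Proof.
have ex (w : cseq) : exists l, tends (fun i => v (w i)) l.
  apply: real_cauchy_tends => e e0; have [N hN] := cseqP w e0.
  exists N => i j Ni Nj; apply: le_lt_trans (hN i j Ni Nj).
  exact: av_sub_dist.
set x := to_completion u.
have hx : tends (fun i => v (repr x i)) (completion_abs x).
  have [l hl] := ex (repr x).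
  exact: (@xgetPex _ 0 [set l | tends (fun i => v (repr x i)) l] (ex_intro _ l hl)).
have nul : null_seq (u - repr x).
  by apply/to_completion_eq0; rewrite -to_completionB {2}/to_completion reprK subrr.
move=> e e0; have [N hN] := hx (e / 2) ltac:(lra).
have [M hM] := nul (e / 2) ltac:(lra).
exists (maxn N M) => i; rewrite geq_max => /andP[Ni Mi].
have := hN i Ni; have := hM i Mi.
have := av_sub_dist hv (u i) (repr x i).
rewrite (_ : (u - repr x : cseq) i = u i - repr x i) // => h1 h2 h3.
have -> : v (u i) - completion_abs x = (v (u i) - v (repr x i)) +
   (v (repr x i) - completion_abs x) by ring.
by apply: le_lt_trans (ler_normD _ _) _; lra.
Qed.

Lemma completion_abs_le (u : cseq) (e : R) N :
  (forall i, (N <= i)%N -> v (u i) <= e) -> completion_abs (to_completion u) <= e.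
Proof.
move=> h; apply/ler_addgt0Pl => d d0.
have [M hM] := completion_absP u d0.
have := hM _ (leq_maxr N M); have := h _ (leq_maxl N M).
by rewrite ltr_norml => ? /andP[? ?]; lra.
Qed.

Lemma completion_abs_eq (u : cseq) l :
  tends (fun i => v (u i)) l -> completion_abs (to_completion u) = l.
Proof. exact: tends_unique (completion_absP u). Qed.

Lemma completion_abs_value : is_absolute_value completion_abs.
Proof.
have ge0 x : 0 <= completion_abs x.
  have [u ->] := to_completion_surj x.
  apply/ler_addgt0Pl => d d0; have [M hM] := completion_absP u d0.
  have := hM M (leqnn M); have := av_ge0 hv (u M).
  by rewrite ltr_norml => ? /andP[? ?]; lra.
split=> // [x|x y|x y].
- have [u ->] := to_completion_surj x; rewrite to_completion_eq0; split=> h.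
    move=> e e0; have [N hN] := completion_absP u e0; exists N => i Ni.
    by have := hN i Ni; rewrite h subr0 ger0_norm ?av_ge0.
  apply/eqP; rewrite eq_le ge0 andbT; apply/ler_addgt0Pl => e e0; rewrite addr0.
  have [N hN] := h e e0.
  by apply: (completion_abs_le (N := N)) => i Ni; apply/ltW/hN.
- have [a ->] := to_completion_surj x; have [b ->] := to_completion_surj y.
  rewrite to_completionM; apply: completion_abs_eq => e e0.
  set A := completion_abs _; set B := completion_abs _.
  have [Bb Bb0 hB] := cauchy_bounded (cseqP b).
  have A0 : 0 <= A by apply: ge0.
  have [N hN] := completion_absP a (e := e / (2 * Bb)) ltac:(by rewrite divr_gt0 // mulr_gt0).
  have A1 : 0 < A + 1 by lra.
  have [M hM] := completion_absP b (e := e / (2 * (A + 1))) ltac:(by rewrite divr_gt0 // mulr_gt0).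
  exists (maxn N M) => i; rewrite geq_max => /andP[Ni Mi].
  rewrite (_ : (a * b : cseq) i = a i * b i) // (avM hv).
  have -> : v (a i) * v (b i) - A * B = (v (a i) - A) * v (b i) + A * (v (b i) - B) by ring.
  apply: le_lt_trans (ler_normD _ _) _; rewrite !normrM.
  have := hN i Ni; have := hM i Mi; rewrite -/A -/B.
  rewrite !ltr_pdivlMr ?mulr_gt0 // => h1 h2.
  rewrite (ger0_norm (av_ge0 hv _)) (ger0_norm A0).
  have k1 : `|v (a i) - A| * v (b i) <= `|v (a i) - A| * Bb by rewrite ler_wpM2l.
  have k2 : A * `|v (b i) - B| <= (A + 1) * `|v (b i) - B|.
    by rewrite ler_wpM2r // lerDl.
  lra.
- have [a ->] := to_completion_surj x; have [b ->] := to_completion_surj y.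
  rewrite to_completionD; apply/ler_addgt0Pl => e e0.
  set A := completion_abs (to_completion a); set B := completion_abs (to_completion b).
  have [N hN] := completion_absP a (e := e / 2) ltac:(lra).
  have [M hM] := completion_absP b (e := e / 2) ltac:(lra).
  apply: (completion_abs_le (N := maxn N M)) => i; rewrite geq_max => /andP[Ni Mi].
  apply: le_trans (avD hv (a i) (b i)) _.
  have := hN i Ni; have := hM i Mi; rewrite -/A -/B !ltr_norml.
  by move=> /andP[? ?] /andP[? ?]; lra.
Qed.

Lemma const_cauchy (x : K) : cauchy_pred (fun=> x).
Proof. by apply/asboolP => e e0; exists 0%N => i j _ _; rewrite subrr av0. Qed.

Definition completion_embed (x : K) : completion :=
  to_completion (CSeq (const_cauchy x)).

Lemma completion_embed_additive : zmod_morphism completion_embed.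
Proof.
by move=> x y; rewrite /completion_embed to_completionB; congr to_completion; apply: val_inj.
Qed.

Lemma completion_embed_multiplicative : monoid_morphism completion_embed.
Proof.
split=> [|x y]; first by rewrite -to_completion1; congr to_completion; apply: val_inj.
by rewrite /completion_embed to_completionM; congr to_completion; apply: val_inj.
Qed.

HB.instance Definition _ := GRing.isZmodMorphism.Build K completion completion_embed
  completion_embed_additive.
HB.instance Definition _ := GRing.isMonoidMorphism.Build K completion completion_embed
  completion_embed_multiplicative.

Lemma completion_abs_embed x : completion_abs (completion_embed x) = v x.
Proof.
by apply: completion_abs_eq => e e0; exists 0%N => i _; rewrite subrr normr0.
Qed.

Lemma completion_dense (y : completion) (e : R) : 0 < e ->
  exists x, completion_abs (y - completion_embed x) < e.
Proof.
move=> e0; have [u ->] := to_completion_surj y.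
have [N hN] := cseqP u (e := e / 2) ltac:(lra).
exists (u N); apply: (@le_lt_trans _ _ (e / 2)); last by lra.
rewrite to_completionB; apply: (completion_abs_le (N := N)) => i Ni.
by apply/ltW; apply: hN.
Qed.

(** Approximate the k-th term by an element x k of K within 1/(k + 1); the sequence x is Cauchy in
    K, and its class is the limit. *)
Lemma completion_complete : abs_complete completion_abs.
Proof.
move=> s hs; have hw := completion_abs_value.
have ex k : exists x, completion_abs (s k - completion_embed x) < k.+1%:R^-1.
  by apply: completion_dense; rewrite invr_gt0.
have [x hx] := choice ex.
have cx : cauchy_pred x.
  apply/asboolP => e e0; have [N hN] := hs (e / 3) ltac:(lra).
  have [M hM] := inv_succ_lt (e := e / 3) ltac:(lra).
  exists (maxn N M) => i j; rewrite !geq_max => /andP[Ni Mi] /andP[Nj Mj].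
  have lt3 k : (M <= k)%N -> completion_abs (s k - completion_embed (x k)) < e / 3.
    by move=> Mk; apply: lt_trans (hx k) (hM k Mk).
  rewrite -completion_abs_embed rmorphB.
  have -> : e = e / 3 + (e / 3 + e / 3) by lra.
  apply: (av_dist_lt hw (y := s i)); first by rewrite (avB hw); apply: lt3.
  by apply: (av_dist_lt hw (y := s j)); [apply: hN | apply: lt3].
exists (to_completion (CSeq cx)) => e e0.
have [N hN] := cseqP (CSeq cx) (e := e / 3) ltac:(lra).
have [M hM] := inv_succ_lt (e := e / 3) ltac:(lra).
exists (maxn N M) => i; rewrite geq_max => /andP[Ni Mi].
have -> : e = e / 3 + (e / 3 + e / 3) by lra.
apply: (av_dist_lt hw (y := completion_embed (x i))).
  by apply: lt_trans (hx i) (hM i Mi).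
apply: (@le_lt_trans _ _ (e / 3)); last by lra.
rewrite to_completionB; apply: (completion_abs_le (N := N)) => j Nj.
by apply/ltW; apply: (hN i j).
Qed.

End Completion.

(** This ensures that [local_degree] is a genuine degree and not the default of [xget]. *)
Lemma completion_exists (R : realType) (K : fieldType) (v : K -> R) :
  is_absolute_value v ->
  exists (L : fieldType) (w : L -> R) (f : {rmorphism K -> L}), is_completion v w f.
Proof.
move=> hv; exists (completion hv), (@completion_abs _ _ _ hv), (@completion_embed _ _ _ hv).
split.
- exact: completion_abs_value.
- exact: completion_abs_embed.
- rewrite -subTset => y _ e e0; have [x hx] := completion_dense y e0.
  by exists (completion_embed hv x) => //; exists x.
- exact: completion_complete.
Qed.

(** * Local degrees through free and dense tuples *)

Lemma indep_free (K : fieldExtType rat) (T : finType) (e : T -> K) :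
  (forall c : T -> rat, \sum_i c i *: e i = 0 -> forall i, c i = 0) ->
  free [tuple e (enum_val i) | i < #|T|].
Proof.
move=> he; apply/freeP => k hk t.
rewrite -[t]enum_valK; apply: (he (fun x => k (enum_rank x))).
rewrite -[RHS]hk (reindex (@enum_val T T)) /=; last exact/onW_bij/enum_val_bij.
apply: eq_bigr => j _; rewrite enum_valK (nth_map j) ?size_enum_ord //.
by rewrite nth_ord_enum.
Qed.

Lemma indep_card (K : fieldExtType rat) (T : finType) (e : T -> K) :
  (forall c : T -> rat, \sum_i c i *: e i = 0 -> forall i, c i = 0) ->
  (#|T| <= \dim {:K})%N.
Proof.
move=> /indep_free; set X := [tuple _ | _ < _] => fX.
by have := dimvS (subvf <<X>>%VS); rewrite (eqnP fX) size_tuple.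
Qed.

Section FreeTuples.
Variables (R : realType) (K : fieldExtType rat) (v : K -> R).
Hypothesis hv : is_absolute_value v.

(* For v extending an absolute value of the rationals, a v-free tuple stays
   independent over the completion of the rationals.  A maximal one has a
   v-dense span, so its size is the local degree at v. *)
Definition vfree (t : nat) (e : 'I_t -> K) := exists2 k : R, 0 < k &
  forall (c : 'I_t -> rat) s, k * v (c s)%:A <= v (\sum_i c i *: e i).

Definition vdense (t : nat) (e : 'I_t -> K) := forall z (eps : R), 0 < eps ->
  exists c : 'I_t -> rat, v (z - \sum_i c i *: e i) < eps.

Lemma avZ (c : rat) x : v (c *: x) = v c%:A * v x.
Proof. by rewrite -(avM hv) mulr_algl. Qed.

Lemma vfree_indep t (e : 'I_t -> K) : vfree e ->
  forall c : 'I_t -> rat, \sum_i c i *: e i = 0 -> forall i, c i = 0.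
Proof.
move=> [k k0 he] c c0 i; have := he c i; rewrite c0 av0 // pmulr_rle0 // => vc.
have : v (c i)%:A == 0 by rewrite eq_le vc av_ge0.
by rewrite av_eq0 // scaler_eq0 oner_eq0 orbF => /eqP.
Qed.

Lemma vfree_le_dim t (e : 'I_t -> K) : vfree e -> (t <= \dim {:K})%N.
Proof. by move/vfree_indep/indep_card; rewrite card_ord. Qed.

Lemma vfree_extend t (e : 'I_t -> K) : vfree e -> ~ vdense e ->
  exists e' : 'I_t.+1 -> K, vfree e'.
Proof.
move=> [k k0 he] /existsNP[z /existsNP[d /not_implyP[d0 /forallNP hz]]].
have {}hz c : d <= v (z - \sum_i c i *: e i) by rewrite leNgt; apply/negP/hz.
have hz' a c : v a%:A * d <= v (a *: z + \sum_i c i *: e i).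
  have [->|a0] := eqVneq a 0; first by rewrite scale0r av0 // mul0r av_ge0.
  have -> : a *: z + \sum_i c i *: e i = a *: (z - \sum_i (- (c i / a)) *: e i).
    rewrite scalerBr scaler_sumr; congr (_ + _); rewrite -sumrN.
    by apply: eq_bigr => i _; rewrite scalerA mulrN scaleNr opprK mulrC divfK.
  by rewrite (avZ a (z - _)) ler_wpM2l ?av_ge0.
exists (fun i => oapp e z (unlift ord0 i)).
(* With S the part of the combination without z and c the coefficient of z, d v(c) <= v(c z + S), so
   v(S) <= v(c z + S) + v(c) v(z) <= B v(c z + S). *)
pose B := 1 + v z / d; have B0 : 0 < B.
  by rewrite ltr_pwDl // divr_ge0 ?av_ge0 // ltW.
exists (Num.min d (k / B)); first by rewrite lt_min d0 divr_gt0.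
move=> c s; rewrite big_ord_recl unlift_none /=.
under eq_bigr do rewrite liftK /=.
case: (unliftP ord0 s) => [j|] ->.
  apply: (@le_trans _ _ ((k / B) * v (c (lift ord0 j))%:A)).
    by rewrite ler_wpM2r ?av_ge0 // ge_min lexx orbT.
  rewrite mulrAC ler_pdivrMr //.
  apply: le_trans (he (fun i => c (lift ord0 i)) j) _.
  set S := \sum_i _; have := hz' (c ord0) (fun i => c (lift ord0 i)).
  rewrite -/S => hc.
  have hS : v S <= v (c ord0 *: z + S) + v (c ord0 *: z).
    have {1}-> : S = (c ord0 *: z + S) - c ord0 *: z by rewrite addrC addKr.
    by apply: le_trans (avD hv _ _) _; rewrite avN.
  apply: le_trans hS _; rewrite /B mulrDr mulr1 lerD2l.
  by rewrite (avZ (c ord0) z) mulrA ler_pdivlMr // mulrAC ler_wpM2r ?av_ge0.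
apply: (@le_trans _ _ (d * v (c ord0)%:A)).
  by rewrite ler_wpM2r ?av_ge0 // ge_min lexx.
by rewrite mulrC; apply: hz'.
Qed.

Lemma vfree_dense_exists : exists t (e : 'I_t -> K), vfree e /\ vdense e.
Proof.
pose P t := `[< exists e : 'I_t -> K, vfree e >].
have P0 : exists t, P t.
  exists 0%N; apply/asboolP; exists (fun=> 0); exists 1 => //.
  by move=> c [].
have Pb t : P t -> (t <= \dim {:K})%N by move=> /asboolP[e /vfree_le_dim].
have [t /asboolP[e fe] tmax] := ex_maxnP P0 Pb.
exists t, e; split=> //; apply: contrapT => /(vfree_extend fe)[e' fe'].
by have := tmax t.+1 (introT (asboolP _) (ex_intro _ e' fe')); rewrite ltnn.
Qed.

Lemma vdense_gt0 t (e : 'I_t -> K) : vdense e -> (0 < t)%N.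
Proof.
case: t e => // e he; have [c] := he 1 1 ltr01.
by rewrite big_ord0 subr0 av1 // ltxx.
Qed.

End FreeTuples.

Section SubfieldLinearAlgebra.
Variables (L : fieldType) (F : set L).
Hypotheses (F0 : F 0) (F1 : F 1) (FB : forall x y, F x -> F y -> F (x - y))
  (FM : forall x y, F x -> F y -> F (x * y)) (FV : forall x, F x -> F x^-1).

Let FN x : F x -> F (- x). Proof. by rewrite -sub0r; apply: FB. Qed.
Let FD x y : F x -> F y -> F (x + y).
Proof. by move=> Fx Fy; rewrite -[y]opprK; apply/FB/FN. Qed.
Let Fsum (I : finType) (f : I -> L) : (forall i, F (f i)) -> F (\sum_i f i).
Proof. by move=> Ff; elim/big_ind: _. Qed.

(** Gaussian elimination with a pivot in the first equation. It is carried out on a subset [F] of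
    [L] closed under the field operations because the closure of the rationals in a completion is
    given as a set. *)
Lemma subfield_kernel n t (A : 'I_t -> 'I_n -> L) : (n < t)%N ->
  (forall s i, F (A s i)) -> exists x : 'I_t -> L,
  [/\ forall s, F (x s), exists s, x s != 0 & forall i, \sum_s x s * A s i = 0].
Proof.
elim: n t A => [|n IH] [//|t] A nt FA.
  exists (fun=> 1); split=> //; last by case.
  by exists ord0; rewrite oner_eq0.
have [/existsP[p pA]|/existsPn colz] := boolP [exists p, A p ord0 != 0]; last first.
  have [|s i|x [Fx x0 xA]] := IH t.+1 (fun s i => A s (lift ord0 i)).
  - exact: ltnW.
  - exact: FA.
  exists x; split=> // i; case: (unliftP ord0 i) => [j ->//|->].
  rewrite big1 // => s _; have := colz s; rewrite negbK => /eqP ->.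
  by rewrite mulr0.
pose A' s i := A (lift p s) (lift ord0 i) -
  A (lift p s) ord0 / A p ord0 * A p (lift ord0 i).
have [//|s i|x [Fx [s0 x0] xA]] := IH t A'.
  by apply: FB => //; apply: FM => //; apply: FM => //; apply: FV.
pose y := - \sum_s x s * (A (lift p s) ord0 / A p ord0).
exists (fun s => oapp x y (unlift p s)).
have split_sum i : \sum_s oapp x y (unlift p s) * A s i =
    y * A p i + \sum_s x s * A (lift p s) i.
  rewrite (bigD1_ord p) //= unlift_none /=; congr (_ + _).
  by apply: eq_bigr => s _; rewrite liftK.
split.
- move=> s; case: (unliftP p s) => [j _|_] //=.
  apply: FN; apply: Fsum => j; apply: FM => //; apply: FM => //; exact: FV.
- by exists (lift p s0); rewrite liftK.
move=> i; rewrite split_sum; case: (unliftP ord0 i) => [j ->|->].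
  rewrite -[RHS](xA j) /y mulNr mulr_suml addrC -sumrB.
  by apply: eq_bigr => s _; rewrite /A' mulrBr !mulrA.
rewrite /y mulNr mulr_suml addrC -sumrB big1 // => s _.
by rewrite -!mulrA mulVf // mulr1 subrr.
Qed.

Lemma has_degree_le n t : has_degree_over F n -> has_degree_over F t -> (t <= n)%N.
Proof.
move=> [b hb] [e he]; rewrite leqNgt; apply/negP => nt.
have ex s : exists c : 'rV[L]_n, (forall i, F (c 0 i)) /\ e s = \sum_i c 0 i * b i.
  by have [c [hc _]] := hb (e s); exists c.
have [A hA] := choice ex.
have [s i|x [Fx [s x0] xA]] := subfield_kernel (A := fun s i => A s 0 i) nt.
  by have [] := hA s.
have xe : \sum_s x s * e s = 0.
  under eq_bigr do rewrite (hA _).2 mulr_sumr.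
  rewrite exchange_big big1 //= => i _.
  under eq_bigr do rewrite mulrA.
  by rewrite -mulr_suml xA mul0r.
have [c [_ uc]] := he 0.
have e1 : c = \row_s x s.
  apply: uc; split=> [i|]; first by rewrite mxE.
  by rewrite -[LHS]xe; apply: eq_bigr => i _; rewrite mxE.
have e2 : c = 0.
  apply: uc; split=> [i|]; first by rewrite mxE.
  by rewrite big1 // => i _; rewrite mxE mul0r.
by move: x0; have := congr1 (fun c : 'rV_t => c 0 s) e1; rewrite e2 !mxE => <-; rewrite eqxx.
Qed.

End SubfieldLinearAlgebra.

Lemma rmorph_ratr (K : fieldExtType rat) (L : fieldType) (f : {rmorphism K -> L}) (r : rat) :
  f r%:A = ratr r.
Proof.
rewrite -[r in LHS]divq_num_den /ratr.
have -> : (((numq r)%:~R / (denq r)%:~R : rat)%:A : K) = (numq r)%:~R / (denq r)%:~R.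
  by rewrite [LHS](fmorph_div (in_alg K)) !rmorph_int.
by rewrite fmorph_div !rmorph_int.
Qed.

Section LocalDegree.
Variables (R : realType) (K : fieldExtType rat) (v : K -> R).
Hypothesis hv : is_absolute_value v.

Section InCompletion.
Variables (L : fieldType) (w : L -> R) (f : {rmorphism K -> L}).
Hypothesis hw : is_completion v w f.
Local Notation F := (abs_closure w (range (ratr : rat -> L))).

Let hwa : is_absolute_value w. Proof. by case: hw. Qed.
Let hf x : w (f x) = v x. Proof. by case: hw. Qed.

Lemma closure_subfield : [/\ F 0, F 1, forall x y, F x -> F y -> F (x - y),
  forall x y, F x -> F y -> F (x * y) & forall x, F x -> F x^-1].
Proof.
have FQ (r : rat) : F (ratr r).
  by move=> e e0; exists (ratr r); [exists r | rewrite subrr av0].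
have Fapp x : F x <-> forall e, 0 < e -> exists r : rat, w (x - f r%:A) < e.
  split=> h e e0; first by have [_ [r _ <-]] := h e e0; exists r; rewrite rmorph_ratr.
  by have [r hr] := h e e0; exists (ratr r); [exists r | rewrite -(rmorph_ratr f)].
have FM x y : F x -> F y -> F (x * y).
  move=> /Fapp hx /Fapp hy; apply/Fapp => e e0.
  have y0 : 0 < w y + 1 by rewrite ltr_wpDl // av_ge0.
  have [r hr] := hx (e / (2 * (w y + 1))) ltac:(by rewrite divr_gt0 // mulr_gt0).
  have r0 : 0 < w (f r%:A) + 1 by rewrite ltr_wpDl // av_ge0.
  have [s hs] := hy (e / (2 * (w (f r%:A) + 1))) ltac:(by rewrite divr_gt0 // mulr_gt0).
  exists (r * s).
  have -> : x * y - f (r * s)%:A = (x - f r%:A) * y + f r%:A * (y - f s%:A).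
    rewrite (_ : f (r * s)%:A = f r%:A * f s%:A); first by ring.
    by rewrite -rmorphM -scalerAl mul1r scalerA.
  apply: le_lt_trans (avD hwa _ _) _; rewrite !(avM hwa).
  move: hr hs; rewrite !ltr_pdivlMr ?mulr_gt0 // => hr hs.
  have := av_ge0 hwa (x - f r%:A); have := av_ge0 hwa (y - f s%:A).
  have := av_ge0 hwa y; have := av_ge0 hwa (f r%:A).
  by nra.
split=> //.
- by have := FQ 0; rewrite -(rmorph_ratr f) scale0r rmorph0.
- by have := FQ 1; rewrite -(rmorph_ratr f) scale1r rmorph1.
- move=> x y /Fapp hx /Fapp hy; apply/Fapp => e e0.
  have [r hr] := hx (e / 2) ltac:(lra); have [s hs] := hy (e / 2) ltac:(lra).
  exists (r - s); rewrite scalerBl rmorphB.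
  have -> : x - y - (f r%:A - f s%:A) = (x - f r%:A) + (f s%:A - y) by ring.
  apply: le_lt_trans (avD hwa _ _) _; rewrite [w (_ - y)](avB hwa); lra.
- move=> x Fx; have [->|x0] := eqVneq x 0.
    by rewrite invr0; have := FQ 0; rewrite -(rmorph_ratr f) scale0r rmorph0.
  move/Fapp: Fx => hx; apply/Fapp => e e0.
  have wx : 0 < w x by rewrite av_gt0.
  (* The first bound gives w r > w x / 2, so r is not 0; the second absorbs the denominator x r of
     x^-1 - r^-1. *)
  have [r hr] := hx (Num.min (w x / 2) (e * w x ^+ 2 / 2))
    ltac:(by rewrite lt_min !divr_gt0 ?mulr_gt0 ?exprn_gt0).
  move: hr; rewrite lt_min => /andP[hr1 hr2].
  have wr : w x / 2 < w (f r%:A).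
    have := av_sub_dist hwa x (f r%:A); have := ler_norm (w x - w (f r%:A)); lra.
  have r0 : r != 0.
    apply: contraTneq wr => ->; rewrite scale0r rmorph0 av0 // -leNgt.
    by rewrite divr_ge0 // av_ge0.
  exists r^-1.
  have fr0 : f r%:A != 0 by rewrite fmorph_eq0 scaler_eq0 oner_eq0 orbF.
  have -> : f (r^-1)%:A = (f r%:A)^-1.
    by rewrite -fmorphV -[in RHS](fmorphV (in_alg K)).
  have -> : x^-1 - (f r%:A)^-1 = (f r%:A - x) / (x * f r%:A).
    by field; rewrite fr0 x0.
  rewrite (avM hwa) (avV hwa) (avM hwa) (avB hwa) ltr_pdivrMr ?mulr_gt0 ?av_gt0 //.
  apply: lt_le_trans hr2 _.
  rewrite (_ : e * w x ^+ 2 / 2 = e * (w x * (w x / 2))); last by field.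
  by rewrite !ler_pM2l // ltW.
Qed.

(** The constant of [vfree] makes the rational coordinates of approximations to y Cauchy, and their
    limits are coordinates of y. The same constant gives uniqueness, after approximating the scalars
    by rationals. *)
Lemma completion_degree t (e : 'I_t -> K) : vfree v e -> vdense v e ->
  has_degree_over F t.
Proof.
move=> [k k0 fe] de; have [F0 F1 FB FM FV] := closure_subfield.
have dense_f y eps : 0 < eps -> exists x, w (y - f x) < eps.
  case: hw => _ _ hd _ e0; have : abs_closure w (range f) y by rewrite hd.
  by move=> /(_ _ e0)[_ [x _ <-] ?]; exists x.
have fsum (c : 'I_t -> rat) : f (\sum_i c i *: e i) = \sum_i f (c i)%:A * f (e i).
  by rewrite rmorph_sum; apply: eq_bigr => i _; rewrite -[c i *: e i]mulr_algl rmorphM.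
exists (fun i => f (e i)) => y.
have ex n : exists c : 'I_t -> rat, w (y - f (\sum_i c i *: e i)) < n.+1%:R^-1.
  have n0 : 0 < (n.+1%:R^-1 : R) / 2 by rewrite divr_gt0 // invr_gt0.
  have [z hz] := dense_f y _ n0; have [c hc] := de z _ n0.
  exists c; rewrite [X in _ < X]splitr.
  by apply: (av_dist_lt hwa hz); rewrite -rmorphB hf.
have [c hc] := choice ex.
have small eps : 0 < eps -> exists N, forall n, (N <= n)%N ->
    w (y - f (\sum_i c n i *: e i)) < eps.
  move=> /inv_succ_lt[N hN]; exists N => n Nn.
  exact: lt_trans (hc n) (hN n Nn).
have cau i : exists l, forall eps, 0 < eps -> exists N, forall n, (N <= n)%N ->
    w (f (c n i)%:A - l) < eps.
  case: hw => _ _ _ hcomp; apply: hcomp => eps e0.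
  have [N hN] := small (k * eps / 2) ltac:(by rewrite divr_gt0 // mulr_gt0).
  exists N => a b Na Nb; rewrite -rmorphB hf -scalerBl -(ltr_pM2l k0).
  apply: le_lt_trans (fe (fun i => c a i - c b i) i) _.
  under eq_bigr do rewrite scalerBl.
  rewrite sumrB -hf rmorphB (_ : k * eps = k * eps / 2 + k * eps / 2); last by lra.
  by apply: (av_dist_lt hwa (y := y)); [rewrite (avB hwa); apply: hN | apply: hN].
have [l hl] := choice cau.
have Fl i : F (l i).
  move=> eps e0; have [N hN] := hl i eps e0.
  exists (ratr (c N i)); first by exists (c N i).
  by rewrite -(rmorph_ratr f) (avB hwa); apply: hN.
pose B := \sum_i w (f (e i)).
have B0 : 0 <= B by rewrite sumr_ge0 // => i _; apply: av_ge0.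
have Be i : w (f (e i)) <= B.
  rewrite /B (bigD1 i) //= lerDl sumr_ge0 // => j _; exact: av_ge0.
have sum_le (x z : 'I_t -> L) eps : 0 <= eps -> (forall i, w (x i - z i) <= eps) ->
    w (\sum_i x i * f (e i) - \sum_i z i * f (e i)) <= eps * B.
  move=> e0 h; rewrite -sumrB; apply: le_trans (av_sum hwa _ _ _) _.
  rewrite /B mulr_sumr; apply: ler_sum => i _.
  by rewrite -mulrBl (avM hwa) ler_wpM2r ?av_ge0.
have common (I : finType) (P : I -> nat -> Prop) :
    (forall i, exists N, forall n, (N <= n)%N -> P i n) ->
    exists N, forall n, (N <= n)%N -> forall i, P i n.
  move=> /choice[N hN]; exists (\max_i N i) => n Nn i; apply: hN.
  by apply: leq_trans Nn; apply: leq_bigmax.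
have ly : y = \sum_i l i * f (e i).
  apply/eqP; rewrite -subr_eq0 -(av_eq0 hwa) eq_le av_ge0 // andbT.
  apply/ler_addgt0Pl => eps e0; rewrite addr0.
  have d0 : 0 < eps / 2 / (B + 1) by rewrite !divr_gt0 // ltr_wpDl.
  have [N hN] := small (eps / 2) ltac:(lra).
  have [M hM] := common _ _ (fun i => hl i _ d0).
  pose n := maxn N M; apply: le_trans (av_dist hwa _ (f (\sum_i c n i *: e i)) _) _.
  have h1 := hN n (leq_maxl _ _).
  have h2 := hM n (leq_maxr _ _).
  have := sum_le (fun i => f (c n i)%:A) l _ (ltW d0) (fun i => ltW (h2 i)).
  rewrite fsum; have : eps / 2 / (B + 1) * B <= eps / 2.
    rewrite mulrAC ler_pdivrMr ?ltr_wpDl // ler_pM2l ?divr_gt0 //; lra.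
  by move: h1; rewrite fsum; lra.
have inj (D : 'I_t -> L) : (forall i, F (D i)) -> \sum_i D i * f (e i) = 0 ->
    forall i, D i = 0.
  move=> FDi D0 i; apply/eqP; rewrite -(av_eq0 hwa) eq_le av_ge0 // andbT.
  apply/ler_addgt0Pl => eps e0; rewrite addr0.
  (* With rational r j within d of each D j, freeness gives k w(r i) <= d B, hence k w(D i) <= k d +
     d B, which is at most k eps for this d. *)
  have d0 : 0 < k * eps / (k + B + 1).
    by rewrite divr_gt0 ?mulr_gt0 // ltr_wpDl // addr_ge0 // ltW.
  set d := k * eps / _ in d0.
  have exr j : exists r : rat, w (D j - f r%:A) < d.
    by have [_ [r _ <-] hr] := FDi j _ d0; exists r; rewrite rmorph_ratr.
  have [r hr] := choice exr.
  have := fe r i; rewrite -hf -[v (\sum_ _ _)]hf fsum => h1.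
  have h2 := sum_le (fun i => f (r i)%:A) D d (ltW d0)
    ltac:(by move=> j; rewrite (avB hwa); exact/ltW/hr).
  rewrite D0 subr0 in h2.
  have h3 := hr i; have h4 : w (D i) <= d + w (f (r i)%:A).
    have := avD hwa (D i - f (r i)%:A) (f (r i)%:A); rewrite subrK; lra.
  rewrite -(ler_pM2l k0); have dE : d * (k + B + 1) = k * eps.
    by rewrite divfK // gt_eqF // ltr_wpDl // addr_ge0 // ltW.
  by nra.
exists (\row_i l i); split.
  split=> [i|]; first by rewrite mxE.
  by rewrite [LHS]ly; apply: eq_bigr => i _; rewrite mxE.
move=> x [Fx yx]; apply/rowP => i; rewrite mxE; apply/eqP; rewrite -subr_eq0; apply/eqP.
apply: (inj (fun i => l i - x 0 i)) => [j|]; first exact: FB.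
under eq_bigr do rewrite mulrBl.
by rewrite sumrB -ly -yx subrr.
Qed.

End InCompletion.

(** [local_degree] refers to some completion and some basis. In every completion the image of [e] is
    a basis, and the size of a basis over a subfield is determined. *)
Lemma local_degreeE t (e : 'I_t -> K) : vfree v e -> vdense v e ->
  local_degree v = t.
Proof.
move=> fe de.
have ex : exists n, is_local_degree v n.
  have [L [w [f hw]]] := completion_exists hv.
  by exists t, L, w, f; split=> //; apply: (completion_degree hw fe de).
have [L [w [f [hw hd]]]] := @xgetPex _ 0%N _ ex.
have hd' := completion_degree hw fe de.
have [F0 F1 FB FM FV] := closure_subfield hw.
apply/eqP; rewrite eqn_leq /local_degree.
by rewrite (has_degree_le F0 F1 FB FM FV hd hd') (has_degree_le F0 F1 FB FM FV hd' hd).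
Qed.

End LocalDegree.

(** * Weak approximation and the sum of local degrees *)

Lemma exp_eventually_large (R : realType) (a B : R) : 1 < a ->
  exists N, forall k, (N <= k)%N -> B < a ^+ k.
Proof.
move=> a1; have [N hN] := exp_beats_linear `|B| a1.
exists N => k Nk; apply: le_lt_trans (ler_norm B) _.
apply: (@le_lt_trans _ _ (`|B| * N.+1%:R)).
  by apply: ler_peMr => //; rewrite ler1n.
by apply: lt_le_trans hN _; rewrite ler_eXn2l.
Qed.

Lemma exp_eventually_small (R : realType) (a e : R) : 0 <= a -> a < 1 -> 0 < e ->
  exists N, forall k, (N <= k)%N -> a ^+ k < e.
Proof.
move=> a0 a1 e0; have [->|an0] := eqVneq a 0.
  by exists 1%N => k k1; rewrite expr0n gtn_eqF.
have ap : 0 < a by rewrite lt_def an0.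
have [|N hN] := @exp_eventually_large R a^-1 e^-1; first by rewrite invf_gt1.
exists N => k /hN; rewrite exprVn ltf_pV2 ?posrE ?exprn_gt0 //.
Qed.

Lemma eventually_all (T : eqType) (s : seq T) (P : T -> nat -> Prop) :
  (forall x, x \in s -> exists N, forall k, (N <= k)%N -> P x k) ->
  exists N, forall k, (N <= k)%N -> forall x, x \in s -> P x k.
Proof.
elim: s => [|y s IH] h; first by exists 0%N.
have [N hN] := h y (mem_head _ _).
have [|M hM] := IH; first by move=> x xs; apply: h; rewrite in_cons xs orbT.
exists (maxn N M) => k; rewrite geq_max => /andP[Nk Mk] x.
by rewrite in_cons => /orP[/eqP->|]; [apply: hN | apply: hM].
Qed.

Section WeakApproximation.
Variables (R : realType) (K : fieldExtType rat) (w : rat -> R).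
Hypothesis hw : std_abs_rat w.

Definition extends_abs (v : K -> R) :=
  is_absolute_value v /\ forall r : rat, v r%:A = w r.

(** Both v and u take the value w r at a rational r, so dividing x^k by an r with u(x^k) < w r <
    v(x^k) puts the two values on either side of 1. *)
Lemma separate_two (v u : K -> R) : extends_abs v -> extends_abs u -> v <> u ->
  exists x, 1 < v x /\ u x < 1.
Proof.
move=> [hv vw] [hu uw] vu.
have [x ux] : exists x, u x < v x.
  have [x /eqP xx] : exists x, v x <> u x.
    by apply/existsNP => h; apply: vu; rewrite funeqE.
  have [|vx] := ltP (u x) (v x); first by exists x.
  have {xx}vx : v x < u x by rewrite lt_neqAle xx.
  have x0 : x != 0 by apply: contraTneq vx => ->; rewrite !av0 // ltxx.
  by exists x^-1; rewrite (avV hv) (avV hu) ltf_pV2 // posrE av_gt0.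
have [k [r [k0 r0 ur rv]]] := std_abs_separates hw (av_ge0 hu x) ux.
have wr : 0 < w r by rewrite (av_gt0 (std_abs_value hw)).
exists (x ^+ k / r%:A).
rewrite (avM hv) (avM hu) (avV hv) (avV hu) (avX hv) (avX hu) vw uw.
by rewrite ltr_pdivlMr // mul1r ltr_pdivrMr // mul1r.
Qed.

Section Moebius.
Variable v : K -> R.
Hypothesis hv : is_absolute_value v.

(** The map z |-> z / (1 + z) sends large elements near 1 and small ones near 0. At z = x^k, with k
    growing, it turns separation at the threshold 1 into approximation. *)
Lemma av_moebius_large z : 1 < v z -> v (z / (1 + z) - 1) <= (v z - 1)^-1.
Proof.
move=> z1; have z0 : v z - 1 <= v (1 + z).
  have := avD hv (1 + z) (-1); rewrite avN // av1 // addrAC subrr add0r; lra.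
have z0' : 1 + z != 0 by rewrite -(av_eq0 hv) gt_eqF //; lra.
have -> : z / (1 + z) - 1 = - (1 + z)^-1 by field.
by rewrite avN // avV // lef_pV2 // posrE; lra.
Qed.

Lemma av_moebius_small z : v z < 1 -> v (z / (1 + z)) <= v z / (1 - v z).
Proof.
move=> z1; have z0 : 1 - v z <= v (1 + z).
  have := avD hv (1 + z) (- z); rewrite avN // addrK av1 //; lra.
rewrite avM // avV // ler_wpM2l ?av_ge0 // lef_pV2 // posrE; lra.
Qed.

Lemma av_moebius_near1 x e : 1 < v x -> 0 < e ->
  exists N, forall k, (N <= k)%N -> v (x ^+ k / (1 + x ^+ k) - 1) < e.
Proof.
move=> x1 e0; have [N hN] := @exp_eventually_large R (v x) (1 + e^-1) x1.
exists N => k /hN hk; have e0' : 0 < e^-1 by rewrite invr_gt0.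
apply: le_lt_trans (av_moebius_large _) _; rewrite avX //; first by lra.
rewrite invf_plt ?posrE //; lra.
Qed.

Lemma av_moebius_near0 x e : v x < 1 -> 0 < e ->
  exists N, forall k, (N <= k)%N -> v (x ^+ k / (1 + x ^+ k)) < e.
Proof.
move=> x1 e0; have [|N hN] := @exp_eventually_small R (v x) (Num.min (1 / 2) (e / 2)) (av_ge0 hv x) x1.
  by rewrite lt_min !divr_gt0.
exists N => k /hN; rewrite lt_min => /andP[h1 h2].
apply: le_lt_trans (av_moebius_small _) _; rewrite avX //; first by lra.
rewrite ltr_pdivrMr; last by lra.
by have : e * (1 / 2) <= e * (1 - v x ^+ k); [rewrite ler_pM2l //; lra | lra].
Qed.

End Moebius.

(** Induction on [us]: x separates v from the old absolute values, y separates v from the new u.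
    Depending on whether u x is below, above or equal to 1, the element is x, y x^k / (1 + x^k) or
    x^N y. *)
Lemma separate_many (v : K -> R) (us : seq (K -> R)) : extends_abs v ->
  (forall u, u \in us -> extends_abs u) -> v \notin us ->
  exists x, 1 < v x /\ forall u, u \in us -> u x < 1.
Proof.
move=> ev; have hv := ev.1; elim: us => [|u us IH] hus.
  have [k [r [k0 r0 r1 _]]] := @std_abs_separates _ _ hw 1 2 ler01 ltac:(lra).
  by exists r%:A; split=> //; rewrite ev.2; move: r1; rewrite expr1n.
rewrite in_cons negb_or => /andP[vu vus].
have eu := hus u (mem_head _ _); have hu := eu.1.
have {}hus u' : u' \in us -> extends_abs u'.
  by move=> h; apply: hus; rewrite in_cons h orbT.
have [x [vx ux]] := IH hus vus.
have [y [vy uy]] := separate_two ev eu (elimN eqP vu).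
have y0 u' : u' \in us -> 0 < (u' y)^-1.
  move=> /hus hu'; rewrite invr_gt0; apply: (av_gt0 hu'.1).
  by rewrite -(av_eq0 hv) gt_eqF // (lt_trans ltr01).
have [ux1|ux1|ux1] := ltgtP (u x) 1.
- exists x; split=> // u'; rewrite in_cons => /orP[/eqP->//|]; exact: ux.
- have [N1 h1] := av_moebius_near1 hv (e := 1 - (v y)^-1) vx ltac:(by rewrite subr_gt0 invf_lt1 // (lt_trans ltr01)).
  have uy0 : 0 < u y by rewrite av_gt0 // -(av_eq0 hv) gt_eqF // (lt_trans ltr01).
  have [N2 h2] := av_moebius_near1 hu (e := (u y)^-1 - 1) ux1 ltac:(by rewrite subr_gt0 invf_gt1).
  have [N3 h3] := eventually_all (s := us)
    (P := fun u' k => u' (x ^+ k / (1 + x ^+ k)) < (u' y)^-1)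
    (fun u' h => av_moebius_near0 (hus u' h).1 (ux u' h) (y0 u' h)).
  pose k := maxn N1 (maxn N2 N3).
  have {}h1 := h1 k (leq_maxl _ _).
  have {}h2 := h2 k ltac:(by rewrite /k leq_max leq_maxl orbT).
  have {}h3 := h3 k ltac:(by rewrite /k !leq_max leqnn !orbT).
  set z := x ^+ k / _ in h1 h2 h3; exists (y * z).
  have vy0 : 0 < v y by apply: lt_trans vy.
  split.
    rewrite avM // -ltr_pdivrMl // mulr1.
    have := av_sub_dist hv 1 z; rewrite av1 // (avB hv) ler_norml => /andP[_]; lra.
  move=> u'; rewrite in_cons => /orP[/eqP->|u'us].
    rewrite avM // -ltr_pdivlMl // mulr1.
    have := av_sub_dist hu z 1; rewrite av1 // ler_norml => /andP[_]; lra.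
  have hu' := (hus u' u'us).1.
  have u'y : 0 < u' y by have := y0 _ u'us; rewrite invr_gt0.
  by rewrite (avM hu') -ltr_pdivlMl // mulr1; apply: h3.
- have [N hN] := eventually_all (s := us)
    (P := fun u' k => u' x ^+ k < (u' y)^-1)
    (fun u' h => exp_eventually_small (av_ge0 (hus u' h).1 x) (ux u' h) (y0 u' h)).
  exists (x ^+ N * y); split.
    rewrite avM // avX //; apply: lt_le_trans vy _.
    by rewrite ler_peMl ?av_ge0 // exprn_ege1 // ltW.
  move=> u'; rewrite in_cons => /orP[/eqP->|u'us].
    by rewrite avM // avX // ux1 expr1n mul1r.
  have hu' := (hus u' u'us).1.
  have u'y : 0 < u' y by have := y0 _ u'us; rewrite invr_gt0.
  rewrite avM // avX // -ltr_pdivlMr // mul1r; exact: hN.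
Qed.

Lemma weak_approximation (v : K -> R) (us : seq (K -> R)) e : extends_abs v ->
  (forall u, u \in us -> extends_abs u) -> v \notin us -> 0 < e ->
  exists z, v (z - 1) < e /\ forall u, u \in us -> u z < e.
Proof.
move=> ev hus vus e0; have [x [vx ux]] := separate_many ev hus vus.
have [N1 h1] := av_moebius_near1 ev.1 vx e0.
have [N2 h2] := eventually_all (s := us)
    (P := fun u' k => u' (x ^+ k / (1 + x ^+ k)) < e)
    (fun u' h => av_moebius_near0 (hus u' h).1 (ux u' h) e0).
pose k := maxn N1 N2; exists (x ^+ k / (1 + x ^+ k)).
by split; [apply: h1; apply: leq_maxl | apply: h2; apply: leq_maxr].
Qed.

(** Multiply the tuple at each place by an element near 1 there and near 0 at the other places. The
    union of the scaled tuples is still independent over the rationals, so its size is at most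
    [K : Q]. *)
Lemma sum_vfree_le (vs : seq (K -> R)) (t : (K -> R) -> nat) : uniq vs ->
  (forall v, v \in vs -> extends_abs v /\ exists e : 'I_(t v) -> K, vfree v e) ->
  (\sum_(v <- vs) t v <= \dim {:K})%N.
Proof.
move=> uvs hvs.
pose V (i : 'I_(size vs)) := tnth (in_tuple vs) i.
have Vvs i : V i \in vs by apply: mem_tnth.
have Vinj : injective V.
  move=> i j /eqP; rewrite /V !(tnth_nth (fun=> 0)) nth_uniq // => /eqP.
  exact: val_inj.
have eV i : extends_abs (V i) by have [] := hvs _ (Vvs i).
have hV i : is_absolute_value (V i) by have [] := eV i.
have ex i : exists e : 'I_(t (V i)) -> K, vfree (V i) e by have [] := hvs _ (Vvs i).
pose T := {i : 'I_(size vs) & 'I_(t (V i))}.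
have cardT : #|{: T}| = (\sum_(v <- vs) t v)%N.
  rewrite card_tagged sumnE big_map big_enum /= (big_tnth _ _ vs).
  by apply: eq_bigr => i _; rewrite card_ord.
pose e i := projT1 (cid (ex i)).
have he i : vfree (V i) (e i) by rewrite /e; case: cid.
have exk i : exists k : R, 0 < k /\
    forall (c : 'I_(t (V i)) -> rat) s, k * V i (c s)%:A <= V i (\sum_j c j *: e i j).
  by have [k k0 hk] := he i; exists k.
have [k hk] := choice exk.
pose B i := 1 + \sum_(x : T) V i (e (tag x) (tagged x)).
have B0 i : 0 < B i.
  by rewrite ltr_wpDr // sumr_ge0 // => x _; apply: av_ge0.
have exz i : exists z, V i (z - 1) < k i / B i /\
    forall j, j != i -> V j z < k j / B j.
  have m0 : exists2 m : R, 0 < m & forall j, m <= k j / B j.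
    exists (\big[Num.min/1]_j (k j / B j)).
      elim/big_rec: _ => // j x _ x0; rewrite lt_min x0 divr_gt0 //.
      by have [] := hk j.
    by move=> j; rewrite (bigD1 j) //= ge_min lexx.
  have [m mp hm] := m0.
  have [||z [z1 z2]] := @weak_approximation (V i) (rem (V i) vs) m (eV i) _ _ mp.
  - by move=> u /mem_rem/hvs[].
  - by rewrite mem_rem_uniq // !inE eqxx.
  exists z; split; first exact: lt_le_trans (hm i).
  move=> j ji; apply: lt_le_trans (hm j); apply: z2.
  by rewrite mem_rem_uniq // !inE Vvs andbT; apply: contra ji => /eqP/Vinj->.
have [z hz] := choice exz.
rewrite -cardT; apply: (@indep_card _ _ (fun x : T => z (tag x) * e (tag x) (tagged x))).
move=> c c0.
have hsw := std_abs_value hw.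
have [x0|noT] := pickP (fun x : T => true); last by move=> x; have := noT x.
move=> _.
pose x1 := [arg max_(x > x0) w (c x)]%O.
have x1P x : w (c x) <= w (c x1).
  by rewrite /x1; case: arg_maxP => // y _; apply.
suff x10 : w (c x1) = 0.
  move=> x; apply/eqP; rewrite -(av_eq0 hsw) eq_le av_ge0 // andbT -x10; exact: x1P.
apply/eqP; rewrite eq_le av_ge0 // andbT leNgt; apply/negP => cx.
case: x1 x1P cx => i s /= x1P cx.
have [ki hki] := hk i.
have := hki (fun j => c (Tagged (fun i => 'I_(t (V i))) j)) s; rewrite (eV i).2.
apply/negP; rewrite -ltNge.
(* Subtracting the relation [c0] from the block of the place i leaves the factors 1 - z i and - z j,
   all small at i. As the largest coefficient sits in this block, its freeness constant k i is
   contradicted. *)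
pose D (x : T) := (if tag x == i then 1 - z (tag x) else - z (tag x)) * e (tag x) (tagged x).
have -> : \sum_j c (Tagged (fun i => 'I_(t (V i))) j) *: e i j = \sum_x c x *: D x.
  rewrite /D.
  have -> : \sum_x c x *: ((if tag x == i then 1 - z (tag x) else - z (tag x)) * e (tag x) (tagged x))
   = \sum_(x : T | tag x == i) c x *: e (tag x) (tagged x)
     - \sum_x c x *: (z (tag x) * e (tag x) (tagged x)).
    rewrite [X in _ = X - _]big_mkcond -sumrB; apply: eq_bigr => x _.
    case: eqP => _; first by rewrite mulrBl mul1r scalerBr.
    by rewrite mulNr scalerN sub0r.
  rewrite c0 subr0.
  pose G j (u : 'I_(t (V j))) := c (Tagged (fun i => 'I_(t (V i))) u) *: e j u.
  transitivity (\sum_(j | j == i) \sum_(u | true) G j u).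
    by rewrite big_pred1_eq.
  rewrite sig_big_dep; apply: eq_big => [x|[j u] _]; [by rewrite andbT|by []].
have wc x : V i (c x)%:A = w (c x) by rewrite (eV i).2.
pose M := w (c (Tagged (fun i => 'I_(t (V i))) s)).
have Bi : (V i (\sum_x c x *: D x) <= \sum_(x : T) M *
    (V i (if tag x == i then 1 - z (tag x) else - z (tag x)) * V i (e (tag x) (tagged x))))%R.
  apply: le_trans (av_sum (hV i) _ _ _) _; apply: ler_sum => x _.
  rewrite (avZ (hV i)) wc /D (avM (hV i)).
  by rewrite ler_wpM2r ?mulr_ge0 ?av_ge0 //; apply: x1P.
apply: le_lt_trans Bi _.
rewrite -mulr_sumr mulrC ltr_pM2r //.
apply: (@le_lt_trans _ _ (\sum_(x : T) k i / B i * V i (e (tag x) (tagged x)))).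
  apply: ler_sum => x _; rewrite ler_wpM2r ?av_ge0 //.
  case: (tag x =P i) => [xi|/eqP xi].
    by rewrite (avB (hV i)) xi; case: (hz i) => /ltW.
  rewrite avN // ltW //; have [_] := hz (tag x); apply.
  by rewrite eq_sym.
rewrite -mulr_sumr mulrAC ltr_pdivrMr // ltr_pM2l //.
by rewrite /B ltrDr.
Qed.

End WeakApproximation.

(** * Extension of p-adic absolute values to number fields *)

Section FiniteMax.
Variables (R : realType) (T : finType).
Implicit Types F : T -> R.

Definition fmax F := \big[Num.max/0]_t F t.

Lemma fmax_ge F t : F t <= fmax F.
Proof. by rewrite /fmax (bigD1 t) //= le_max lexx. Qed.

Lemma fmax_le F B : 0 <= B -> (forall t, F t <= B) -> fmax F <= B.
Proof. by move=> B0 h; rewrite /fmax; elim/big_rec: _ => // t x _ xB; rewrite ge_max h. Qed.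

Lemma fmax_ge0 F : 0 <= fmax F.
Proof. by rewrite /fmax; elim/big_rec: _ => // t x _ x0; rewrite le_max x0 orbT. Qed.

End FiniteMax.

Lemma inf_mul_ge (R : realType) (X Y : set R) c :
  (exists x, X x) -> (exists y, Y y) -> (forall x, X x -> 0 <= x) ->
  (forall y, Y y -> 0 <= y) -> (forall x y, X x -> Y y -> c <= x * y) ->
  c <= inf X * inf Y.
Proof.
move=> [x0 Xx0] [y0 Yy0] X0 Y0 h.
have iX : 0 <= inf X by apply: lb_le_inf; [exists x0 | move=> x /X0].
have iY : 0 <= inf Y by apply: lb_le_inf; [exists y0 | move=> x /Y0].
have hy x : X x -> c <= x * inf Y.
  move=> Xx; have := X0 _ Xx; rewrite le_eqVlt => /orP[/eqP x00|xp].
    by rewrite -x00 mul0r; have := h _ _ Xx Yy0; rewrite -x00 mul0r.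
  rewrite -ler_pdivrMl //; apply: lb_le_inf; first by exists y0.
  by move=> y Yy; rewrite ler_pdivrMl // h.
move: iY; rewrite le_eqVlt => /orP[/eqP y00|yp].
  by rewrite -y00 mulr0; have := hy _ Xx0; rewrite -y00 mulr0.
rewrite -ler_pdivrMr //; apply: lb_le_inf; first by exists x0.
by move=> x Xx; rewrite ler_pdivrMr // hy.
Qed.

Lemma inf_lt_ex (R : realType) (X : set R) c : (exists x, X x) -> inf X < c ->
  exists2 x, X x & x < c.
Proof.
move=> [x0 Xx0] h; apply: contrapT => H; move: h; apply/negP; rewrite -leNgt.
apply: lb_le_inf; first by exists x0.
by move=> x Xx; rewrite leNgt; apply/negP => xc; apply: H; exists x.
Qed.

Section PadicExtension.
Variables (R : realType) (E : fieldExtType rat) (p : nat).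
Hypothesis pp : prime p.
Local Notation w := (padic_abs R p).

Let hw : is_absolute_value w. Proof. exact: padic_abs_value. Qed.
Let hwu : ultrametric w. Proof. exact: padic_ultrametric. Qed.

(* A minimal seminorm r is an absolute value.  Its spectral radius and the
   functions y |-> inf_k r (x ^+ k * y) / r x ^+ k are smaller seminorms, so they
   equal r; the first gives r (x ^+ 2) = r x ^+ 2, the others multiplicativity. *)
Definition padic_seminorm (r : E -> R) := [/\ (forall x, 0 <= r x) /\ r 1 = 1,
  forall x y, r (x * y) <= r x * r y, forall x y, r (x + y) <= Num.max (r x) (r y)
  & forall (c : rat) x, r (c *: x) <= w c * r x].

(** The largest value of an entry in the matrix of multiplication by x. In the ultrametric setting a
    product of matrices costs no factor depending on the dimension, so this is submultiplicative. *)
Lemma padic_seminorm_exists : exists r, padic_seminorm r.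
Proof.
pose X := vbasis {:E}; pose I := 'I_(\dim {:E}).
have fX : free X := basis_free (vbasisP {:E}).
pose a (x : E) (ij : I * I) : rat := coord X ij.1 (x * X`_ij.2).
have XE (x : E) : x = \sum_i coord X i x *: X`_i.
  exact/coord_vbasis/memvf.
exists (fun x => fmax (fun ij => w (a x ij))).
have d0 : (0 < \dim {:E})%N := adim_gt0 {:E}.
have a1 ij : a 1 ij = (ij.1 == ij.2)%:R by rewrite /a mul1r coord_free // eq_sym.
split; [split=> [x|] | move=> x y | move=> x y | move=> c x].
- exact: fmax_ge0.
- apply/eqP; rewrite eq_le; apply/andP; split.
    apply: fmax_le => // ij; rewrite a1; case: eqP => _; by rewrite ?av1 ?av0.
  apply: le_trans (fmax_ge _ (Ordinal d0, Ordinal d0)).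
  by rewrite a1 eqxx av1.
- apply: fmax_le => [|[i j]]; first by rewrite mulr_ge0 ?fmax_ge0.
  have -> : a (x * y) (i, j) = \sum_k a x (i, k) * a y (k, j).
    rewrite /a /= -mulrA {1}(XE (y * X`_j)) mulr_sumr linear_sum.
    by apply: eq_bigr => k _; rewrite -scalerAr linearZ /= mulrC.
  apply: (ultra_sum hw hwu) => [|k _]; first by rewrite mulr_ge0 ?fmax_ge0.
  rewrite (avM hw) ler_pM ?av_ge0 //.
    exact: (fmax_ge (fun ij => w (a x ij)) (i, k)).
  exact: (fmax_ge (fun ij => w (a y ij)) (k, j)).
- apply: fmax_le => [|ij]; first by rewrite le_max fmax_ge0.
  rewrite /a mulrDl linearD; apply: le_trans (hwu _ _) _.
  rewrite ge_max !le_max; apply/andP; split; apply/orP; [left|right].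
    exact: (fmax_ge (fun ij => w (a x ij)) ij).
  exact: (fmax_ge (fun ij => w (a y ij)) ij).
- apply: fmax_le => [|ij]; first by rewrite mulr_ge0 ?av_ge0 ?fmax_ge0.
  rewrite /a -scalerAl linearZ /= (avM hw) ler_wpM2l ?av_ge0 //.
  exact: (fmax_ge (fun ij => w (a x ij)) ij).
Qed.

(** An inequality between infima involves two members of the family; comparability supplies a single
    member below both, to which the seminorm law applies. *)
Lemma padic_seminorm_chain (A : set (E -> R)) :
  (exists r, A r) -> (forall r, A r -> padic_seminorm r) ->
  (forall r s, A r -> A s -> (forall x, r x <= s x) \/ (forall x, s x <= r x)) ->
  padic_seminorm (fun x => inf [set r x | r in A]).
Proof.
move=> [r0 Ar0] hA tot.
have ne x : exists y, [set r x | r in A] y by exists (r0 x), r0.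
have ge0 x y : [set r x | r in A] y -> 0 <= y.
  by move=> [r /hA[[h _] _ _ _] <-].
have lb x : has_lbound [set r x | r in A] by exists 0 => y /ge0.
have le_r r x : A r -> inf [set r x | r in A] <= r x.
  by move=> Ar; apply: ge_inf => //; exists r.
have small r s : A r -> A s -> exists2 t, A t & forall x, t x <= r x /\ t x <= s x.
  move=> Ar As; have [rs|sr] := tot r s Ar As; first by exists r.
  by exists s.
split; [split=> [x|] | move=> x y | move=> x y | move=> c x].
- by apply: lb_le_inf => // y; apply: ge0.
- apply/eqP; rewrite eq_le; apply/andP; split.
    by apply: le_trans (le_r _ _ Ar0) _; have [[_ ->]] := hA _ Ar0.
  by apply: lb_le_inf => // y [r /hA[[_ ->] _ _ _] <-].
- apply: inf_mul_ge => // [z|z|_ _ [r Ar <-] [s As <-]]; [exact: ge0|exact: ge0|].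
  have [t At ht] := small r s Ar As; have [[t0 _] tM _ _] := hA t At.
  apply: le_trans (le_r t _ At) _; apply: le_trans (tM x y) _.
  by apply: ler_pM => //; have [? ?] := ht x; have [? ?] := ht y.
- rewrite leNgt; apply/negP; rewrite gt_max => /andP[hx hy].
  have [_ [r Ar <-] rx] := inf_lt_ex (ne x) hx.
  have [_ [s As <-] sy] := inf_lt_ex (ne y) hy.
  have [t At ht] := small r s Ar As; have [_ _ tD _] := hA t At.
  have := le_r t (x + y) At; apply/negP; rewrite -ltNge.
  apply: le_lt_trans (tD x y) _; rewrite gt_max.
  by rewrite (le_lt_trans (ht x).1 rx) (le_lt_trans (ht y).2 sy).
- have := av_ge0 hw c; rewrite le_eqVlt => /orP[/eqP c0|cp].
    rewrite -c0 mul0r; apply: le_trans (le_r _ _ Ar0) _.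
    by have [_ _ _ /(_ c x)] := hA _ Ar0; rewrite -c0 mul0r.
  rewrite -ler_pdivrMl //; apply: lb_le_inf => // _ [r Ar <-].
  rewrite ler_pdivrMl //; apply: le_trans (le_r _ _ Ar) _.
  by have [_ _ _] := hA _ Ar; apply.
Qed.

Lemma padic_seminorm_minimal : exists2 r, padic_seminorm r &
  forall s, padic_seminorm s -> (forall x, s x <= r x) -> s = r.
Proof.
have [r0 hr0] := padic_seminorm_exists.
pose T := {r : E -> R | padic_seminorm r}.
(* The order is reversed, since [Zorn] yields maximal elements. *)
pose le (a b : T) : bool := `[< forall x, sval b x <= sval a x >].
have [a|a b c /asboolP ab /asboolP bc|[a Pa] [b Pb] /asboolP /= ab /asboolP /= ba|A tot|t ht] := @Zorn T le.
- by apply/asboolP.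
- by apply/asboolP => x; apply: le_trans (bc x) (ab x).
- apply: eq_exist; rewrite funeqE => x; apply/eqP; rewrite eq_le.
  by rewrite ab ba.
- have [[a Aa]|noA] := pselect (exists a, A a); last first.
    by exists (exist _ r0 hr0) => a Aa; case: noA; exists a.
  pose B := [set sval a | a in A].
  have hB : padic_seminorm (fun x => inf [set r x | r in B]).
    apply: padic_seminorm_chain.
    - by exists (sval a), a.
    - by move=> _ [b Ab <-]; apply: svalP.
    move=> _ _ [b Ab <-] [c Ac <-].
    by have [/asboolP h|/asboolP h] := tot b c Ab Ac; [right|left].
  exists (exist _ _ hB) => b Ab; apply/asboolP => x /=.
  apply: ge_inf; last by exists (sval b) => //; exists b.
  exists 0 => _ [_ [c Ac <-] <-]; by have [[]] := svalP c.
exists (sval t); first exact: svalP.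
move=> s hs st; have := ht (exist _ s hs) (introT (asboolP _) st).
by move/(congr1 sval).
Qed.

Section Spectral.
Variable r : E -> R.
Hypothesis hr : padic_seminorm r.

Let r_ge0 x : 0 <= r x. Proof. by have [[]] := hr. Qed.
Let r1 : r 1 = 1. Proof. by have [[]] := hr. Qed.
Let rM x y : r (x * y) <= r x * r y. Proof. by have [] := hr. Qed.
Let rD x y : r (x + y) <= Num.max (r x) (r y). Proof. by have [] := hr. Qed.
Let rZ (c : rat) x : r (c *: x) <= w c * r x. Proof. by have [] := hr. Qed.

Let rX x k : r (x ^+ k) <= r x ^+ k.
Proof.
elim: k => [|k IH]; first by rewrite !expr0 r1.
by rewrite !exprS; apply: le_trans (rM _ _) _; rewrite ler_wpM2l.
Qed.

Let r0 : r 0 = 0.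
Proof.
apply/eqP; rewrite eq_le r_ge0 andbT -(scale0r (1 : E)).
by apply: le_trans (rZ _ _) _; rewrite av0 // mul0r.
Qed.

Let r_sum (I : Type) (s : seq I) (F : I -> E) B : 0 <= B -> (forall i, r (F i) <= B) ->
  r (\sum_(i <- s) F i) <= B.
Proof.
move=> B0 hB; elim/big_rec: _ => [|i x _ xB]; first by rewrite r0.
by apply: le_trans (rD _ _) _; rewrite ge_max hB.
Qed.

(** The infimum of these t is the spectral radius lim r(x^k)^(1/k). The free constant C survives
    products and binomial sums, so no limit has to be formed. *)
Definition power_bound (x : E) : set R :=
  [set t | 0 < t /\ exists C : R, forall k, r (x ^+ k) <= C * t ^+ k].

Definition spectral x := inf (power_bound x).

Lemma power_bound_gt x t : r x < t -> power_bound x t.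
Proof.
move=> xt; have t0 : 0 < t by apply: le_lt_trans xt.
split=> //; exists 1 => k; rewrite mul1r; apply: le_trans (rX _ _) _.
by apply: lerXn2r; rewrite ?nnegrE ?r_ge0 ?ltW.
Qed.

Let pb_ne x : exists t, power_bound x t.
Proof. by exists (r x + 1); apply: power_bound_gt; rewrite ltrDl. Qed.

Let pb_ge0 x t : power_bound x t -> 0 <= t. Proof. by case=> /ltW. Qed.

Let pb_lb x : has_lbound (power_bound x). Proof. by exists 0 => t /pb_ge0. Qed.

Let sp_le x t : power_bound x t -> spectral x <= t.
Proof. by move=> h; apply: ge_inf. Qed.

Lemma power_bound_of_spectral x t : spectral x < t -> power_bound x t.
Proof.
move=> /(inf_lt_ex (pb_ne x))[s [s0 [C hC]] st].
have C0 : 0 <= C by have := hC 0%N; rewrite !expr0 r1 mulr1; apply: le_trans.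
split; first exact: lt_trans st.
exists C => k; apply: le_trans (hC k) _; rewrite ler_wpM2l //.
by apply: lerXn2r; rewrite ?nnegrE ?ltW // (lt_trans s0).
Qed.

Lemma spectral_le x : spectral x <= r x.
Proof.
apply/ler_addgt0Pl => e e0; apply: sp_le; apply: power_bound_gt.
by rewrite ltrDr.
Qed.

Lemma spectral_seminorm : padic_seminorm spectral.
Proof.
split; [split=> [x|] | move=> x y | move=> x y | move=> c x].
- by apply: lb_le_inf => // t /pb_ge0.
- apply/eqP; rewrite eq_le; apply/andP; split; first by rewrite -[leRHS]r1 spectral_le.
  apply: lb_le_inf => // t [t0 [C hC]].
  have C0 : 0 <= C by have := hC 0%N; rewrite !expr0 r1 mulr1; apply: le_trans.
  apply: (@le_of_exp_le R C) => // [|N]; first exact: ltW.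
  rewrite expr1n; have := hC N; rewrite expr1n r1 => h; apply: le_trans h _.
  by apply: ler_wpM2r; [rewrite exprn_ge0 // ltW | rewrite ler_peMr // ler1n].
- apply: inf_mul_ge => // [t|t|t s [t0 [C hC]] [s0 [D hD]]]; [exact: pb_ge0|exact: pb_ge0|].
  apply: sp_le; split; first exact: mulr_gt0.
  exists (C * D) => k; rewrite !exprMn mulrACA; apply: le_trans (rM _ _) _.
  exact: ler_pM.
- apply/ler_addgt0Pl => e e0.
  pose c := e + Num.max (spectral x) (spectral y); rewrite -/c; have c0 : 0 < c.
    by rewrite ltr_pwDl // le_max; apply/orP; left; apply: lb_le_inf => // t /pb_ge0.
  have [_ [C hC]] : power_bound x c.
    by apply: power_bound_of_spectral; rewrite /c ltr_pwDl // le_max lexx.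
  have [_ [D hD]] : power_bound y c.
    by apply: power_bound_of_spectral; rewrite /c ltr_pwDl // le_max lexx orbT.
  have C0 : 0 <= C by have := hC 0%N; rewrite !expr0 r1 mulr1; apply: le_trans.
  have D0 : 0 <= D by have := hD 0%N; rewrite !expr0 r1 mulr1; apply: le_trans.
  apply: sp_le; split=> //; exists (C * D) => k; rewrite exprDn.
  apply: r_sum => [|i]; first by rewrite !mulr_ge0 // exprn_ge0 // ltW.
  rewrite -mulr_natl -[_%:R]mulr1 mulr_natl -scaler_nat -scalerAl mul1r.
  apply: le_trans (rZ _ _) _; apply: (@le_trans _ _ (1 * r (x ^+ (k - i) * y ^+ i))).
    by rewrite ler_wpM2r // padic_abs_nat_le1.
  rewrite mul1r; apply: le_trans (rM _ _) _.
  rewrite -[in leRHS](subnK (leq_ord i)) exprD mulrACA.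
  exact: ler_pM.
- have := av_ge0 hw c; rewrite le_eqVlt => /orP[/eqP c0|cp].
    rewrite -c0 mul0r; apply: le_trans (spectral_le _) _.
    by apply: le_trans (rZ _ _) _; rewrite -c0 mul0r.
  rewrite -ler_pdivrMl //; apply: lb_le_inf => // t [t0 [C hC]].
  rewrite ler_pdivrMl //; apply: sp_le; split; first exact: mulr_gt0.
  exists C => k; rewrite exprZn; apply: le_trans (rZ _ _) _.
  by rewrite exprMn mulrCA (avX hw) ler_wpM2l // exprn_ge0 // av_ge0.
Qed.

Lemma spectral_sqr x : spectral x ^+ 2 <= spectral (x ^+ 2).
Proof.
apply/ler_addgt0Pl => e e0; pose t := e + spectral (x ^+ 2); rewrite -/t.
have t0 : 0 < t by rewrite ltr_pwDl // lb_le_inf // => s /pb_ge0.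
have [_ [C hC]] : power_bound (x ^+ 2) t.
  by apply: power_bound_of_spectral; rewrite /t ltrDr.
have C0 : 0 <= C by have := hC 0%N; rewrite !expr0 r1 mulr1; apply: le_trans.
pose s := Num.sqrt t; have s0 : 0 < s by rewrite sqrtr_gt0.
have s2 : s ^+ 2 = t by rewrite sqr_sqrtr // ltW.
rewrite -s2; apply: lerXn2r; rewrite ?nnegrE; [by apply: lb_le_inf => // u /pb_ge0|exact: ltW|].
(* An odd power of x costs one more factor r x, which is the r x / s in the constant. *)
apply: sp_le; split=> //; exists (C * (1 + r x / s)) => k.
have B0 : 0 <= r x / s by rewrite divr_ge0 // ltW.
rewrite -[k]odd_double_half exprD -mul2n !exprM exprD exprM s2.
case: (odd k); rewrite ?expr1 ?expr0 ?mul1r.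
  apply: le_trans (rM _ _) _; apply: (@le_trans _ _ (r x * (C * t ^+ k./2))).
    by rewrite ler_wpM2l.
  have -> : C * (1 + r x / s) * (s * t ^+ k./2) =
     r x * (C * t ^+ k./2) + C * s * t ^+ k./2 by field; rewrite gt_eqF.
  by rewrite lerDl !mulr_ge0 ?exprn_ge0 // ltW.
apply: le_trans (hC _) _; apply: ler_wpM2r; first by rewrite exprn_ge0 // ltW.
by rewrite ler_peMr // lerDl.
Qed.

End Spectral.

Lemma padic_extension_exists : exists u : E -> R, extends_abs w u.
Proof.
have [r hr rmin] := padic_seminorm_minimal.
have [[r_ge0 r1] rM rD rZ] := hr.
have sp : spectral r = r by apply: rmin; [apply: spectral_seminorm|apply: spectral_le].
have r2 x : r x ^+ 2 <= r (x ^+ 2) by rewrite -sp; apply: spectral_sqr.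
have rX x k : r (x ^+ k) <= r x ^+ k.
  elim: k => [|k IH]; first by rewrite !expr0 r1.
  by rewrite !exprS; apply: le_trans (rM _ _) _; rewrite ler_wpM2l.
have r_gt0 x : x != 0 -> 0 < r x.
  move=> x0; rewrite lt_def r_ge0 andbT; apply: contraTneq (rM x x^-1) => ->.
  by rewrite divff // r1 mul0r ler10.
(* Squaring gives the inequality for exponents 2^j. For general k, r(x)^(2^k) <= r(x^(2^k)) <=
   r(x^k) r(x)^(2^k - k), and the last factor cancels. *)
have pow x k : r x ^+ k <= r (x ^+ k).
  have [->|x0] := eqVneq x 0.
    case: k => [|k]; first by rewrite !expr0 r1.
    rewrite (_ : r 0 = 0) ?expr0n // -(scale0r (1 : E)); apply/eqP.
    by rewrite eq_le r_ge0 andbT; apply: le_trans (rZ _ _) _; rewrite av0 // mul0r.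
  have pow2 j : r x ^+ (2 ^ j) <= r (x ^+ (2 ^ j)).
    elim: j => [|j IH]; first by rewrite expn0 !expr1.
    rewrite expnSr !exprM; apply: le_trans (r2 _); apply: lerXn2r => //;
      by rewrite nnegrE ?exprn_ge0.
  have kj : (k <= 2 ^ k)%N by rewrite ltnW // ltn_expl.
  rewrite -(ler_pM2r (exprn_gt0 (2 ^ k - k) (r_gt0 x x0))) -exprD subnKC //.
  apply: le_trans (pow2 k) _; rewrite -{1}(subnKC kj) exprD.
  by apply: le_trans (rM _ _) _; rewrite ler_wpM2l.
have mult x y : x != 0 -> r x * r y <= r (x * y).
  move=> x0; have rx := r_gt0 x x0.
  pose a y k := r (x ^+ k * y) / r x ^+ k.
  have a_ge0 z k : 0 <= a z k by rewrite divr_ge0 ?exprn_ge0.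
  have a_dec z k : a z k.+1 <= a z k.
    rewrite /a ler_pdivrMr ?exprn_gt0 // exprS -mulrA; apply: le_trans (rM _ _) _.
    by rewrite (exprS (r x)) mulrCA divfK // gt_eqF // exprn_gt0.
  have a_mono z k l : (k <= l)%N -> a z l <= a z k.
    by move=> /subnK<-; elim: (l - k)%N => // i IH; apply: le_trans (a_dec _ _) IH.
  pose s z := inf (range (a z)).
  have ne z : exists t, range (a z) t by exists (a z 0%N), 0%N.
  have ge0 z t : range (a z) t -> 0 <= t by move=> [k _ <-].
  have sle z k : s z <= a z k.
    by apply: ge_inf; [exists 0 => t /ge0 | exists k].
  have sr z : s z <= r z by apply: le_trans (sle z 0%N) _; rewrite /a expr0 mul1r divr1.
  have hs : padic_seminorm s.
    split; [split=> [z|] | move=> z t | move=> z t | move=> c z].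
    - by apply: lb_le_inf => // t /ge0.
    - apply/eqP; rewrite eq_le; apply/andP; split; first by rewrite -[leRHS]r1 sr.
      apply: lb_le_inf => // _ [k _ <-].
      by rewrite /a mulr1 ler_pdivlMr ?exprn_gt0 // mul1r pow.
    - apply: inf_mul_ge => // [q|q|_ _ [k _ <-] [l _ <-]]; [exact: ge0|exact: ge0|].
      apply: le_trans (sle _ (k + l)%N) _.
      rewrite /a !exprD mulf_div ler_pM2r ?invr_gt0 ?mulr_gt0 ?exprn_gt0 //.
      by rewrite mulrACA; apply: rM.
    - rewrite leNgt; apply/negP; rewrite gt_max => /andP[hx hy].
      have [_ [k _ <-] kx] := inf_lt_ex (ne z) hx.
      have [_ [l _ <-] ly] := inf_lt_ex (ne t) hy.
      have := sle (z + t) (maxn k l); apply/negP; rewrite -ltNge.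
      have xp : 0 < r x ^+ maxn k l by rewrite exprn_gt0.
      rewrite /a ltr_pdivrMr // mulrDr; apply: le_lt_trans (rD _ _) _.
      rewrite gt_max -!ltr_pdivrMr //; apply/andP; split.
        by apply: le_lt_trans kx; apply: a_mono; apply: leq_maxl.
      by apply: le_lt_trans ly; apply: a_mono; apply: leq_maxr.
    - have := av_ge0 hw c; rewrite le_eqVlt => /orP[/eqP c0|cp].
        rewrite -c0 mul0r; apply: le_trans (sr _) _.
        by apply: le_trans (rZ _ _) _; rewrite -c0 mul0r.
      rewrite -ler_pdivrMl //; apply: lb_le_inf => // _ [k _ <-].
      rewrite ler_pdivrMl //; apply: le_trans (sle _ k) _.
      by rewrite /a -scalerAr mulrA ler_pM2r ?invr_gt0 ?exprn_gt0 // rZ.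
  have := sle y 1%N; rewrite (rmin s hs sr) /a !expr1 ler_pdivlMr //.
  by rewrite mulrC.
have r0 : r 0 = 0.
  apply/eqP; rewrite eq_le r_ge0 andbT -(scale0r (1 : E)).
  by apply: le_trans (rZ _ _) _; rewrite av0 // mul0r.
exists r; split.
  split=> // [x|x y|x y].
  - split=> [rx|->//]; apply/eqP/negP => /negP /r_gt0; by rewrite rx ltxx.
  - have [->|x0] := eqVneq x 0; first by rewrite mul0r r0 mul0r.
    by apply/eqP; rewrite eq_le rM mult.
  - apply: le_trans (rD _ _) _; rewrite ge_max lerDl lerDr !r_ge0 //.
move=> c; have [->|c0] := eqVneq c 0; first by rewrite scale0r r0 av0.
apply/eqP; rewrite eq_le; apply/andP; split.
  by have := rZ c 1; rewrite r1 mulr1.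
have wc := av_gt0 hw c0.
have := rM c%:A (c^-1)%:A; rewrite -scalerAl mul1r scalerA divff // scale1r r1.
have := rZ c^-1 1; rewrite r1 mulr1 (avV hw) => h1 h2.
have : 1 <= r c%:A / w c by apply: le_trans h2 _; rewrite ler_wpM2l.
by rewrite ler_pdivlMr // mul1r.
Qed.

End PadicExtension.

(** * Embeddings into a common field, characteristic polynomials and traces *)

Section RootEmbedding.
Variables (K : fieldExtType rat) (x : K) (g : {poly rat}).
Hypotheses (gen : <<1; x>>%VS = {:K}%VS) (hg : minPoly 1 x = map_poly (in_alg K) g).

Lemma gen_polyP y : exists q : {poly rat}, y = (map_poly (in_alg K) q).[x].
Proof.
have : y \in <<1; x>>%VS by rewrite gen memvf.
by move/Fadjoin_polyP => [_ /polyOver1P[q ->] ->]; exists q.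
Qed.

Lemma gen_dvdp q : (map_poly (in_alg K) q).[x] = 0 -> g %| q.
Proof.
move=> q0; rewrite -(dvdp_map (in_alg K)) -hg; apply: minPoly_dvdp.
  by apply/polyOver1P; exists q.
by rewrite rootE q0.
Qed.

Variables (W : fieldType) (iota : {rmorphism rat -> W}) (z : W).
Hypothesis hz : root (map_poly iota g) z.

(** A polynomial q with q(x) = y is picked by choice; another choice differs by a multiple of g,
    which vanishes at z. *)
Definition root_embedding (y : K) : W :=
  (map_poly iota (projT1 (cid (gen_polyP y)))).[z].

Lemma root_embedding_horner q :
  root_embedding (map_poly (in_alg K) q).[x] = (map_poly iota q).[z].
Proof.
rewrite /root_embedding; case: cid => q' /= /eqP.
rewrite -subr_eq0 -hornerN -hornerD -rmorphB => /eqP/gen_dvdp/dvdpP[r hr].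
apply/eqP; rewrite eq_sym -subr_eq0 -hornerN -hornerD -rmorphB hr rmorphM hornerM.
by rewrite (rootP hz) mulr0.
Qed.

Lemma root_embedding_additive : zmod_morphism root_embedding.
Proof.
move=> a b; have [p ->] := gen_polyP a; have [q ->] := gen_polyP b.
by rewrite -hornerN -hornerD -rmorphB !root_embedding_horner rmorphB hornerD hornerN.
Qed.

Lemma root_embedding_multiplicative : monoid_morphism root_embedding.
Proof.
split=> [|a b].
  by have := root_embedding_horner 1; rewrite !rmorph1 !hornerC.
have [p ->] := gen_polyP a; have [q ->] := gen_polyP b.
by rewrite -hornerM -rmorphM !root_embedding_horner rmorphM hornerM.
Qed.

HB.instance Definition _ := GRing.isZmodMorphism.Build K W root_embedding
  root_embedding_additive.
HB.instance Definition _ := GRing.isMonoidMorphism.Build K W root_embedding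
  root_embedding_multiplicative.

Lemma root_embedding_exists : exists f : {rmorphism K -> W}, f x = z.
Proof.
exists root_embedding; have := root_embedding_horner 'X.
by rewrite !map_polyX !hornerX.
Qed.

End RootEmbedding.

Lemma primitive_element_exists (K : fieldExtType rat) : exists (x : K) (g : {poly rat}),
  [/\ <<1; x>>%VS = {:K}%VS, minPoly 1 x = map_poly (in_alg K) g, separable_poly g,
      g \is monic & size g = (\dim {:K}).+1].
Proof.
have sepE (y : K) : separable_element 1 y.
  apply: pcharf0_separable => q; rewrite pchar_lalg; exact: pchar_num.
have sep : separable 1 {:K}%AS by apply/separableP => y _.
have e := eq_adjoin_separable_generator sep (sub1v _).
set x := separable_generator _ _ in e; exists x.
have /polyOver1P[g hg] := minPolyOver 1 x; exists g; split=> //.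
- by rewrite -(separable_map (in_alg K)) -hg; apply: sepE.
- by rewrite -(map_monic (in_alg K)) -hg monic_minPoly.
- rewrite -(size_map_poly (in_alg K)) -hg size_minPoly; congr _.+1.
  by have := dim_Fadjoin 1 x; rewrite -e dimv1 muln1.
Qed.

(** E is generated by the roots in [algC] of the minimal polynomial of a primitive element. These
    are [K : Q] in number by separability, and each defines an embedding. *)
Lemma embeddings_exist (K : fieldExtType rat) : exists (E : fieldExtType rat)
  (s : 'I_(\dim {:K}) -> {rmorphism K -> E}), forall i j, (s i =1 s j) -> i = j.
Proof.
have [x [g [gen hg sepg mong szg]]] := primitive_element_exists K.
have [r hr] := closed_field_poly_normal (map_poly (ratr : rat -> algC) g).
have {}hr : map_poly (ratr : rat -> algC) g = \prod_(z <- r) ('X - z%:P).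
  by move: hr; rewrite lead_coef_map (monicP mong) rmorph1 scale1r.
have [E [EC [s1 hs1 _]]] := num_field_exists r.
have gE : map_poly (in_alg E) g = \prod_(z <- s1) ('X - z%:P).
  apply: (map_poly_inj EC); rewrite rmorph_prod /= -map_poly_comp.
  transitivity (\prod_(z <- r) ('X - z%:P)).
    rewrite -hr; apply: eq_map_poly => c /=.
    by rewrite alg_num_field fmorph_rat.
  rewrite -hs1 big_map; apply: eq_bigr => z _.
  by rewrite rmorphB /= map_polyX map_polyC.
have us1 : uniq s1.
  by rewrite -separable_prod_XsubC -gE separable_map.
have ss1 : size s1 = \dim {:K}.
  by have := congr1 (size \o polyseq) gE; rewrite /= size_map_poly szg size_prod_XsubC => -[].
have ex (i : 'I_(\dim {:K})) : exists f : {rmorphism K -> E}, f x = s1`_i.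
  apply: (@root_embedding_exists _ _ _ gen hg _ (in_alg E)).
  by rewrite gE root_prod_XsubC mem_nth // ss1.
have [s hs] := choice ex; exists E, s => i j sij.
apply/val_inj/eqP; rewrite -(nth_uniq 0 _ _ us1) ?ss1 ?ltn_ord //.
by rewrite -!hs sij.
Qed.

Section ComplexAbsoluteValue.
Variable R : realType.

Lemma normc_absolute_value :
  is_absolute_value (L := (complex R : fieldType)) (@ComplexField.Normc.normc R).
Proof.
split=> [x|x|x y|x y].
- by case: x => a b; rewrite sqrtr_ge0.
- split=> [/ComplexField.Normc.eq0_normc//|->].
  exact: ComplexField.Normc.normc0.
- exact: ComplexField.Normc.normcM.
- exact: le_normcD.
Qed.

Lemma archimedean_extension_exists (E : fieldExtType rat) :
  exists u : E -> R, extends_abs (fun r : rat => `|ratr r|) u.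
Proof.
have [x [g [gen hg sepg mong szg]]] := primitive_element_exists E.
pose C := (complex R : closedFieldType).
pose iota : {rmorphism rat -> C} := (ratr : rat -> C).
have [z hz] : exists z : C, root (map_poly iota g) z.
  apply/closed_rootP; rewrite size_map_poly szg.
  by rewrite eqSS -lt0n (adim_gt0 {:E}).
have [f _] := root_embedding_exists gen hg hz.
exists (@ComplexField.Normc.normc R \o f); split.
  exact: (av_comp f normc_absolute_value).
move=> r /=; rewrite rmorph_ratr.
have -> : ratr r = real_complex_def (Phant R) (ratr r) :> C.
  by rewrite (fmorph_rat (real_complex_def (Phant R))).
by rewrite /ComplexField.Normc.normc /= expr0n addr0 sqrtr_sqr.
Qed.

End ComplexAbsoluteValue.

Section Embeddings.
Variables (K E : fieldExtType rat) (d : nat) (s : 'I_d -> {rmorphism K -> E}).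
Hypotheses (hd : \dim {:K} = d) (hs : forall i j, s i =1 s j -> i = j).

Lemma embedZ i (c : rat) x : s i (c *: x) = c *: s i x.
Proof.
rewrite -[c *: x]mulr_algl rmorphM rmorph_ratr -[RHS]mulr_algl; congr (_ * _).
by rewrite -(rmorph_ratr idfun).
Qed.

Lemma embed_alg i (c : rat) : s i c%:A = c%:A.
Proof. by rewrite embedZ rmorph1. Qed.

Lemma embed_horner i (q : {poly rat}) x :
  s i (map_poly (in_alg K) q).[x] = (map_poly (in_alg E) q).[s i x].
Proof.
rewrite -horner_map -map_poly_comp; congr _.[_]; apply: eq_map_poly => c /=.
exact: embed_alg.
Qed.

Lemma embed_gen_inj x : <<1; x>>%VS = {:K}%VS -> injective (fun i => s i x).
Proof.
move=> gen i j sij; apply: hs => y; have [q ->] := gen_polyP gen y.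
by rewrite !embed_horner sij.
Qed.

(** Dedekind's independence of embeddings, read off the Vandermonde determinant of the conjugates of
    a primitive element. *)
Lemma embed_independent (y : 'I_d -> E) :
  (forall x, \sum_i y i * s i x = 0) -> forall i, y i = 0.
Proof.
move=> hy i; have [x [g [gen _ _ _ _]]] := primitive_element_exists K.
pose a := \row_i s i x; pose Y := \row_i y i.
have nz : \det (Vandermonde d a) != 0.
  rewrite det_Vandermonde; apply/prodf_neq0 => k _; apply/prodf_neq0 => l kl.
  by rewrite !mxE subr_eq0; apply: contraTneq kl => /(embed_gen_inj gen)->; rewrite ltnn.
have YV : Vandermonde d a *m Y^T = 0.
  apply/matrixP => k j; rewrite !mxE -[RHS](hy (x ^+ k)); apply: eq_bigr => l _.
  by rewrite !mxE rmorphXn mulrC.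
have : Y^T = 0.
  have Vu : Vandermonde d a \in unitmx by rewrite unitmxE unitfE.
  by rewrite -[Y^T](mulKmx Vu) YV mulmx0.
by move/matrixP => /(_ i 0); rewrite !mxE.
Qed.

Lemma embed_basis_det (w : 'I_d -> K) : (forall x, exists c : 'I_d -> rat, x = \sum_i c i *: w i) ->
  \det (\matrix_(i, k) s k (w i)) != 0.
Proof.
move=> hw; rewrite -det_tr; apply/det0P => -[v v0 hv].
case/negP: v0; apply/eqP/rowP => i; rewrite !mxE.
apply: (embed_independent (y := fun k => v 0 k)) => x; have [c ->] := hw x.
under eq_bigr do rewrite rmorph_sum mulr_sumr.
rewrite exchange_big big1 //= => j _.
under eq_bigr do rewrite embedZ -scalerAr.
rewrite -scaler_sumr; have /rowP/(_ j) := hv; rewrite !mxE.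
under eq_bigr do rewrite !mxE.
by move->; rewrite scaler0.
Qed.

End Embeddings.

Section CharPoly.
Variables (K E : fieldExtType rat) (s : 'I_(\dim {:K}) -> {rmorphism K -> E}).
Hypothesis hs : forall i j, s i =1 s j -> i = j.
Local Notation d := (\dim {:K}).

Definition mult_mx (x : K) : 'M[rat]_d :=
  passmx.mxof (vbasis {:K}) (vbasis {:K}) (amull x).

Let b (i : 'I_d) : K := (vbasis {:K})`_i.
Let S : 'M[E]_d := \matrix_(i, k) s k (b i).
Let D (x : K) : 'M[E]_d := diag_mx (\row_k s k x).

Lemma vbasis_coord (x : K) : x = \sum_i coord (vbasis {:K}) i x *: (vbasis {:K})`_i.
Proof. exact/coord_vbasis/memvf. Qed.

Let S_unit : S \in unitmx.
Proof.
rewrite unitmxE unitfE; apply: embed_basis_det => // x.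
by exists (fun i => coord (vbasis {:K}) i x); apply: vbasis_coord.
Qed.

Lemma mult_mxE x i j : mult_mx x i j = coord (vbasis {:K}) j (x * (vbasis {:K})`_i).
Proof. by rewrite /mult_mx /passmx.mxof !mxE /= passmx.vecof_delta lfunE. Qed.

Let mult_conj x : map_mx (in_alg E) (mult_mx x) *m S = S *m D x.
Proof.
apply/matrixP => i k; rewrite mul_mx_diag !mxE -rmorphM.
rewrite {1}[b i * x]vbasis_coord rmorph_sum; apply: eq_bigr => j _.
by rewrite [map_mx _ _ _ _]mxE [S _ _]mxE embedZ mulr_algl mult_mxE mulrC.
Qed.

(** The matrix S of conjugates of a basis conjugates multiplication by x into the diagonal matrix of
    the conjugates of x. *)
Lemma char_poly_embed x :
  map_poly (in_alg E) (char_poly (mult_mx x)) = \prod_k ('X - (s k x)%:P).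
Proof.
pose P := map_mx polyC S.
have P0 : \det P != 0 by rewrite det_map_mx polyC_eq0 -unitfE -unitmxE.
rewrite map_char_poly; apply: (mulIf P0).
rewrite /char_poly -det_mulmx.
have -> : char_poly_mx (map_mx (in_alg E) (mult_mx x)) *m P = P *m char_poly_mx (D x).
  by rewrite /char_poly_mx mulmxBl mulmxBr -!map_mxM mult_conj scalar_mxC.
rewrite det_mulmx mulrC; congr (_ * _).
rewrite -/(char_poly _) char_poly_trig ?diag_mx_is_trig //.
by apply: eq_bigr => k _; rewrite !mxE eqxx mulr1n.
Qed.

Lemma field_trace_embed x : (field_trace x)%:A = \sum_k s k x.
Proof.
have -> : (field_trace x)%:A = \tr (map_mx (in_alg E) (mult_mx x)).
  by rewrite trace_map_mx.
have -> : map_mx (in_alg E) (mult_mx x) = S *m D x *m invmx S.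
  by rewrite -mult_conj mulmxK.
rewrite mxtrace_mulC mulKmx // /mxtrace.
by apply: eq_bigr => k _; rewrite !mxE eqxx mulr1n.
Qed.

End CharPoly.

(** * Places over a standard absolute value *)

Lemma av_nat_alg (K : fieldExtType rat) (n : nat) : (n%:R : rat)%:A = n%:R :> K.
Proof. by rewrite -[LHS]/(in_alg K n%:R) rmorph_nat. Qed.

Lemma av_int_alg (K : fieldExtType rat) (n : int) : (n%:~R : rat)%:A = n%:~R :> K.
Proof. by rewrite -[LHS]/(in_alg K n%:~R) rmorph_int. Qed.

Lemma extends_ultrametric (R : realType) (K : fieldExtType rat) p (v : K -> R) :
  prime p -> extends_abs (padic_abs R p) v -> ultrametric v.
Proof.
move=> pp [hv vw]; apply: ultrametric_of_nat => // n.
by rewrite -av_nat_alg vw padic_abs_nat_le1.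
Qed.

Section PlacesFromEmbeddings.
Variables (R : realType) (K E : fieldExtType rat).
Variable s : 'I_(\dim {:K}) -> {rmorphism K -> E}.
Hypothesis hs : forall i j, s i =1 s j -> i = j.
Variables (w : rat -> R) (u : E -> R).
Hypotheses (hw : std_abs_rat w) (hu : extends_abs w u).

Lemma extends_comp k : extends_abs w (u \o s k).
Proof.
split; first exact: (av_comp (s k) hu.1).
by move=> r /=; rewrite embed_alg hu.2.
Qed.

(** Repetitions are kept on purpose: the multiplicity of a place in this list will be its local
    degree. *)
Definition embed_places : seq (K -> R) := [seq u \o s k | k <- enum 'I_(\dim {:K})].

Lemma size_embed_places : size embed_places = \dim {:K}.
Proof. by rewrite size_map size_enum_ord. Qed.

(* If more than t of the s k induced v, some nonzero combination of them would
   kill the e j, hence by density all of K, against Dedekind's independence. *)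
Lemma vdense_count (v : K -> R) t (e : 'I_t -> K) : extends_abs w v -> vdense v e ->
  (count_mem v embed_places <= t)%N.
Proof.
move=> [hv vw] de; rewrite leqNgt; apply/negP => tm.
pose I := [set k | u \o s k == v]%SET.
have cI : count_mem v embed_places = #|I|.
  rewrite count_map -sum1_count -sum1_card big_enum_cond /=.
  by apply: eq_bigl => k; rewrite inE.
rewrite {}cI in tm.
pose A : 'M[E]_(#|I|, t) := \matrix_(i, j) s (enum_val i) (e j).
have /rowV0Pn[y /sub_kermxP yA y0] : kermx A != 0.
  rewrite kermx_eq0 /row_free; apply: contraTneq (rank_leq_col A) => ->.
  by rewrite -ltnNge.
have hu1 := hu.1.
have sumA (c : 'I_t -> rat) : \sum_i y 0 i * s (enum_val i) (\sum_j c j *: e j) = 0.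
  under eq_bigr do rewrite rmorph_sum mulr_sumr.
  rewrite exchange_big big1 //= => j _.
  under eq_bigr do rewrite embedZ -scalerAr.
  rewrite -scaler_sumr; have /rowP/(_ j) := yA; rewrite !mxE.
  by under eq_bigr do rewrite !mxE; move=> ->; rewrite scaler0.
pose B := \sum_i u (y 0 i); have B0 : 0 <= B by rewrite sumr_ge0 // => i _; apply: av_ge0.
have sum0 x : \sum_i y 0 i * s (enum_val i) x = 0.
  apply/eqP; rewrite -(av_eq0 hu1) eq_le av_ge0 // andbT.
  apply/ler_addgt0Pl => eps e0; rewrite addr0.
  have [c hc] := de x (eps / (B + 1)) ltac:(by rewrite divr_gt0 // ltr_wpDl).
  have -> : \sum_i y 0 i * s (enum_val i) x =
      \sum_i y 0 i * s (enum_val i) (x - \sum_j c j *: e j).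
    under [RHS]eq_bigr do rewrite rmorphB mulrBr.
    by rewrite sumrB sumA subr0.
  apply: le_trans (av_sum hu1 _ _ _) _.
  apply: (@le_trans _ _ (\sum_i u (y 0 i) * (eps / (B + 1)))); last first.
    rewrite -mulr_suml mulrA ler_pdivrMr ?ltr_wpDl // mulrC ler_pM2l //.
    by rewrite lerDl.
  apply: ler_sum => i _; rewrite (avM hu1).
  rewrite ler_wpM2l ?av_ge0 // ltW //.
  have := enum_valP i; rewrite inE => /eqP hi.
  by rewrite -[u _]/((u \o s (enum_val i)) _) hi.
pose Y k := \sum_i (if enum_val i == k then y 0 i else 0).
have Y0 : forall k, Y k = 0.
  apply: (embed_independent hs) => x; rewrite -[RHS](sum0 x).
  under eq_bigr do rewrite mulr_suml.
  rewrite exchange_big; apply: eq_bigr => i _.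
  rewrite (bigD1 (enum_val i)) //= eqxx big1 ?addr0 // => k ki.
  by rewrite eq_sym (negPf ki) mul0r.
case/negP: y0; apply/eqP/rowP => i; rewrite mxE -[RHS](Y0 (enum_val i)) /Y.
rewrite (bigD1 i) //= eqxx big1 ?addr0 // => j ji.
by rewrite (inj_eq enum_val_inj) (negPf ji).
Qed.

Lemma sum_count_undup (T : eqType) (r : seq T) :
  (\sum_(x <- undup r) count_mem x r)%N = size r.
Proof.
rewrite -[RHS]sum1_size -[RHS]big_undup_iterop_count. apply: eq_bigr => x _.
by elim: (count_mem x r) => //= -[|n] //= <-; rewrite add1n.
Qed.

Lemma local_degree_bounds (v : K -> R) : extends_abs w v ->
  [/\ (count_mem v embed_places <= local_degree v)%N, (0 < local_degree v)%N
   & exists e : 'I_(local_degree v) -> K, vfree v e].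
Proof.
move=> ev; have [t [e [fe de]]] := vfree_dense_exists ev.1.
rewrite (local_degreeE ev.1 fe de); split; last by exists e.
  exact: vdense_count ev de.
exact: vdense_gt0 ev.1 _ _ de.
Qed.

(** The places in the list have local degrees summing to at least its length [K : Q]. A further
    place has positive local degree and would push the sum beyond the bound of [sum_vfree_le]. *)
Lemma embed_places_complete (v : K -> R) : extends_abs w v -> v \in embed_places.
Proof.
move=> ev; apply/negPn/negP => vn.
have h v' : v' \in v :: undup embed_places -> extends_abs w v'.
  rewrite in_cons mem_undup => /orP[/eqP->//|/mapP[k _ ->]].
  exact: extends_comp.
have : (\sum_(v' <- v :: undup embed_places) local_degree v' <= \dim {:K})%N.
  apply: (sum_vfree_le hw); first by rewrite /= mem_undup vn undup_uniq.
  by move=> v' /h ev'; split=> //; have [] := local_degree_bounds ev'.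
apply/negP; rewrite big_cons -ltnNge -size_embed_places -sum_count_undup.
have [_ v0 _] := local_degree_bounds ev.
apply: leq_ltn_trans (_ : _ <= \sum_(x <- undup embed_places) local_degree x)%N _.
  rewrite !big_seq; apply: leq_sum => x xs.
  have ex : extends_abs w x by apply: h; rewrite in_cons xs orbT.
  by have [] := local_degree_bounds ex.
by rewrite -[X in (X < _)%N]add0n ltn_add2r.
Qed.

(** Each local degree is at least the multiplicity, and the sum of the local degrees is at most the
    sum of the multiplicities; so they agree term by term. *)
Lemma local_degree_count (v : K -> R) : extends_abs w v ->
  local_degree v = count_mem v embed_places.
Proof.
move=> ev; have vs := embed_places_complete ev.
have h v' : v' \in undup embed_places -> extends_abs w v'.
  by rewrite mem_undup => /mapP[k _ ->]; apply: extends_comp.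
have : (\sum_(v' <- undup embed_places) local_degree v' <= \dim {:K})%N.
  apply: (sum_vfree_le hw); first exact: undup_uniq.
  by move=> v' /h ev'; split=> //; have [] := local_degree_bounds ev'.
rewrite -size_embed_places -sum_count_undup => le.
have /eqP eqs : (\sum_(x <- undup embed_places) local_degree x ==
    \sum_(x <- undup embed_places) count_mem x embed_places)%N.
  rewrite eqn_leq le !big_seq; apply: leq_sum => x /h ex.
  by have [] := local_degree_bounds ex.
apply/eqP; rewrite eqn_leq; have [-> _ _] := local_degree_bounds ev; rewrite andbT.
have vu : v \in undup embed_places by rewrite mem_undup.
move: eqs; rewrite !(bigD1_seq v) ?undup_uniq //= => eqs.
have : (\sum_(i <- undup embed_places | i != v) count_mem i embed_places <=
        \sum_(i <- undup embed_places | i != v) local_degree i)%N.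
  rewrite big_seq_cond [leqRHS]big_seq_cond; apply: leq_sum => x /andP[/h ex _].
  by have [] := local_degree_bounds ex.
have arith (x y z t : nat) : (x + z = y + t -> t <= z -> x <= y)%N by lia.
exact: arith eqs.
Qed.

Lemma prod_local_degree (f : (K -> R) -> R) :
  \prod_(v <- undup embed_places) f v ^+ local_degree v = \prod_k f (u \o s k).
Proof.
transitivity (\prod_(v <- embed_places) f v); last by rewrite big_map big_enum.
rewrite -[RHS]big_undup_iterop_count big_seq [RHS]big_seq; apply: eq_bigr => v.
rewrite mem_undup => vs; rewrite local_degree_count.
  by [].
by case/mapP: vs => k _ ->; apply: extends_comp.
Qed.

End PlacesFromEmbeddings.

(** * Gauss's lemma and the height formula *)

Section GaussNorm.
Variables (R : realType) (E : fieldType) (u : E -> R).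
Hypotheses (hu : is_absolute_value u) (uu : ultrametric u).

Definition gauss (q : {poly E}) : R := \big[Num.max/0]_(i < size q) u q`_i.

Lemma gauss_ge0 q : 0 <= gauss q.
Proof. exact: fmax_ge0. Qed.

Lemma gauss_ge (q : {poly E}) i : u q`_i <= gauss q.
Proof.
have [qi|iq] := leqP (size q) i; first by rewrite nth_default // av0 // gauss_ge0.
exact: (fmax_ge (fun i : 'I_(size q) => u q`_i) (Ordinal iq)).
Qed.

Lemma gauss_le (q : {poly E}) B : 0 <= B -> (forall i, u q`_i <= B) -> gauss q <= B.
Proof. by move=> B0 h; apply: fmax_le. Qed.

Lemma gauss_attained (q : {poly E}) : q != 0 -> exists2 i, gauss q = u q`_i & forall j, (i < j)%N -> u q`_j < gauss q.
Proof.
move=> q0; pose P i := gauss q <= u q`_i.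
have exP : exists i, P i.
  apply: contrapT => /forallNP h.
  have : gauss q < gauss q.
    rewrite {1}/gauss; elim/big_ind: _ => [|x y hx hy|i _].
    - have lc : 0 < u (lead_coef q) by rewrite av_gt0 // lead_coef_eq0.
      exact: lt_le_trans lc (gauss_ge _ _).
    - by rewrite gt_max hx hy.
    - by rewrite ltNge; apply/negP/h.
  by rewrite ltxx.
have bP i : P i -> (i <= size q)%N.
  rewrite /P => hi; rewrite leqNgt; apply/negP => qi.
  move: hi; rewrite nth_default ?(ltnW qi) // av0 // => h0.
  have lc : 0 < u (lead_coef q) by rewrite av_gt0 // lead_coef_eq0.
  by have := lt_le_trans lc (le_trans (gauss_ge _ _) h0); rewrite ltxx.
have [i hi imax] := ex_maxnP exP bP.
exists i => [|j ij]; first by apply/eqP; rewrite eq_le gauss_ge andbT.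
by rewrite ltNge; apply/negP => /imax; rewrite leqNgt ij.
Qed.

Lemma gaussZ c q : gauss (c *: q) = u c * gauss q.
Proof.
have le a r : gauss (a *: r) <= u a * gauss r.
  apply: gauss_le => [|i]; first by rewrite mulr_ge0 ?av_ge0 ?gauss_ge0.
  by rewrite coefZ (avM hu) ler_wpM2l ?av_ge0 ?gauss_ge.
have [->|c0] := eqVneq c 0.
  by rewrite scale0r av0 // mul0r /gauss size_poly0 big_ord0.
apply/eqP; rewrite eq_le le /= -ler_pdivlMl ?av_gt0 // -(avV hu).
by rewrite -{1}[q](scalerK c0); apply: le.
Qed.

Lemma gauss1 : gauss 1 = 1.
Proof. by rewrite /gauss size_poly1 big_ord_recl big_ord0 coef1 eqxx av1 // max_l. Qed.

(** Let i be the last index where the norm of q is attained. If u x <= 1, coefficient i + 1 of the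
    product has the value of q_i; otherwise coefficient i has the value of x q_i. In both cases the
    other term is strictly smaller. *)
Lemma gauss_linear x q : gauss (('X - x%:P) * q) = Num.max 1 (u x) * gauss q.
Proof.
have [->|q0] := eqVneq q 0.
  by rewrite mulr0 /gauss size_poly0 big_ord0 mulr0.
have cf i : (('X - x%:P) * q)`_i = (if i is j.+1 then q`_j else 0) - x * q`_i.
  by rewrite mulrBl coefB coefXM coefCM; case: i.
apply/eqP; rewrite eq_le; apply/andP; split.
  apply: gauss_le => [|i]; first by rewrite mulr_ge0 ?gauss_ge0 // le_max ler01.
  rewrite cf; apply: le_trans (ultraB hu uu _ _) _; rewrite ge_max; apply/andP; split.
    case: i => [|i]; first by rewrite av0 // mulr_ge0 ?gauss_ge0 // le_max ler01.
    apply: le_trans (gauss_ge q i) _; rewrite ler_peMl ?gauss_ge0 //.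
    by rewrite le_max lexx.
  rewrite (avM hu); apply: ler_pM; rewrite ?av_ge0 ?gauss_ge //.
  by rewrite le_max lexx orbT.
have [i gi gmax] := gauss_attained q0.
have gp : 0 < gauss q.
  have lc : 0 < u (lead_coef q) by rewrite av_gt0 // lead_coef_eq0.
  exact: lt_le_trans lc (gauss_ge _ _).
have [x1|x1] := leP (u x) 1.
  rewrite mul1r; apply: le_trans (gauss_ge _ i.+1); rewrite cf.
  rewrite (ultra_eq hu uu) -?gi // avN // (avM hu).
  apply: (@le_lt_trans _ _ (1 * u q`_i.+1)); first by rewrite ler_wpM2r ?av_ge0.
  by rewrite mul1r gmax.
apply: le_trans (gauss_ge _ i); rewrite cf.
rewrite addrC (ultra_eq hu uu) avN // (avM hu) -?gi //.
case: i {gi gmax} => [|i]; first by rewrite av0 // mulr_gt0 // (lt_trans ltr01).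
by apply: le_lt_trans (gauss_ge q i) _; rewrite ltr_pMl.
Qed.

Lemma gauss_prod (I : Type) (r : seq I) (f : I -> E) :
  gauss (\prod_(i <- r) ('X - (f i)%:P)) = \prod_(i <- r) Num.max 1 (u (f i)).
Proof.
elim: r => [|i r IH]; first by rewrite !big_nil gauss1.
by rewrite !big_cons gauss_linear IH.
Qed.

End GaussNorm.

(** [c] is the leading coefficient called a0 in the overview, and [G] the primitive multiple of the
    characteristic polynomial, written through the conjugates because that is how it enters
    heights. *)
Definition primitive_multiple (K E : fieldExtType rat) (s : 'I_(\dim {:K}) -> {rmorphism K -> E})
    (a : K) (c : nat) (G : {poly int}) :=
  [/\ (0 < c)%N, zcontents G = 1 &
      map_poly intr G = c%:R *: \prod_k ('X - (s k a)%:P) :> {poly E}].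

Section Height.
Variables (R : realType) (K E : fieldExtType rat).
Variable s : 'I_(\dim {:K}) -> {rmorphism K -> E}.
Hypothesis hs : forall i j, s i =1 s j -> i = j.
Local Notation d := (\dim {:K}).

Lemma primitive_multiple_exists a : exists c G, primitive_multiple s a c G.
Proof.
have [q [b b0 hq]] := rat_poly_scale (char_poly (mult_mx a)).
have q0 : q != 0.
  apply: contraTneq (char_poly_monic (mult_mx a)) => q0.
  by rewrite hq q0 map_poly0 scaler0 monicE lead_coef0 eq_sym oner_eq0.
pose G := zprimitive q; have G1 : zcontents G = 1 by rewrite zcontents_primitive q0.
have qG : q = zcontents q *: G by apply: zpolyEprim.
pose t : rat := (zcontents q)%:~R / b%:~R.
have chiG : char_poly (mult_mx a) = t *: map_poly intr G.
  rewrite hq [in LHS]qG map_polyZ /= scalerA mulrC //.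
have lG : t * (lead_coef G)%:~R = 1.
  have := char_poly_monic (mult_mx a); rewrite chiG monicE lead_coefZ.
  by rewrite lead_coef_map_inj ?rmorph0 // => [/eqP//|]; apply: intr_inj.
have lG0 : 0 < lead_coef G.
  by rewrite -sgz_gt0 sgz_lead_primitive q0.
have [c hc] : exists c : nat, lead_coef G = c%:Z by case: (lead_coef G) lG0 => // c _; exists c.
exists c, G; split=> //; first by rewrite hc in lG0.
rewrite -char_poly_embed // chiG map_polyZ scalerA /=.
have -> : c%:R * t%:A = 1 :> E.
  rewrite -[t%:A]/(in_alg E t) -(rmorph_nat (in_alg E) c) -rmorphM.
  by rewrite mulrC -[c%:R]/(c%:Z%:~R) -hc lG rmorph1.
rewrite scale1r -[RHS]map_poly_comp; apply: eq_map_poly => z /=.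
by rewrite av_int_alg.
Qed.

Section PrimitiveMultiple.
Variables (a : K) (c : nat) (G : {poly int}).
Hypothesis hG : primitive_multiple s a c G.

Lemma gauss_primitive p (u : E -> R) : prime p -> extends_abs (padic_abs R p) u ->
  gauss u (map_poly intr G) = 1.
Proof.
move=> pp eu; have [hu uw] := eu; have uu := extends_ultrametric pp eu.
have uint (z : int) : u z%:~R = padic_abs R p z%:~R by rewrite -uw av_int_alg.
apply/eqP; rewrite eq_le; apply/andP; split.
  apply: gauss_le => // i; rewrite coef_map_id0 ?rmorph0 //.
  exact: ultra_int.
have [i hi] : exists i, ~~ (p%:Z %| G`_i)%Z.
  apply: contrapT => /forallNP h; have [_ G1 _] := hG.
  have : (p%:Z %| zcontents G)%Z.
    by rewrite dvdz_contents; apply/polyOverP => i; apply/negPn/negP/h.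
  rewrite G1 dvdzE /= dvdn1 => /eqP p1; by move: pp; rewrite p1.
apply: le_trans (gauss_ge hu _ i); rewrite coef_map_id0 ?rmorph0 // uint.
have gi0 : G`_i != 0 by apply: contraNneq hi => ->; apply: dvdz0.
rewrite padic_abs_int // (_ : logn p _ = 0%N) ?expr0 ?invr1 //.
apply/eqP; rewrite -leqn0 leqNgt logn_gt0 mem_primes pp absz_gt0 gi0 /=.
by move: hi; rewrite dvdzE.
Qed.

(** Both sides are the Gauss norm of the primitive polynomial [G]. So the part of the height at p is
    the inverse of |c|_p. *)
Lemma prime_max_prod p (u : E -> R) : prime p -> extends_abs (padic_abs R p) u ->
  padic_abs R p c%:R * \prod_k Num.max 1 (u (s k a)) = 1.
Proof.
move=> pp eu; have [hu uw] := eu; have uu := extends_ultrametric pp eu.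
rewrite -[RHS](gauss_primitive pp eu); have [_ _ ->] := hG.
rewrite gaussZ // -av_nat_alg uw; congr (_ * _).
by rewrite gauss_prod.
Qed.

(** At a prime not dividing c, |c|_p = 1 forces every max(1, .) to be 1, so the infinite product
    reduces to the places over infinity and over the primes dividing c. Local degrees turn products
    over places into products over embeddings, and the product formula for c collects the finite
    part. *)
Lemma weil_height_exp (uinf : E -> R) : extends_abs (fun r : rat => `|ratr r|) uinf ->
  weil_height R a ^+ d = c%:R * \prod_k Num.max 1 (uinf (s k a)).
Proof.
move=> einf; have [c0 _ _] := hG; have d0 : (0 < d)%N := adim_gt0 {:K}.
pose winf : rat -> R := fun r => `|ratr r|.
have winfP : std_abs_rat winf by left.
have padicP p : prime p -> std_abs_rat (padic_abs R p) by move=> pp; right; exists p.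
pose S := primes c.
have Sp p : p \in S -> prime p by rewrite mem_primes => /andP[].
pose W := winf :: [seq padic_abs R p | p <- S].
have WP w : w \in W -> std_abs_rat w.
  by rewrite in_cons => /orP[/eqP->//|/mapP[p /Sp/padicP pp ->]].
(* A dummy value at a w that is not standard lets [choice] select an extension for all w at once. *)
have exu w : exists u : E -> R, std_abs_rat w -> extends_abs w u.
  have [hw|nw] := pselect (std_abs_rat w); last by exists (fun=> 0).
  case: hw => [h|[p pp h]].
    by exists uinf; rewrite (_ : w = winf) // funeqE.
  have [u hu] := padic_extension_exists R E pp.
  by exists u => _; rewrite (_ : w = padic_abs R p) // funeqE.
have [u0 hu0] := choice exu.
pose u w := if w == winf then uinf else u0 w.
have hu w : std_abs_rat w -> extends_abs w (u w).
  by rewrite /u; case: eqP => [->//|_]; apply: hu0.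
pose V w := undup (embed_places s (u w)).
have VP w v : std_abs_rat w -> (v \in V w) = `[< extends_abs w v >].
  move=> hw; rewrite mem_undup; apply/idP/asboolP.
    by move=> /mapP[k _ ->]; apply: extends_comp (hu w hw) k.
  exact: (embed_places_complete hs hw (hu w hw)).
have padic_inj p q : prime p -> prime q -> padic_abs R p = padic_abs R q -> p = q.
  move=> pp pq /(congr1 (fun f => f p%:R)); rewrite padic_abs_prime //.
  have [//|pnq] := eqVneq p q; rewrite padic_abs_coprime ?prime_gt0 //.
    by move/eqP; rewrite invr_eq1 pnatr_eq1 => /eqP p1; move: pp; rewrite p1.
  by rewrite dvdn_prime2 // eq_sym.
have winf_padic p : prime p -> winf <> padic_abs R p.
  move=> pp /(congr1 (fun f => f p%:R)); rewrite padic_abs_prime // /winf ratr_nat normr_nat.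
  have p1 : 1 < p%:R :> R by rewrite ltr1n prime_gt1.
  move=> e; have : p%:R^-1 < 1 :> R by rewrite invf_lt1 // (lt_trans ltr01).
  by rewrite -e ltNge ltW.
have uW : uniq W.
  rewrite /= map_inj_in_uniq ?primes_uniq ?andbT.
    by apply/negP => /mapP[p /Sp pp]; apply: winf_padic.
  by move=> p q /Sp pp /Sp pq; apply: padic_inj.
have uflat (W' : seq (rat -> R)) : uniq W' -> (forall w, w \in W' -> std_abs_rat w) ->
    uniq (flatten [seq V w | w <- W']).
  elim: W' => //= w W' IH /andP[wW' uW'] h; rewrite cat_uniq undup_uniq /= IH ?andbT //.
    apply/hasPn => v /flatten_mapP[w' w'W vV']; apply/negP => vV.
    have hw : std_abs_rat w by apply: h; rewrite in_cons eqxx.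
    have hw' : std_abs_rat w' by apply: h; rewrite in_cons w'W orbT.
    move: vV vV'; rewrite (VP _ _ hw) (VP _ _ hw') => /asboolP[_ e1] /asboolP[_ e2].
    by case/negP: wW'; rewrite (_ : w = w') // funeqE => r; rewrite -e1 -e2.
  by move=> w' hw'; apply: h; rewrite in_cons hw' orbT.
pose F (v : K -> R) := Num.max 1 (v a) `^ ((local_degree v)%:R / d%:R).
pose X := flatten [seq V w | w <- W].
have Xplaces : [set` X] `<=` @places R K.
  move=> v /= /flatten_mapP[w wW]; rewrite (VP _ _ (WP w wW)) => /asboolP[hv vw]; split=> //.
  by rewrite (_ : (fun x : rat => v x%:A) = w) ?funeqE //; apply: WP.
have FX v : (@places R K `\` [set` X]) v -> F v = 1.
  move=> [[hv hw] vX]; pose w : rat -> R := fun x => v x%:A.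
  have ev : extends_abs w v by [].
  have wW : w \notin W.
    apply/negP => wW; apply: vX; apply/flatten_mapP; exists w => //.
    by rewrite (VP _ _ (WP w wW)); apply/asboolP.
  have [p pp wp] : exists2 p, prime p & w = padic_abs R p.
    case: (hw) => [h|[p pp h]]; last by exists p => //; rewrite funeqE.
    by case/negP: wW; rewrite in_cons (_ : w = winf) ?eqxx // funeqE.
  suff va : v a <= 1 by rewrite /F max_l // powR1.
  have := embed_places_complete hs hw (hu w hw) ev => /mapP[k _ ->] /=.
  have ew := hu w hw; rewrite wp in ew *.
  have pc : padic_abs R p c%:R = 1.
    rewrite padic_abs_coprime //; apply: contra wW => pc.
    by rewrite wp in_cons map_f ?orbT // mem_primes pp c0.
  have := prime_max_prod pp ew; rewrite pc mul1r => prod1.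
  rewrite leNgt; apply/negP => uk.
  have : 1 < \prod_k Num.max 1 (u (padic_abs R p) (s k a)).
    rewrite (bigD1 k) //=; set m := Num.max 1 _.
    apply: (@lt_le_trans _ _ m); first by rewrite lt_max uk orbT.
    apply: ler_peMr; first by rewrite le_max ler01.
    elim/big_ind: _ => // [x y x1 y1|j _]; first exact: mulr_ege1.
    by rewrite le_max lexx.
  by rewrite prod1 ltxx.
have HX : weil_height R a = \prod_(v <- X) F v.
  rewrite (fsbig_seq _ _ (uflat W uW WP)).
  by apply/esym/fsbig_widen.
have Fd v : F v ^+ d = Num.max 1 (v a) ^+ local_degree v.
  have m0 : 0 <= Num.max 1 (v a) by rewrite le_max ler01.
  by rewrite -powR_mulrn ?powR_ge0 // /F -powRrM divfK ?pnatr_eq0 -?lt0n // powR_mulrn.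
rewrite HX -prodrXl; under eq_bigr do rewrite Fd.
rewrite big_flatten big_map big_cons.
have prodV w : std_abs_rat w ->
    \prod_(v <- V w) Num.max 1 (v a) ^+ local_degree v = \prod_k Num.max 1 (u w (s k a)).
  move=> hw; exact: (prod_local_degree hs hw (hu w hw) (fun v => Num.max 1 (v a))).
rewrite prodV // /u eqxx mulrC; congr (_ * _).
rewrite big_map (eq_big_seq (fun p => \prod_k Num.max 1 (u (padic_abs R p) (s k a)))); last first.
  by move=> p hp; apply: prodV; apply/padicP/Sp.
rewrite -[RHS]invrK -(prod_padic_abs R c0).
rewrite -prodfV; apply: eq_big_seq => p /Sp pp.
have h := prime_max_prod pp (hu _ (padicP p pp)).
have n0 : padic_abs R p c%:R != 0.
  by apply: contra_eq_neq h => ->; rewrite mul0r eq_sym oner_eq0.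
by apply: (mulfI n0); rewrite h divff.
Qed.

End PrimitiveMultiple.
End Height.

(** * Existence of a generator of least height *)

Lemma intr_alg_inj (K : fieldExtType rat) : injective (intr : int -> K).
Proof.
move=> x y; rewrite -!av_int_alg => /(fmorph_inj (in_alg K)).
exact: intr_inj.
Qed.

Lemma natr_alg_eq0 (K : fieldExtType rat) (n : nat) : (n%:R == 0 :> K) = (n == 0%N).
Proof. by rewrite -av_nat_alg -[_%:A]/(in_alg K n%:R) fmorph_eq0 pnatr_eq0. Qed.

Lemma weil_height_ge0 (R : realType) (K : fieldExtType rat) (a : K) :
  0 <= weil_height R a.
Proof.
by apply: (big_ind (fun x => 0 <= x)) => // [x y|v _]; [apply: mulr_ge0|apply: powR_ge0].
Qed.

Lemma av_coef_prod_XsubC (R : realType) (E : fieldType) (u : E -> R)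
    (hu : is_absolute_value u) (I : Type) (r : seq I) (f : I -> E) i :
  u (\prod_(k <- r) ('X - (f k)%:P))`_i <= \prod_(k <- r) (1 + u (f k)).
Proof.
elim: r i => [|k r IH] i.
  by rewrite !big_nil coef1; case: (i == 0%N); rewrite ?av1 ?av0.
rewrite !big_cons mulrBl coefB coefXM coefCM mulrDl mul1r.
apply: le_trans (avD hu _ _) _; apply: lerD.
  case: (i == 0%N); last exact: IH.
  by rewrite av0 // prodr_ge0 // => j _; rewrite addr_ge0 ?av_ge0.
by rewrite avN // (avM hu) ler_wpM2l ?av_ge0.
Qed.

Section Northcott.
Variables (R : realType) (K : fieldExtType rat).
Local Notation d := (\dim {:K}).

(** Northcott: the height depends only on [G], whose coefficients are bounded by 2^d H^d. Heights
    below that of one fixed generator a1 therefore take finitely many values, and the least one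
    attained by a generator is [delta]. *)
Lemma delta_attained : exists2 a : K, <<1; a>>%VS = {:K}%VS /\ delta R K = weil_height R a
  & forall b : K, <<1; b>>%VS = {:K}%VS -> delta R K <= weil_height R b.
Proof.
have [E [s hs]] := embeddings_exist K.
have [u hu] := archimedean_extension_exists R E; have hu1 := hu.1.
have [cG hcG] := choice (fun a => let: ex_intro c h := primitive_multiple_exists hs a in
  let: ex_intro G h := h in ex_intro (fun z : nat * {poly int} => primitive_multiple s a z.1 z.2) (c, G) h).
pose G a := (cG a).2; pose c a := (cG a).1.
have hG a : primitive_multiple s a (c a) (G a) by apply: hcG.
have Hd a : weil_height R a ^+ d = (c a)%:R * \prod_k Num.max 1 (u (s k a)).
  by have := weil_height_exp hs (hG a) hu.
have d0 : (0 < d)%N := adim_gt0 {:K}.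
have szG a : size (G a) = d.+1.
  have [c0 _ e] := hG a; have := congr1 (fun q : {poly E} => size q) e.
  rewrite size_map_inj_poly ?rmorph0 //; last exact: intr_alg_inj.
  rewrite size_scale ?natr_alg_eq0 -?lt0n //= => ->.
  by rewrite -big_enum size_prod_XsubC size_enum_ord.
have lcG a : lead_coef (G a) = (c a)%:Z.
  have [c0 _ e] := hG a; have := congr1 lead_coef e.
  rewrite lead_coef_map_inj ?rmorph0 //; last exact: intr_alg_inj.
  rewrite lead_coefZ (monicP (monic_prod_XsubC _ _ _)) mulr1 => h.
  exact: (@intr_alg_inj E).
have HG a b : G a = G b -> weil_height R a = weil_height R b.
  move=> Gab; have cab : c a = c b by apply/eqP; rewrite -eqz_nat -!lcG Gab.
  apply/eqP; rewrite -(eqrXn2 d0) ?weil_height_ge0 // !Hd cab; apply/eqP; congr (_ * _).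
  have [c0 _ ea] := hG a; have [_ _ eb] := hG b.
  have e : \prod_k ('X - (s k a)%:P) = \prod_k ('X - (s k b)%:P) :> {poly E}.
    have cn0 : (c b)%:R != 0 :> E by rewrite natr_alg_eq0 -lt0n -cab.
    by apply: (scalerI cn0); rewrite -eb -Gab ea cab.
  have pe : perm_eq [seq s k a | k <- index_enum 'I_d] [seq s k b | k <- index_enum 'I_d].
    by apply: prod_XsubC_eq; rewrite !big_map.
  rewrite -(big_map (fun k => s k a) xpredT (fun x => Num.max 1 (u x))).
  by rewrite (perm_big _ pe) big_map.
have bound a i : u ((G a)`_i)%:~R <= 2 ^+ d * weil_height R a ^+ d.
  have [c0 _ e] := hG a; have := congr1 (fun q : {poly E} => q`_i) e.
  rewrite coef_map_id0 ?rmorph0 // => ->; rewrite coefZ (avM hu1) Hd mulrCA.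
  apply: ler_pM; rewrite ?av_ge0 //.
    by rewrite -av_nat_alg hu.2 /= ratr_nat normr_nat.
  apply: le_trans (av_coef_prod_XsubC hu1 _ _ _) _.
  have -> : 2 ^+ d = \prod_(k < d) 2 :> R by rewrite prodr_const card_ord.
  rewrite -big_split /=; apply: ler_prod => k _; rewrite addr_ge0 ?av_ge0 //=.
  by have : 1 <= Num.max 1 (u (s k a)) /\ u (s k a) <= Num.max 1 (u (s k a));
    [rewrite !le_max !lexx orbT | case; lra].
have [a1 [_ [gen1 _ _ _ _]]] := primitive_element_exists K.
set h1 := weil_height R a1.
pose N := (Num.trunc (2 ^+ d * h1 ^+ d)).+1.
(* Coefficients between -N and N are shifted into 0 .. 2N, where [inord] is faithful; the code then
   determines [G]. *)
pose code a : {ffun 'I_d.+1 -> 'I_(N + N).+1} :=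
  [ffun i : 'I_d.+1 => inord (absz ((G a)`_i + N%:Z))].
pose P t a := [/\ <<1; a>>%VS = {:K}%VS, weil_height R a <= h1 & code a = t].
have codeG a b : weil_height R a <= h1 -> weil_height R b <= h1 -> code a = code b -> G a = G b.
  have small e i : weil_height R e <= h1 -> `|(G e)`_i| <= N%:Z.
    move=> he; have := bound e i; rewrite -av_int_alg hu.2 /= ratr_int -intr_norm => h.
    rewrite -(ler_int R); apply: le_trans h _; apply: le_trans (ltW (truncnS_gt _)).
    rewrite ler_pM2l ?exprn_gt0 //; apply: lerXn2r => //; rewrite nnegrE ?weil_height_ge0 //.
  move=> ha hb /ffunP cab; apply/polyP => i.
  have [di|id] := ltnP d i; first by rewrite !nth_default ?szG.
  have := cab (inord i); rewrite !ffunE inordK // => /(congr1 val) /=.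
  have := small a i ha; have := small b i hb.
  set x := (G b)`_i; set y := (G a)`_i => hx hy.
  rewrite !inordK; lia.
pose rep t := xget a1 [set a | P t a].
have repP t : (exists a, P t a) -> P t (rep t) by move=> ex; exact: (@xgetPex _ a1 [set a | P t a] ex).
have P1 : P (code a1) a1 by split.
pose t0 := [arg min_(t < code a1 | `[< exists a, P t a >]) weil_height R (rep t)]%O.
have [Pt0 t0min] : P t0 (rep t0) /\ forall b, <<1; b>>%VS = {:K}%VS ->
    weil_height R (rep t0) <= weil_height R b.
  rewrite /t0; case: arg_minP; first by apply/asboolP; exists a1.
  move=> t /asboolP/repP Pt tmin; split=> // b genb.
  have [hb|hb] := leP (weil_height R b) h1.
    have Pb : P (code b) b by split.
    have [_ hr cr] := repP _ (ex_intro _ b Pb).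
    have := tmin (code b) (introT (asboolP _) (ex_intro _ b Pb)).
    by rewrite (HG _ _ (codeG _ _ hr hb cr)).
  apply/ltW; apply: le_lt_trans hb; by have [] := Pt.
have [gen0 _ _] := Pt0.
have ex : exists h, (@generator_heights R K `&` lbound (generator_heights K)) h.
  exists (weil_height R (rep t0)); split; first by exists (rep t0).
  by move=> _ [b genb <-]; apply: t0min.
have [[a gena ha] lb] := @xgetPex _ 0 _ ex.
exists a; first by split=> //; rewrite ha.
by move=> b genb; apply: lb; exists b.
Qed.

End Northcott.

(** * Integral elements and the discriminant *)

Lemma ultra_det_le1 (R : realType) (E : fieldType) (u : E -> R) n (M : 'M[E]_n) :
  is_absolute_value u -> ultrametric u -> (forall i j, u (M i j) <= 1) -> u (\det M) <= 1.
Proof.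
move=> hu uu hM; rewrite /determinant; apply: (ultra_sum hu uu) => // t _.
rewrite (avM hu) (avX hu) avN // av1 // expr1n mul1r (av_prod hu).
by apply: prodr_ile1 => i; rewrite av_ge0 //= hM.
Qed.

Lemma integral_av_le1 (R : realType) (K : fieldExtType rat) p (v : K -> R) x :
  prime p -> extends_abs (padic_abs R p) v -> is_integral x -> v x <= 1.
Proof.
move=> pp ev [P monP Px]; have hv := ev.1; have uv := extends_ultrametric pp ev.
rewrite leNgt; apply/negP => x1.
have xn : (map_poly intr P : {poly K})`_(size P).-1 = 1.
  by rewrite coef_map_id0 ?rmorph0 // -lead_coefE (monicP monP).
have sP : size (map_poly intr P : {poly K}) = (size P).-1.+1.
  rewrite size_map_inj_poly ?rmorph0 ?prednK //; last exact: intr_alg_inj.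
  by rewrite size_poly_gt0 monic_neq0.
move: Px; rewrite rootE horner_coef sP big_ord_recr /= xn mul1r addr_eq0 => /eqP e.
have x0 : 0 < v x ^+ (size P).-1 by rewrite exprn_gt0 // (lt_trans ltr01).
have : v (x ^+ (size P).-1) < v x ^+ (size P).-1.
  rewrite -(avN hv) -e; apply: (ultra_sum_lt hv uv) => // i _.
  rewrite (avM hv) (avX hv); apply: le_lt_trans (_ : v x ^+ i < _).
    by rewrite ler_piMl ?exprn_ge0 ?av_ge0 // coef_map_id0 ?rmorph0 // ultra_int.
  by rewrite ltr_eXn2l.
by rewrite (avX hv) ltxx.
Qed.

(** c a is a root of c^(d-1) G(X / c), which is the monic integer polynomial [H] of the proof. *)
Lemma integral_multiple (K E : fieldExtType rat) (s : 'I_(\dim {:K}) -> {rmorphism K -> E}) a c G :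
  primitive_multiple s a c G -> is_integral (c%:R * a).
Proof.
move=> [c0 _ hG]; pose d := \dim {:K}.
have d0 : (0 < d)%N := adim_gt0 {:K}.
have sG : size G = d.+1.
  have := congr1 (fun q : {poly E} => size q) hG.
  rewrite size_map_inj_poly ?rmorph0 //; last exact: intr_alg_inj.
  rewrite size_scale ?natr_alg_eq0 -?lt0n //= => ->.
  by rewrite -big_enum size_prod_XsubC size_enum_ord.
have lG : G`_d = c%:Z.
  have -> : G`_d = lead_coef G by rewrite lead_coefE sG.
  have := congr1 lead_coef hG.
  rewrite lead_coef_map_inj ?rmorph0 //; last exact: intr_alg_inj.
  rewrite lead_coefZ (monicP (monic_prod_XsubC _ _ _)) mulr1 => h.
  exact: (@intr_alg_inj E).
pose H := \poly_(i < d.+1) (if i == d then 1 else G`_i * c%:Z ^+ (d.-1 - i)).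
have Hd : H`_d = 1 by rewrite coef_poly ltnSn eqxx.
have sH : size H = d.+1 by apply: size_poly_eq; rewrite eqxx oner_eq0.
have Ga : \sum_(i < d.+1) (G`_i)%:~R * a ^+ i = 0.
  have k0 : 'I_(\dim {:K}) by exact: (Ordinal d0).
  apply: (fmorph_inj (s k0)); rewrite rmorph0.
  have : root (map_poly intr G : {poly E}) (s k0 a).
    rewrite hG rootZ ?natr_alg_eq0 -?lt0n // rootE horner_prod; apply/eqP.
    by rewrite (bigD1 k0) //= !hornerE subrr mul0r.
  rewrite rootE horner_coef size_map_inj_poly ?rmorph0 //; last exact: intr_alg_inj.
  rewrite sG => /eqP <-; rewrite rmorph_sum; apply: eq_bigr => i _.
  by rewrite rmorphM rmorph_int rmorphXn coef_map_id0 ?rmorph0.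
exists H; first by rewrite monicE lead_coefE sH /= Hd.
rewrite rootE horner_coef size_map_inj_poly ?rmorph0 //; last exact: intr_alg_inj.
rewrite sH; apply/eqP.
transitivity (c%:R ^+ d.-1 * \sum_(i < d.+1) (G`_i)%:~R * a ^+ i); last by rewrite Ga mulr0.
rewrite mulr_sumr; apply: eq_bigr => i _.
rewrite coef_map_id0 ?rmorph0 // coef_poly ltn_ord exprMn.
case: eqP => [->|/eqP id].
  rewrite lG mul1r mulrA; congr (_ * _).
  by rewrite -[in LHS](prednK d0) exprS mulrC.
have di : (i <= d.-1)%N by rewrite -ltnS prednK // ltn_neqAle id /= -ltnS ltn_ord.
rewrite rmorphM rmorphXn /= -{2}(subnK di) exprD.
rewrite (_ : (c%:Z)%:~R = c%:R :> K) //.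
by move: (c%:R ^+ (d.-1 - i)) (c%:R ^+ i) (a ^+ i) ((G`_i)%:~R) => x y z t; ring.
Qed.

Section TraceForm.
Variables (K E : fieldExtType rat) (s : 'I_(\dim {:K}) -> {rmorphism K -> E}).
Hypothesis hs : forall i j, s i =1 s j -> i = j.
Local Notation d := (\dim {:K}).

Definition embed_mx (w : 'I_d -> K) : 'M[E]_d := \matrix_(i, k) s k (w i).

Lemma basis_discriminant_embed (w : 'I_d -> K) :
  (basis_discriminant w)%:A = \det (embed_mx w) ^+ 2.
Proof.
rewrite /basis_discriminant -[LHS]/(in_alg E _) -det_map_mx.
have -> : map_mx (in_alg E) (\matrix_(i, j) field_trace (w i * w j)) =
    embed_mx w *m (embed_mx w)^T.
  apply/matrixP => i j; rewrite !mxE /= (field_trace_embed hs); apply: eq_bigr => k _.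
  by rewrite !mxE rmorphM.
by rewrite det_mulmx det_tr expr2.
Qed.

Lemma embed_mx_lincomb (P : 'M[rat]_d) (w y : 'I_d -> K) :
  (forall i, y i = \sum_j P i j *: w j) ->
  embed_mx y = map_mx (in_alg E) P *m embed_mx w.
Proof.
move=> h; apply/matrixP => i k; rewrite !mxE h rmorph_sum; apply: eq_bigr => j _.
by rewrite !mxE embedZ mulr_algl.
Qed.

Lemma embed_mx_coords (w : 'I_d -> K) : \det (embed_mx w) != 0 ->
  forall x, exists c : 'I_d -> rat, x = \sum_i c i *: w i.
Proof.
move=> w0 x.
pose b (i : 'I_d) : K := (vbasis {:K})`_i.
pose P := \matrix_(i, j) coord (vbasis {:K}) j (w i).
have hP i : w i = \sum_j P i j *: b j.
  by rewrite {1}[w i]vbasis_coord; apply: eq_bigr => j _; rewrite mxE.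
have e := embed_mx_lincomb hP.
have Pu : P \in unitmx.
  rewrite unitmxE unitfE; apply: contraNneq w0 => P0.
  by rewrite e det_mulmx det_map_mx P0 rmorph0 mul0r.
pose cx := \row_j coord (vbasis {:K}) j x.
exists (fun i => (cx *m invmx P) 0 i).
rewrite {1}[x]vbasis_coord.
transitivity (\sum_j (cx *m invmx P *m P) 0 j *: b j).
  by apply: eq_bigr => j _; rewrite mulmxKV // mxE.
under [RHS]eq_bigr do rewrite hP scaler_sumr.
rewrite exchange_big; apply: eq_bigr => j _.
rewrite mxE scaler_suml; apply: eq_bigr => i _; by rewrite scalerA.
Qed.

Lemma embed_mx_indep (w : 'I_d -> K) : \det (embed_mx w) != 0 ->
  forall c : 'I_d -> rat, \sum_i c i *: w i = 0 -> forall i, c i = 0.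
Proof.
move=> w0 c c0 i.
have Su : embed_mx w \in unitmx by rewrite unitmxE unitfE.
have : (\row_j (c j)%:A) *m embed_mx w = 0.
  apply/rowP => k; rewrite !mxE -[RHS](rmorph0 (s k)) -c0 rmorph_sum.
  by apply: eq_bigr => j _; rewrite !mxE embedZ mulr_algl.
move/(congr1 (mulmx^~ (invmx (embed_mx w)))); rewrite mulmxK // mul0mx.
by move/rowP/(_ i); rewrite !mxE => /eqP; rewrite scaler_eq0 oner_eq0 orbF => /eqP.
Qed.

Section Places.
Variables (R : realType) (p : nat) (u : E -> R).
Hypotheses (pp : prime p) (eu : extends_abs (padic_abs R p) u).

Let hu := eu.1.
Let uu := extends_ultrametric pp eu.

Lemma integral_embed_le1 x k : is_integral x -> u (s k x) <= 1.
Proof. exact: (integral_av_le1 pp (extends_comp s eu k)). Qed.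

(** If all conjugates of x are integral at p, then |c|_p = 1 by [prime_max_prod], so the integer c
    that makes x integral is prime to p. *)
Lemma locally_integral x : (forall k, u (s k x) <= 1) ->
  exists N : nat, [/\ (0 < N)%N, padic_abs R p N%:R = 1 & is_integral (N%:R * x)].
Proof.
move=> hx; have [c [G hG]] := primitive_multiple_exists hs x.
exists c; split; [by case: hG | | exact: integral_multiple hG].
have := prime_max_prod hG pp eu; rewrite big1 ?mulr1 // => k _.
by rewrite max_l.
Qed.

End Places.

Lemma rat_int_of_embed (r : rat) (R : realType) :
  (forall p (u : E -> R), prime p -> extends_abs (padic_abs R p) u -> u r%:A <= 1) ->
  exists z : int, r = z%:~R.
Proof.
move=> h; apply: (@rat_int_of_padic R) => p pp.
have [u eu] := padic_extension_exists R E pp.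
by rewrite -eu.2; apply: h eu.
Qed.

End TraceForm.

Section IntegralBasis.
Variables (R : realType) (K E : fieldExtType rat) (s : 'I_(\dim {:K}) -> {rmorphism K -> E}).
Hypothesis hs : forall i j, s i =1 s j -> i = j.
Local Notation d := (\dim {:K}).

Lemma integral_disc_int (w : 'I_d -> K) : (forall i, is_integral (w i)) ->
  exists z : int, basis_discriminant w = z%:~R.
Proof.
move=> iw; apply: (@rat_int_of_embed E _ R) => p u pp eu.
have hu := eu.1; rewrite (basis_discriminant_embed hs) (avX hu).
apply: exprn_ile1; first exact: av_ge0.
apply: ultra_det_le1 => //; first exact: extends_ultrametric eu.
by move=> i j; rewrite mxE; apply: integral_embed_le1 eu _ _ (iw i).
Qed.

Lemma integral_scale_int (z : int) (x : K) : is_integral x -> is_integral (x *~ z).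
Proof.
move=> hx; rewrite -mulrzr; apply: integral_mul => //.
exact: (integral_id (intmul 1) z).
Qed.

(* A basis of integers of least absolute discriminant: a coordinate with
   fractional part t in (0, 1) would allow multiplying the discriminant by t^2. *)
Lemma integral_basis_exists : exists w : 'I_d -> K,
  is_integral_basis w /\ \det (embed_mx s w) != 0.
Proof.
pose P k := `[< exists w : 'I_d -> K, [/\ forall i, is_integral (w i),
   \det (embed_mx s w) != 0 & `|basis_discriminant w| = k%:R] >].
have exP : exists k, P k.
  have ex (i : 'I_d) : exists c : nat, (0 < c)%N /\ is_integral (c%:R * (vbasis {:K})`_i).
    have [c [G hG]] := primitive_multiple_exists hs ((vbasis {:K})`_i).
    by exists c; split; [case: hG | exact: integral_multiple hG].
  have [c hc] := choice ex; pose w (i : 'I_d) := (c i)%:R * (vbasis {:K})`_i.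
  have iw i : is_integral (w i) by have [] := hc i.
  have [z hz] := integral_disc_int iw.
  exists `|z|%N; apply/asboolP; exists w; split=> //.
    apply: embed_basis_det => // x.
    exists (fun i => coord (vbasis {:K}) i x / (c i)%:R).
    rewrite {1}[x]vbasis_coord; apply: eq_bigr => i _.
    rewrite /w -av_nat_alg mulr_algl scalerA divfK // pnatr_eq0 -lt0n.
    by have [] := hc i.
  by rewrite hz -intr_norm -abszE.
have [k /asboolP[w [iw w0 wk]] kmin] := ex_minnP exP.
exists w; split=> //; split=> // x ix.
have [c xc] := embed_mx_coords w0 x.
have cint i : exists z : int, c i = z%:~R.
  apply: contrapT => nz; pose f := Num.floor (c i); pose t := c i - f%:~R.
  have t0 : 0 < t.
    rewrite lt_def subr_eq0 subr_ge0 Num.Theory.floor_le ?num_real // andbT.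
    by apply/eqP => e; apply: nz; exists f.
  have t1 : t < 1.
    by rewrite ltrBlDl -[X in _ + X]/(1%:~R) -rmorphD /= floorD1_gt.
  pose y j := if j == i then x - w i *~ f else w j.
  have iy j : is_integral (y j).
    rewrite /y; case: eqP => // _; apply: integral_sub => //.
    exact: integral_scale_int.
  pose Q : 'M[rat]_d := \matrix_(j, l) if j == i then c l - (f%:~R) *+ (l == i) else (j == l)%:R.
  have hQ j : y j = \sum_l Q j l *: w l.
    rewrite /y; case: eqP => [->|/eqP ji].
      under eq_bigr do rewrite mxE eqxx scalerBl.
      rewrite sumrB -xc; congr (_ - _).
      rewrite (bigD1 i) //= eqxx mulr1n big1 ?addr0.
        by rewrite -[RHS]mulr_algl av_int_alg mulrzl.
      by move=> l /negPf ->; rewrite mulr0n scale0r.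
    rewrite (bigD1 j) //= mxE (negPf ji) eqxx scale1r big1 ?addr0 // => l lj.
    by rewrite mxE (negPf ji) eq_sym (negPf lj) scale0r.
  have detQ : \det Q = t.
    rewrite (expand_det_col _ i) (bigD1 i) //= big1 ?addr0.
      rewrite mxE !eqxx mulr1n /cofactor -signr_odd addnn odd_double expr0 mul1r.
      rewrite (_ : row' _ _ = 1%:M) ?det1 ?mulr1 //.
      apply/matrixP => a b; rewrite !mxE eq_sym (negPf (neq_lift _ _)).
      by rewrite (inj_eq lift_inj).
    by move=> j ji; rewrite mxE (negPf ji) mul0r.
  have detE : \det (embed_mx s y) = t%:A * \det (embed_mx s w).
    by rewrite (embed_mx_lincomb s hQ) det_mulmx det_map_mx detQ.
  have discE : basis_discriminant y = t ^+ 2 * basis_discriminant w.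
    apply: (fmorph_inj (in_alg E)); rewrite rmorphM rmorphXn /=.
    by rewrite !(basis_discriminant_embed hs) detE exprMn.
  have y0 : \det (embed_mx s y) != 0.
    by rewrite detE mulf_neq0 // scaler_eq0 oner_eq0 orbF gt_eqF.
  have [z hz] := integral_disc_int iy.
  have zk : `|basis_discriminant y| = `|z|%N%:R by rewrite hz -intr_norm -abszE.
  have := kmin `|z|%N (introT (asboolP _) (ex_intro _ y (And3 iy y0 zk))).
  rewrite -(ler_nat rat) -zk discE normrM wk normrX gtr0_norm // leNgt.
  have k0 : 0 < k%:R :> rat.
    rewrite -wk normr_gt0; apply: contra_neq w0 => w0.
    by apply/eqP; rewrite -sqrf_eq0 -(basis_discriminant_embed hs) w0 scale0r.
  by rewrite gtr_pMl // expr_lt1 ?t1 // ltW.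
have [z hz] := choice cint.
have zx : x = \sum_i w i *~ z i.
  by rewrite xc; apply: eq_bigr => i _; rewrite hz -[LHS]mulr_algl av_int_alg mulrzl.
exists [ffun i => z i]; split.
  by rewrite {1}zx; apply: eq_bigr => i _; rewrite ffunE.
move=> c' xc'; apply/ffunP => i; rewrite ffunE; apply: (@intr_inj rat).
apply/eqP; rewrite -subr_eq0; apply/eqP.
apply: (embed_mx_indep w0 (c := fun i => (z i)%:~R - (c' i)%:~R)).
under eq_bigr do rewrite scalerBl -[_ *: _]mulr_algl av_int_alg mulrzl
  -[X in _ - X]mulr_algl av_int_alg mulrzl.
by rewrite sumrB -zx -xc' subrr.
Qed.

(** The definition picks an arbitrary integral basis, so nonvanishing is needed for every one: each
    x has a positive multiple c x in the lattice, hence the lattice spans K. *)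
Lemma discriminantP : exists w : 'I_d -> K,
  [/\ is_integral_basis w, \det (embed_mx s w) != 0 &
      discriminant K = basis_discriminant w].
Proof.
have [w0 [iw0 _]] := integral_basis_exists.
have ex : exists D, [set basis_discriminant w | w in @is_integral_basis K] D.
  by exists (basis_discriminant w0), w0.
have [w iw hw] := @xgetPex _ 0 _ ex; exists w; split=> //.
apply: embed_basis_det => // x; have [c [G hG]] := primitive_multiple_exists hs x.
have [z [cx _]] := iw.2 _ (integral_multiple hG).
exists (fun i => (z i)%:~R / c%:R).
have c0 : c%:R != 0 :> rat by rewrite pnatr_eq0 -lt0n; case: hG.
have -> : x = c%:R^-1 *: (c%:R * x) by rewrite -av_nat_alg mulr_algl scalerA mulVf // scale1r.
rewrite cx scaler_sumr; apply: eq_bigr => i _.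
by rewrite mulrC -scalerA; congr (_ *: _); rewrite -[RHS]mulr_algl av_int_alg mulrzl.
Qed.

Lemma discriminant_neq0 : discriminant K != 0.
Proof.
have [w [_ w0 ->]] := discriminantP; apply: contra_neq w0 => w0.
by apply/eqP; rewrite -sqrf_eq0 -(basis_discriminant_embed hs) w0 scale0r.
Qed.

Lemma discriminant_int : exists z : int, discriminant K = z%:~R.
Proof. by have [w [[iw _] _ ->]] := discriminantP; apply: integral_disc_int. Qed.

(** Up to integers prime to p the y i are integral, so they are combinations of an integral basis
    with a p-integral matrix P, and the discriminant gets multiplied by det(P)^2. *)
Lemma padic_disc_le p (u : E -> R) (y : 'I_d -> K) : prime p ->
  extends_abs (padic_abs R p) u -> (forall i k, u (s k (y i)) <= 1) ->
  padic_abs R p (basis_discriminant y) <= padic_abs R p (discriminant K).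
Proof.
move=> pp eu hy; have hu := eu.1; have uu := extends_ultrametric pp eu.
have [w [[iw sw] w0 ->]] := discriminantP.
have [N hN] := choice (fun i => locally_integral hs pp eu (hy i)).
have exC i : exists c : {ffun 'I_d -> int}, (N i)%:R * y i = \sum_j w j *~ c j.
  by have [_ _ /sw[c [hc _]]] := hN i; exists c.
have [C hC] := choice exC.
pose P : 'M[rat]_d := \matrix_(i, j) ((C i j)%:~R / (N i)%:R).
have yP i : y i = \sum_j P i j *: w j.
  have N0 : (N i)%:R != 0 :> rat by rewrite pnatr_eq0 -lt0n; case: (hN i).
  have -> : y i = (N i)%:R^-1 *: ((N i)%:R * y i).
    by rewrite -av_nat_alg mulr_algl scalerA mulVf // scale1r.
  rewrite hC scaler_sumr; apply: eq_bigr => j _.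
  by rewrite mxE mulrC -scalerA; congr (_ *: _); rewrite -[RHS]mulr_algl av_int_alg mulrzl.
have hw := padic_abs_value R pp; have hwu := padic_ultrametric R pp.
have disc_y : basis_discriminant y = (\det P) ^+ 2 * basis_discriminant w.
  apply: (fmorph_inj (in_alg E)); rewrite rmorphM rmorphXn /=.
  by rewrite !(basis_discriminant_embed hs) (embed_mx_lincomb s yP) det_mulmx det_map_mx exprMn.
rewrite disc_y (avM hw) (avX hw) ger_pMl ?exprn_ile1 ?av_ge0 //.
  apply: ultra_det_le1 => // i j; rewrite mxE (avM hw) (avV hw).
  by have [_ -> _] := hN i; rewrite invr1 mulr1 ultra_int.
rewrite av_gt0 //; apply: contra_neq w0 => w0.
by apply/eqP; rewrite -sqrf_eq0 -(basis_discriminant_embed hs) w0 scale0r.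
Qed.

End IntegralBasis.

(** * Values of Q(a) at a place over p *)

Section FrobeniusCongruence.
Variables (K : fieldType) (A : set K) (p : nat).
Hypotheses (pp : prime p) (A1 : A 1) (AB : forall x y, A x -> A y -> A (x - y))
  (AM : forall x y, A x -> A y -> A (x * y)).

Definition congr_mod (x y : K) := exists2 D, A D & x - y = p%:R * D.

Let A0 : A 0. Proof. by rewrite -(subrr 1); apply: AB. Qed.
Let AN x : A x -> A (- x). Proof. by rewrite -sub0r; apply: AB. Qed.
Let AD x y : A x -> A y -> A (x + y).
Proof. by move=> Ax Ay; rewrite -[y]opprK; apply/AB/AN. Qed.
Let AX x k : A x -> A (x ^+ k).
Proof. by move=> Ax; elim: k => [|k IH]; rewrite ?expr0 // exprS; apply: AM. Qed.
Let Anat k : A k%:R.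
Proof. by elim: k => [|k IH]; rewrite ?mulr0n // -natr1; apply: AD. Qed.

Lemma congr_mod_refl x : congr_mod x x.
Proof. by exists 0; rewrite // subrr mulr0. Qed.

Lemma congr_mod_sym x y : congr_mod x y -> congr_mod y x.
Proof. by move=> [D AD' e]; exists (- D); [apply: AN | rewrite mulrN -e opprB]. Qed.

Lemma congr_mod_trans x y z : congr_mod x y -> congr_mod y z -> congr_mod x z.
Proof.
move=> [D HD e] [D' HD' e']; exists (D + D'); first exact: AD.
by rewrite mulrDr -e -e' addrA subrK.
Qed.

Lemma congr_modD x y z t : congr_mod x y -> congr_mod z t -> congr_mod (x + z) (y + t).
Proof.
move=> [D HD e] [D' HD' e']; exists (D + D'); first exact: AD.
by rewrite mulrDr -e -e'; ring.
Qed.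

Lemma congr_modM x y z t : A y -> A z -> congr_mod x y -> congr_mod z t ->
  congr_mod (x * z) (y * t).
Proof.
move=> Ay Az [D HD e] [D' HD' e']; exists (D * z + y * D').
  by apply: AD; apply: AM.
by rewrite mulrDr mulrA -e mulrCA -e'; ring.
Qed.

Lemma congr_modX x y k : A x -> A y -> congr_mod x y -> congr_mod (x ^+ k) (y ^+ k).
Proof.
move=> Ax Ay h; elim: k => [|k IH]; first exact: congr_mod_refl.
by rewrite !exprS; apply: congr_modM => //; apply: AX.
Qed.

Lemma frobenius_congrD x y : A x -> A y -> congr_mod ((x + y) ^+ p) (x ^+ p + y ^+ p).
Proof.
move=> Ax Ay; have p0 := prime_gt0 pp.
rewrite exprDn (bigD1 ord0) //= (bigD1 ord_max) /=; last by rewrite -val_eqE /= -lt0n.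
rewrite subn0 bin0 mulr1n expr0 mulr1 subnn binn mulr1n expr0 mul1r addrA.
rewrite -[X in congr_mod _ X]addr0; apply: congr_modD; first exact: congr_mod_refl.
apply: (big_ind (fun z => congr_mod z 0)) => [|z t hz ht|i /andP[i0 ip]].
- exact: congr_mod_refl.
- by rewrite -[0]addr0; apply: congr_modD.
have /dvdnP[q hq] : (p %| 'C(p, i))%N.
  apply: prime_dvd_bin => //; rewrite lt0n ltn_neqAle -ltnS ltn_ord andbT.
  by apply/andP.
exists (x ^+ (p - i) * y ^+ i * q%:R).
  by apply: AM; [apply: AM; apply: AX | apply: Anat].
by rewrite subr0 hq -mulr_natr natrM; ring.
Qed.

Lemma frobenius_iter_congrD k x y : A x -> A y ->
  congr_mod ((x + y) ^+ (p ^ k)) (x ^+ (p ^ k) + y ^+ (p ^ k)).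
Proof.
move=> Ax Ay; elim: k => [|k IH]; first by rewrite expn0 !expr1; apply: congr_mod_refl.
rewrite expnSr !exprM; apply: congr_mod_trans (frobenius_congrD (AX _ Ax) (AX _ Ay)).
by apply: congr_modX => //; [apply/AX/AD | apply: AD; apply: AX].
Qed.

Definition frobenius_fixed k : set K := [set x | A x /\ congr_mod (x ^+ (p ^ k)) x].

(** Because the Frobenius is additive modulo p, its fixed elements form a ring; the congruence then
    passes from [a] to the whole ring that [a] generates. *)
Lemma frobenius_fixed_subring k : [/\ frobenius_fixed k 1,
  forall x y, frobenius_fixed k x -> frobenius_fixed k y -> frobenius_fixed k (x - y) &
  forall x y, frobenius_fixed k x -> frobenius_fixed k y -> frobenius_fixed k (x * y)].
Proof.
have pk : (0 < p ^ k)%N by rewrite expn_gt0 prime_gt0.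
have fD x y : frobenius_fixed k x -> frobenius_fixed k y -> frobenius_fixed k (x + y).
  move=> [Ax hx] [Ay hy]; split; first exact: AD.
  exact: congr_mod_trans (frobenius_iter_congrD k Ax Ay) (congr_modD hx hy).
(* Comparing 0 = (x - x)^(p^k) with the sum of the two powers avoids distinguishing p = 2 from odd
   p. *)
have fN x : frobenius_fixed k x -> frobenius_fixed k (- x).
  move=> [Ax hx]; split; first exact: AN.
  have := frobenius_iter_congrD k (AN Ax) Ax.
  rewrite addNr expr0n gtn_eqF // => h.
  have := congr_modD (congr_mod_sym h) (congr_mod_refl (- x ^+ (p ^ k))).
  rewrite addrK add0r => h2; apply: congr_mod_trans h2 _.
  have [D HD e] := hx; exists (- D); first exact: AN.
  by rewrite mulrN -e; ring.
split=> [|x y hx hy|x y [Ax hx] [Ay hy]].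
- by split=> //; rewrite expr1n; apply: congr_mod_refl.
- exact/fD/fN.
- by split; [apply: AM | rewrite exprMn; apply: congr_modM => //; apply: AX].
Qed.

End FrobeniusCongruence.

Section IntegerPolynomialValues.
Variables (K : fieldExtType rat) (a : K).

(** The ring Z[a]; the next set is the field Q(a). *)
Definition int_poly_values : set K := [set x | exists q : {poly int}, x = (map_poly intr q).[a]].
Definition rat_poly_values : set K :=
  [set x | exists q : {poly rat}, x = (map_poly (in_alg K) q).[a]].

Lemma int_poly_values_subring : [/\ int_poly_values 1,
  forall x y, int_poly_values x -> int_poly_values y -> int_poly_values (x - y) &
  forall x y, int_poly_values x -> int_poly_values y -> int_poly_values (x * y)].
Proof.
split=> [|_ _ [q ->] [r ->]|_ _ [q ->] [r ->]].
- by exists 1; rewrite rmorph1 hornerC.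
- by exists (q - r); rewrite rmorphB !hornerE.
- by exists (q * r); rewrite rmorphM hornerM.
Qed.

Lemma int_poly_values_ind (T : set K) : T 1 -> T a ->
  (forall x y, T x -> T y -> T (x - y)) -> (forall x y, T x -> T y -> T (x * y)) ->
  forall x, int_poly_values x -> T x.
Proof.
move=> T1 Ta TB TM _ [q ->].
have T0 : T 0 by rewrite -(subrr 1); apply: TB.
have TN x : T x -> T (- x) by rewrite -sub0r; apply: TB.
have TD x y : T x -> T y -> T (x + y) by move=> Tx Ty; rewrite -[y]opprK; apply/TB/TN.
have Tnat k : T k%:R by elim: k => [|k IH]; rewrite ?mulr0n // -natr1; apply: TD.
have Tint (z : int) : T z%:~R.
  by case: z => k; [apply: Tnat | rewrite NegzE rmorphN; apply/TN/Tnat].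
elim/poly_ind: q => [|q c IH]; first by rewrite rmorph0 horner0.
rewrite rmorphD rmorphM /= map_polyX map_polyC hornerMXaddC.
by apply: TD; [apply: TM | apply: Tint].
Qed.

Lemma rat_poly_values_frac x : rat_poly_values x ->
  exists (b : int) (y : K), [/\ b != 0, int_poly_values y & x = (b%:~R^-1 : rat) *: y].
Proof.
move=> [q ->]; have [r [b b0 ->]] := rat_poly_scale q.
exists b, (map_poly intr r).[a]; split=> //; first by exists r.
rewrite map_polyZ hornerZ -map_poly_comp /=.
rewrite -[RHS]mulr_algl; congr (_ * _.[_]).
by apply: eq_map_poly => z /=; rewrite av_int_alg.
Qed.

End IntegerPolynomialValues.

Section DistinctValues.
Variables (R : realType) (L : fieldType) (v : L -> R) (p n : nat).
Hypotheses (hv : is_absolute_value v) (uv : ultrametric v) (pp : prime p).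
Variable b : L.
Hypothesis hb : v b ^+ n = p%:R^-1.

(* The nonzero summands have valuations in distinct classes modulo n, so the
   largest one is not cancelled. *)
Lemma distinct_values_le (f : 'I_n -> L) :
  (forall j, f j != 0 -> exists z : int, v (f j) = p%:R ^ z) ->
  forall j, v (f j * b ^+ j) <= v (\sum_i f i * b ^+ i).
Proof.
move=> hf j.
have n0 : (0 < n)%N by apply: leq_ltn_trans (ltn_ord j).
have p1 : 1 < p%:R :> R by rewrite ltr1n prime_gt1.
have pu : p%:R != 0 :> R by rewrite gt_eqF // (lt_trans ltr01).
pose j0 := [arg max_(i > j) v (f i * b ^+ i)]%O.
have jmax i : v (f i * b ^+ i) <= v (f j0 * b ^+ j0).
  by rewrite /j0; case: arg_maxP => // k _; apply.
have [z0|nz] := eqVneq (f j0 * b ^+ j0) 0.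
  by apply: le_trans (jmax j) _; rewrite z0 av0 // av_ge0.
have pos : 0 < v (f j0 * b ^+ j0) by rewrite av_gt0.
have val i : f i * b ^+ i != 0 ->
    exists z : int, v (f i * b ^+ i) ^+ n = p%:R ^ (z * n%:Z - i%:Z).
  move=> fi; have [|z hz] := hf i; first by apply: contraNneq fi => ->; rewrite mul0r.
  exists z; rewrite (avM hv) exprMn (avX hv) exprAC hb hz exprVn exprnN.
  by rewrite [in LHS]exprnP exprz_exp -expfzDr.
have strict i : i != j0 -> v (f i * b ^+ i) < v (f j0 * b ^+ j0).
  move=> ij; rewrite lt_neqAle jmax andbT; apply/eqP => e.
  have fi : f i * b ^+ i != 0 by rewrite -(av_eq0 hv) e av_eq0.
  have [z hz] := val i fi; have [t ht] := val j0 nz.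
  move: hz; rewrite e ht => /(ieexprIz (lt_trans ltr01 p1)) ee.
  have {}ee : t * n%:Z - j0%:Z = z * n%:Z - i%:Z.
    by apply: ee; rewrite gt_eqF.
  case/negP: ij; apply/eqP/val_inj => /=.
  have i_n := ltn_ord i; have j_n := ltn_ord j0.
  have e2 : (t - z) * n%:Z = j0%:Z - i%:Z by rewrite mulrBl; lia.
  have : t - z = 0 by nia.
  lia.
apply: le_trans (jmax j) _.
rewrite (bigD1 j0) //= (ultra_eq hv uv) //.
exact: (ultra_sum_lt hv uv).
Qed.

End DistinctValues.

Lemma indep_span (K : fieldExtType rat) (T : finType) (e : T -> K) :
  (forall c : T -> rat, \sum_i c i *: e i = 0 -> forall i, c i = 0) ->
  #|T| = \dim {:K} -> forall x, exists c : T -> rat, x = \sum_i c i *: e i.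
Proof.
move=> /indep_free; set X := [tuple _ | _ < _] => fX cT x.
have bX : basis_of {:K} X.
  by rewrite basisEfree fX subvf size_tuple cT leqnn.
exists (fun t => coord X (enum_rank t) x).
rewrite {1}(coord_basis bX (memvf x)) [RHS](reindex (@enum_val T T)) /=; last exact/onW_bij/enum_val_bij.
by apply: eq_bigr => i _; rewrite enum_valK (nth_map i) ?size_enum_ord // nth_ord_enum.
Qed.

Section RadicalValues.
Variables (R : realType) (K : fieldExtType rat) (m p : nat) (a : K) (v : K -> R).
Hypotheses (m0 : (0 < m)%N) (pp : prime p) (mp : (m < p)%N) (ha : a ^+ m = 2%:R).
Hypothesis ev : extends_abs (padic_abs R p) v.

Let hv := ev.1.
Let uv := extends_ultrametric pp ev.
Local Notation Za := (int_poly_values a).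

(* With N = m(p - 1) and k = phi(N), a^(p^k) = a * 2^((p^k - 1)/m) and p - 1
   divides (p^k - 1)/m.  So c^(p^k) = c mod p on Z[a], and a c in Z[a] with
   v c < 1 is divisible by p in Z[a]: p is unramified in Q(a). *)
Lemma radical_frobenius : exists2 k, (0 < k)%N & frobenius_fixed Za p k a.
Proof.
have Zaa : Za a by exists 'X; rewrite map_polyX hornerX.
have [Z1 ZB ZM] := int_poly_values_subring a.
(* For m = 1 the prime p may be 2, and Euler's theorem modulo p cannot be applied to 2; but then a =
   2 is a sum of ones. *)
have [m1|m1] := leqP m 1.
  have m_1 : m = 1%N by lia.
  have [F1 FB _] := frobenius_fixed_subring pp Z1 ZB ZM 1.
  have F2 : frobenius_fixed Za p 1 (1 - (1 - 1 - 1)) by exact: (FB _ _ F1 (FB _ _ (FB _ _ F1 F1) F1)).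
  exists 1%N => //; move: F2; rewrite (_ : 1 - (1 - 1 - 1) = a) //.
  by have := ha; rewrite m_1 expr1 => ->; ring.
pose N := (m * p.-1)%N; have p1 := prime_gt1 pp.
have N0 : (0 < N)%N by rewrite muln_gt0 m0 -subn1 subn_gt0.
pose k := totient N; have k0 : (0 < k)%N by rewrite totient_gt0.
have copN : coprime p N.
  rewrite coprimeMr; apply/andP; split; rewrite prime_coprime //; apply/negP => /dvdn_leq.
    by move=> /(_ m0); rewrite leqNgt mp.
  have h : (0 < p.-1)%N by rewrite -subn1 subn_gt0.
  by move=> /(_ h); rewrite leqNgt prednK ?leqnn // ltnW.
have /eqP := Euler_exp_totient copN; rewrite eqn_mod_dvd ?expn_gt0 ?prime_gt0 // => /dvdnP[q hq].
have pk : (p ^ k = (p ^ k - 1).+1)%N by rewrite -addn1 subnK // expn_gt0 prime_gt0.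
have cop2 : coprime 2 p.
  rewrite coprime_sym prime_coprime //; apply/negP => /dvdn_leq => /(_ isT); lia.
have /eqP := Euler_exp_totient cop2; rewrite totient_prime // => e2.
have e3 : (2 ^ (p.-1 * q) = 1 %[mod p])%N by rewrite expnM -modnXm (eqP e2) modnXm exp1n.
move/eqP: e3; rewrite eqn_mod_dvd ?expn_gt0 // => /dvdnP[t ht].
exists k => //; split=> //.
exists (a * t%:R).
  by apply: ZM => //; exists t%:R; rewrite rmorph_nat -polyC_natr hornerC.
have -> : a ^+ (p ^ k) = a * 2%:R ^+ (p.-1 * q).
  by rewrite pk exprS hq /N mulnCA exprM ha mulnC.
have -> : 2%:R ^+ (p.-1 * q) = p%:R * t%:R + 1 :> K.
  by rewrite -natrX -natrM natr1 (mulnC p t) -ht -[(_ - _).+1]addn1 subnK // expn_gt0.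
by ring.
Qed.

Lemma radical_int_le1 x : Za x -> v x <= 1.
Proof.
have va : v a <= 1.
  rewrite -(expr_le1 (n := m)) ?av_ge0 // -(avX hv) ha.
  exact: ultra_nat.
apply: (int_poly_values_ind (T := [set x | v x <= 1])) => //= [|y z y1 z1|y z y1 z1].
- by rewrite av1.
- by apply: le_trans (ultraB hv uv _ _) _; rewrite ge_max y1.
- by rewrite (avM hv) mulr_ile1 ?av_ge0.
Qed.

Lemma radical_divide x : Za x -> v x < 1 -> exists2 y, Za y & v x = p%:R^-1 * v y.
Proof.
move=> Zx x1; have [k k0 fa] := radical_frobenius.
have [Z1 ZB ZM] := int_poly_values_subring a.
have [F1 FB FM] := frobenius_fixed_subring pp Z1 ZB ZM k.
have [_ [D ZD hD]] : frobenius_fixed Za p k x by apply: int_poly_values_ind Zx.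
exists D => //; have vp : v p%:R = p%:R^-1.
  by rewrite -av_nat_alg ev.2 padic_abs_prime.
rewrite -vp -(avM hv) -hD -[RHS](avN hv) opprB.
have pk : (p ^ k = (p ^ k).-1.+1)%N by rewrite prednK // expn_gt0 prime_gt0.
have pk1 : (0 < (p ^ k).-1)%N.
  by rewrite -subn1 subn_gt0 -(exp1n k) ltn_exp2r // prime_gt1.
rewrite pk exprS -{2}[x]mulr1 -mulrBr (avM hv).
have -> : v (1 - x ^+ (p ^ k).-1) = 1.
  rewrite (ultra_eq hv uv) av1 // avN // (avX hv).
  by rewrite expr_lt1 ?av_ge0.
by rewrite mulr1.
Qed.

(** Descent on N with v x > p^-N: dividing by p inside Z[a] multiplies v by p, and v <= 1 on Z[a]
    ends the process. The values being powers of p expresses that p is unramified. *)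
Lemma radical_int_value x : Za x -> x != 0 -> exists z : nat, v x = p%:R ^- z.
Proof.
have p1 : 1 < p%:R :> R by rewrite ltr1n prime_gt1.
have pi1 : p%:R^-1 < 1 :> R by rewrite invf_lt1 // (lt_trans ltr01).
have pi0 : 0 <= p%:R^-1 :> R by rewrite invr_ge0 ler0n.
move=> Zx x0; have vx : 0 < v x by rewrite av_gt0.
have [N /(_ N (leqnn N))] := exp_eventually_small pi0 pi1 vx.
elim: N x Zx x0 vx => [|N IH] x Zx x0 vx hN.
  by move: hN; rewrite expr0 ltNge radical_int_le1.
have := radical_int_le1 Zx; rewrite le_eqVlt => /orP[/eqP->|x1].
  by exists 0%N; rewrite expr0 invr1.
have [y Zy xy] := radical_divide Zx x1.
have y0 : y != 0 by apply: contraTneq vx => y0; rewrite xy y0 av0 // mulr0 ltxx.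
have [||z hz] := IH y Zy y0; first by rewrite av_gt0.
  by move: hN; rewrite xy exprS ltr_pM2l // invr_gt0 (lt_trans ltr01).
by exists z.+1; rewrite xy hz exprS invfM.
Qed.

Lemma radical_value x : rat_poly_values a x -> x != 0 -> exists z : int, v x = p%:R ^ z.
Proof.
move=> /rat_poly_values_frac[b [y [b0 Zy ->]]] x0.
have p0 : p%:R != 0 :> R by rewrite pnatr_eq0 -lt0n prime_gt0.
have y0 : y != 0 by apply: contraNneq x0 => ->; rewrite scaler0.
have [z hz] := radical_int_value Zy y0.
have [t ht] := @padic_abs_expz R p (b%:~R^-1) ltac:(by rewrite invr_eq0 intr_eq0).
by exists (t - z%:Z); rewrite (avZ hv) ev.2 ht hz exprnN expfzDr.
Qed.

Lemma rat_poly_values_sum n (c : 'I_n -> rat) : rat_poly_values a (\sum_i c i *: a ^+ i).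
Proof.
exists (\sum_i c i *: 'X^i); rewrite rmorph_sum horner_sum; apply: eq_bigr => i _.
by rewrite /= map_polyZ map_polyXn hornerZ hornerXn mulr_algl.
Qed.

Variables (n : nat) (b : K).
Hypothesis hb : v b ^+ n = p%:R^-1.

Lemma radical_coef_le (f : 'I_n -> K) : (forall j, rat_poly_values a (f j)) ->
  forall j, v (f j * b ^+ j) <= v (\sum_i f i * b ^+ i).
Proof.
by move=> hf; apply: (distinct_values_le hv uv pp hb) => j; apply: radical_value.
Qed.

End RadicalValues.

(** * Degree of the radical field *)

Lemma av_root_value (R : realType) (K : fieldExtType rat) (p n : nat) (r : rat) (b : K) (v : K -> R) :
  extends_abs (padic_abs R p) v -> b ^+ n = r%:A -> v b ^+ n = padic_abs R p r.
Proof. by move=> [hv vw] hb; rewrite -(avX hv) hb vw. Qed.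

Section RadicalDegree.
Variables (R : realType) (K : fieldExtType rat) (m n p : nat) (a b : K) (r : rat).
Hypotheses (m0 : (0 < m)%N) (n0 : (0 < n)%N) (pp : prime p) (mp : (m < p)%N).
Hypotheses (ha : a ^+ m = 2%:R) (hb : b ^+ n = r%:A) (hr : padic_abs R p r = p%:R^-1).

Definition radical_tuple (ij : 'I_m * 'I_n) : K := a ^+ ij.1 * b ^+ ij.2.

(** X^m - 2 is Eisenstein at 2: at a place over 2 the powers of a have values in distinct classes
    modulo those of the rationals, so no cancellation occurs. *)
Lemma radical_a_indep (c : 'I_m -> rat) : \sum_i c i *: a ^+ i = 0 -> forall i, c i = 0.
Proof.
move=> c0 i; have [v ev] := @padic_extension_exists R K 2 isT.
have hv := ev.1; have uv := extends_ultrametric (isT : prime 2) ev.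
have va : v a ^+ m = 2%:R^-1.
  by rewrite -(avX hv) ha -av_nat_alg ev.2 padic_abs_prime.
have h : v ((c i)%:A * a ^+ i) <= 0.
  rewrite -[leRHS](av0 hv) -c0; under eq_bigr do rewrite -mulr_algl.
  apply: (distinct_values_le hv uv (isT : prime 2) va (f := fun i => (c i)%:A)) => j cj.
  rewrite ev.2; apply: padic_abs_expz.
  by apply: contraNneq cj => ->; rewrite scale0r.
have a0 : a != 0.
  by apply: contra_eq_neq ha => ->; rewrite expr0n gtn_eqF // eq_sym natr_alg_eq0.
move: h; rewrite (avM hv) pmulr_lle0 ?av_gt0 ?expf_neq0 // ev.2 => h.
apply/eqP; rewrite -(av_eq0 (padic_abs_value R (isT : prime 2))) eq_le h.
exact: av_ge0 (padic_abs_value R (isT : prime 2)) _.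
Qed.

Lemma radical_tuple_split (c : 'I_m * 'I_n -> rat) :
  \sum_ij c ij *: radical_tuple ij = \sum_j (\sum_i c (i, j) *: a ^+ i) * b ^+ j.
Proof.
transitivity (\sum_i \sum_j c (i, j) *: radical_tuple (i, j)).
  by rewrite pair_bigA; apply: eq_bigr => -[].
rewrite exchange_big; apply: eq_bigr => j _; rewrite mulr_suml; apply: eq_bigr => i _.
by rewrite -scalerAl.
Qed.

(** At a place over p the powers of b have values in distinct classes modulo those of Q(a). So each
    coefficient in Q(a) vanishes, and the independence of the powers of a finishes. *)
Lemma radical_tuple_indep (c : 'I_m * 'I_n -> rat) :
  \sum_ij c ij *: radical_tuple ij = 0 -> forall ij, c ij = 0.
Proof.
rewrite radical_tuple_split => c0 [i j].
have [v ev] := padic_extension_exists R K pp.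
have hv := ev.1; have vb := av_root_value ev hb; rewrite hr in vb.
have b0 : b != 0.
  apply: contra_eq_neq vb => ->; rewrite av0 // expr0n gtn_eqF //= eq_sym invr_eq0.
  by rewrite pnatr_eq0 -lt0n prime_gt0.
have := radical_coef_le m0 pp mp ha ev vb
  (fun j => rat_poly_values_sum a (fun i => c (i, j))) j.
rewrite c0 av0 // (avM hv) pmulr_lle0 ?av_gt0 ?expf_neq0 // => h.
have : v (\sum_i c (i, j) *: a ^+ i) == 0 by rewrite eq_le h av_ge0.
by rewrite av_eq0 // => /eqP/radical_a_indep.
Qed.

Lemma radical_degree_ge : (m * n <= \dim {:K})%N.
Proof. by have := indep_card radical_tuple_indep; rewrite card_prod !card_ord. Qed.

Lemma adjoin_degree_root_le (F : {subfield K}) (x : K) k y : (0 < k)%N ->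
  x ^+ k = y -> y \in F -> (adjoin_degree F x <= k)%N.
Proof.
move=> k0 xk yF; pose q : {poly K} := 'X^k - y%:P.
have sq : size q = k.+1 by apply: size_XnsubC.
have q0 : q != 0 by rewrite -size_poly_gt0 sq.
rewrite -ltnS -sq -size_minPoly; apply: dvdp_leq => //; apply: minPoly_dvdp.
  by rewrite rpredB ?rpredX ?polyOverX // polyOverC.
by rewrite rootE !hornerE xk subrr.
Qed.

Lemma radical_degree : <<1 & [:: a; b]>>%VS = {:K}%VS -> \dim {:K} = (m * n)%N.
Proof.
move=> gen; apply/eqP; rewrite eqn_leq radical_degree_ge andbT -gen /=.
rewrite adjoin_cons adjoin_seq1 !dim_Fadjoin dimv1 muln1 mulnC leq_mul //.
  by apply: adjoin_degree_root_le ha _ => //; rewrite rpredMn // rpred1.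
by apply: adjoin_degree_root_le hb _ => //; rewrite rpredZ // rpred1.
Qed.

Lemma radical_span : \dim {:K} = (m * n)%N -> forall x,
  exists c : 'I_m * 'I_n -> rat, x = \sum_ij c ij *: radical_tuple ij.
Proof. by move=> hd; apply: (indep_span radical_tuple_indep); rewrite card_prod !card_ord. Qed.

End RadicalDegree.

(** * Determinants indexed by pairs, and Vandermonde determinants *)

Section BlockDeterminant.
Variable R : comNzRingType.

Lemma det_reindex d d' (I : Type) (F : I -> I -> R) (g : 'I_d' -> I) (h : 'I_d -> I)
    (f : 'I_d' -> 'I_d) : bijective f -> (forall k, h (f k) = g k) ->
  \det (\matrix_(k, l < d') F (g k) (g l)) = \det (\matrix_(k, l < d) F (h k) (h l)).
Proof.
move=> bf hf; have dd : d' = d by have := bij_eq_card bf; rewrite !card_ord.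
case: d / dd h f bf hf => h f bf hf.
pose s := perm (bij_inj bf).
have -> : \matrix_(k, l) F (g k) (g l) = row_perm s (col_perm s (\matrix_(k, l) F (h k) (h l))).
  by apply/matrixP => k l; rewrite !mxE !permE !hf.
rewrite row_permE col_permE !det_mulmx !det_perm odd_permV mulrCA.
by rewrite -signr_addb addbb mulr1.
Qed.

Lemma det_mxdiag m (q : 'I_m -> nat) (B : forall i, 'M[R]_(q i)) :
  \det (mxdiag B) = \prod_i \det (B i).
Proof.
elim: m q B => [|m IH] q B.
  have h e (M : 'M[R]_e) : e = 0%N -> \det M = 1.
    by move=> e0; move: M; rewrite e0 => M; rewrite det_mx00.
  by rewrite [RHS]big_ord0 h // big_ord0.
rewrite mxdiag_recl [RHS]big_ord_recl -IH.
have det_cast e e' (ee : (e = e') * (e = e')) (M : 'M[R]_e) : \det (castmx ee M) = \det M.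
  case: ee => e1 e2; case: e' / e1 e2 => e2; congr (\det _).
  by apply/matrixP => i j; rewrite castmxE; congr (M _ _); apply: val_inj.
by rewrite det_cast det_ublock.
Qed.

Lemma det_block d m n (h : 'I_d -> 'I_m * 'I_n) (T : 'I_m -> 'I_n -> 'I_n -> R) :
  bijective h ->
  \det (\matrix_(k, l) if (h k).1 == (h l).1 then T (h k).1 (h k).2 (h l).2 else 0) =
  \prod_i \det (\matrix_(k, l) T i k l).
Proof.
move=> [hi hK hiK].
pose F (x y : 'I_m * 'I_n) := if x.1 == y.1 then T x.1 x.2 y.2 else 0.
rewrite -(det_mxdiag (q := fun=> n) (fun i => \matrix_(k, l) T i k l)).
pose S := (\sum_(i < m) n)%N.
pose g (r : 'I_S) : 'I_m * 'I_n := (tagnat.sig1 r, tagnat.sig2 r).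
transitivity (\det (\matrix_(k, l) F (g k) (g l))); last first.
  congr (\det _); apply/matrixP => k l; rewrite !mxE /F /g /=.
  case: eqP => [e|//]; last by rewrite mxE.
  by rewrite conform_mx_id mxE.
have bg : bijective g.
  pose gi (x : 'I_m * 'I_n) : 'I_S := tagnat.Rank x.1 x.2.
  exists gi => [r|[i j]]; first by rewrite /gi /g /= tagnat.sig2K.
  rewrite /g /gi; have := tagnat.rankK (Tagged (fun=> 'I_n) j : {i : 'I_m & 'I_n}).
  by rewrite /tagnat.sig1 /tagnat.sig2 /tagnat.Rank => ->.
have bhi : bijective hi by exists h.
by apply/esym/(det_reindex F (bij_comp bhi bg)) => r /=; rewrite hiK.
Qed.

(** The matrix is the Kronecker product of X with the identity, times the block diagonal matrix of
    the T i. The first factor is block diagonal too once the two indices are swapped. *)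
Lemma det_grid d m n (h : 'I_d -> 'I_m * 'I_n) (X : 'I_m -> 'I_m -> R)
    (T : 'I_m -> 'I_n -> 'I_n -> R) : bijective h ->
  \det (\matrix_(k, l) (X (h k).1 (h l).1 * T (h l).1 (h k).2 (h l).2)) =
  \det (\matrix_(i, j) X i j) ^+ n * \prod_i \det (\matrix_(k, l) T i k l).
Proof.
move=> bh; pose sw (x : 'I_m * 'I_n) := (x.2, x.1).
have bsw : bijective (sw \o h).
  by apply: bij_comp bh; exists (fun x => (x.2, x.1)); case.
rewrite -(det_block T bh).
have -> : \det (\matrix_(i, j) X i j) ^+ n = \prod_(j < n) \det (\matrix_(i, i') X i i').
  by rewrite prodr_const card_ord.
rewrite -(det_block (fun _ : 'I_n => X) bsw) -det_mulmx; congr (\det _).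
apply/matrixP => k l; rewrite !mxE /=.
have [hi hK hiK] := bh.
rewrite (bigD1 (hi ((h l).1, (h k).2))) //= !mxE hiK /= !eqxx big1 ?addr0 // => q ql.
rewrite !mxE; case: eqP => [e2|]; last by rewrite mul0r.
case: eqP => [e1|]; last by rewrite mulr0.
by case/negP: ql; rewrite -e1 e2 -surjective_pairing hK.
Qed.

End BlockDeterminant.

Section VandermondeAbs.
Variables (R : realType) (E : fieldType) (u : E -> R) (n : nat) (x : 'I_n -> E).
Hypothesis hu : is_absolute_value u.

Definition vander : 'M[E]_n := \matrix_(i, j) x j ^+ i.

Lemma vander_sq_abs : u (\det vander) ^+ 2 = \prod_i \prod_(j | j != i) u (x i - x j).
Proof.
have -> : vander = Vandermonde n (\row_j x j) by apply/matrixP => i j; rewrite !mxE.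
have -> : u (\det (Vandermonde n (\row_j x j))) =
    \prod_(i < n) \prod_(j < n | (i < j)%N) u (x i - x j).
  rewrite det_Vandermonde (av_prod hu); apply: eq_bigr => i _; rewrite (av_prod hu).
  by apply: eq_big => [j //|j _]; rewrite !mxE (avB hu).
rewrite expr2; set P := \prod_(i < n) \prod_(j < n | (i < j)%N) _.
have PE : P = \prod_(i < n) \prod_(j < n | (j < i)%N) u (x i - x j).
  rewrite /P (exchange_big_dep xpredT) //=; apply: eq_bigr => i _.
  by apply: eq_bigr => j _; rewrite (avB hu).
rewrite {2}PE -big_split /=; apply: eq_bigr => i _.
rewrite [RHS](bigID (fun j : 'I_n => (i < j)%N)) /=; congr (_ * _); apply: eq_bigl => j.
  by rewrite andbC -val_eqE /=; case: ltngtP.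
by rewrite andbC -val_eqE /= -leqNgt ltn_neqAle andbC.
Qed.

Lemma vander_det_neq0 : injective x -> \det vander != 0.
Proof.
move=> xi; rewrite -(av_eq0 hu) -sqrf_eq0 vander_sq_abs.
apply/prodf_neq0 => i _; apply/prodf_neq0 => j ji.
by rewrite av_eq0 // subr_eq0; apply: contra ji => /eqP/xi->.
Qed.

Lemma vander_deriv (q : {poly E}) : q = \prod_j ('X - (x j)%:P) ->
  u (\det vander) ^+ 2 = \prod_i u (q^`()).[x i].
Proof.
move=> hq; rewrite vander_sq_abs; apply: eq_bigr => i _.
rewrite -(av_prod hu); congr (u _).
have -> : q = ('X - (x i)%:P) * \prod_(j | j != i) ('X - (x j)%:P) by rewrite hq (bigD1 i).
rewrite derivM derivXsubC mul1r !hornerE subrr mul0r addr0 horner_prod.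
by apply: eq_bigr => j _; rewrite !hornerE.
Qed.

End VandermondeAbs.

(** * Conjugates and discriminant of the radical field *)

Section Grid.
Variables (R : realType) (K E : fieldExtType rat) (s : 'I_(\dim {:K}) -> {rmorphism K -> E}).
Hypothesis hs : forall i j, s i =1 s j -> i = j.
Variables (m n p : nat) (a b : K) (r : rat).
Hypotheses (m0 : (0 < m)%N) (n0 : (0 < n)%N) (pp : prime p) (mp : (m < p)%N).
Hypotheses (ha : a ^+ m = 2%:R) (hb : b ^+ n = r%:A) (hr : padic_abs R p r = p%:R^-1).
Hypothesis hd : \dim {:K} = (m * n)%N.

(** An embedding is determined by the images of a and b, among at most m and at most n conjugates.
    As there are mn embeddings, every pair of conjugates occurs exactly once. *)
Lemma embedding_grid : exists (x : 'I_m -> E) (y : 'I_n -> E) (h : 'I_(\dim {:K}) -> 'I_m * 'I_n),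
  [/\ injective x, injective y, bijective h,
      forall k, s k a = x (h k).1 & forall k, s k b = y (h k).2].
Proof.
pose rts (c : K) := undup [seq s k c | k <- enum 'I_(\dim {:K})].
have size_rts c k y0 : (0 < k)%N -> c ^+ k = y0%:A -> (size (rts c) <= k)%N.
  move=> k0 ck; pose q : {poly E} := 'X^k - y0%:A%:P.
  have sq : size q = k.+1 by apply: size_XnsubC.
  rewrite -ltnS -sq; apply: max_poly_roots; last exact: undup_uniq.
    by rewrite -size_poly_gt0 sq.
  apply/allP => z; rewrite mem_undup => /mapP[l _ ->].
  by rewrite rootE !hornerE -rmorphXn ck embed_alg subrr.
have sA : (size (rts a) <= m)%N by apply: (size_rts a m 2%:R) => //; rewrite av_nat_alg.
have sB : (size (rts b) <= n)%N by apply: (size_rts b n r).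
have in_rts c k : s k c \in rts c.
  by rewrite mem_undup; apply: (map_f (fun k => s k c)); rewrite mem_enum.
have inj_ab k l : s k a = s l a -> s k b = s l b -> k = l.
  move=> ea eb; apply: hs => z.
  have [c ->] := radical_span m0 n0 pp mp ha hb hr hd z.
  rewrite !rmorph_sum; apply: eq_bigr => ij _.
  by rewrite !embedZ !rmorphM !rmorphXn ea eb.
have card_le : (m * n <= size (rts a) * size (rts b))%N.
  rewrite -hd -[leqLHS]card_ord.
  pose f (k : 'I_(\dim {:K})) : 'I_(size (rts a)) * 'I_(size (rts b)) :=
    (Ordinal (etrans (index_mem _ _) (in_rts a k)), Ordinal (etrans (index_mem _ _) (in_rts b k))).
  have := @leq_card _ _ f; rewrite card_prod !card_ord; apply.
  move=> k l [ea eb]; apply: inj_ab.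
    by rewrite -(nth_index 0 (in_rts a k)) -(nth_index 0 (in_rts a l)) ea.
  by rewrite -(nth_index 0 (in_rts b k)) -(nth_index 0 (in_rts b l)) eb.
have eA : size (rts a) = m by nia.
have eB : size (rts b) = n by nia.
have lA k : (index (s k a) (rts a) < m)%N by rewrite -[X in (_ < X)%N]eA index_mem in_rts.
have lB k : (index (s k b) (rts b) < n)%N by rewrite -[X in (_ < X)%N]eB index_mem in_rts.
exists (fun i => (rts a)`_i), (fun j => (rts b)`_j), (fun k => (Ordinal (lA k), Ordinal (lB k))).
split=> [i j e|i j e||k|k] /=.
- by apply/val_inj/eqP; move/eqP: e; rewrite nth_uniq ?undup_uniq // ?eA ltn_ord.
- by apply/val_inj/eqP; move/eqP: e; rewrite nth_uniq ?undup_uniq // ?eB ltn_ord.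
- apply: inj_card_bij => [k l [ea eb]|]; last by rewrite card_prod !card_ord hd.
  apply: inj_ab.
    by rewrite -(nth_index 0 (in_rts a k)) -(nth_index 0 (in_rts a l)) ea.
  by rewrite -(nth_index 0 (in_rts b k)) -(nth_index 0 (in_rts b l)) eb.
- by rewrite nth_index.
- by rewrite nth_index.
Qed.

End Grid.

Lemma prod_XsubC_roots (E : fieldType) n (x : 'I_n -> E) (c : E) : (0 < n)%N -> injective x ->
  (forall i, x i ^+ n = c) -> 'X^n - c%:P = \prod_i ('X - (x i)%:P).
Proof.
move=> n0 xi hx; rewrite -[RHS]big_enum -(big_map x xpredT (fun z => 'X - z%:P)).
have sz : size ('X^n - c%:P : {poly E}) = n.+1 by apply: size_XnsubC.
rewrite {1}(@all_roots_prod_XsubC _ ('X^n - c%:P) [seq x i | i <- enum 'I_n]).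
- by rewrite (monicP (monicXnsubC _ n0)) scale1r.
- by rewrite sz size_map size_enum_ord.
- by apply/allP => z /mapP[i _ ->]; rewrite rootE !hornerE hx subrr.
- by rewrite uniq_rootsE map_inj_uniq ?enum_uniq.
Qed.

Lemma prod_eq1_le1 (R : realType) (I : finType) (P : pred I) (F : I -> R) :
  (forall i, 0 <= F i <= 1) -> \prod_(i | P i) F i = 1 -> forall i, P i -> F i = 1.
Proof.
move=> hF h i Pi; move: h; rewrite (bigD1 i) //= => h.
apply/eqP; rewrite eq_le; have /andP[F0 ->] := hF i; rewrite /= -h.
by rewrite ler_piMr //; apply: prodr_ile1.
Qed.

Lemma generator_of_distinct (K E : fieldExtType rat) (s : 'I_(\dim {:K}) -> {rmorphism K -> E}) a :
  injective (fun k => s k a) -> <<1; a>>%VS = {:K}%VS.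
Proof.
move=> inj; have /polyOver1P[g hg] := minPolyOver 1 a.
have g0 : g != 0.
  by rewrite -(map_poly_eq0 (in_alg K)) -hg monic_neq0 // monic_minPoly.
apply/eqP; rewrite eqEdim subvf /= dim_Fadjoin dimv1 muln1 -ltnS -size_minPoly hg size_map_poly.
rewrite -(size_map_poly (in_alg E)).
have -> : \dim {:K} = size [seq s k a | k <- enum 'I_(\dim {:K})] by rewrite size_map size_enum_ord.
apply: max_poly_roots; rewrite ?map_poly_eq0 //.
  apply/allP => z /mapP[k _ ->]; rewrite rootE -embed_horner -hg minPolyxx rmorph0 //.
by rewrite map_inj_uniq ?enum_uniq.
Qed.

Section RadicalDiscriminant.
Variables (R : realType) (K E : fieldExtType rat) (s : 'I_(\dim {:K}) -> {rmorphism K -> E}).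
Hypothesis hs : forall i j, s i =1 s j -> i = j.
Variables (m n p : nat) (a b : K) (r : rat).
Hypotheses (m0 : (0 < m)%N) (n0 : (0 < n)%N) (pp : prime p) (mp : (m < p)%N).
Hypotheses (ha : a ^+ m = 2%:R) (hb : b ^+ n = r%:A) (hr : padic_abs R p r = p%:R^-1).
Hypothesis hd : \dim {:K} = (m * n)%N.
Variables (x : 'I_m -> E) (y : 'I_n -> E) (h : 'I_(\dim {:K}) -> 'I_m * 'I_n).
Hypotheses (xi : injective x) (yi : injective y) (bh : bijective h)
  (hx : forall k, s k a = x (h k).1) (hy : forall k, s k b = y (h k).2).

Lemma grid_root_x i : x i ^+ m = 2%:R.
Proof.
have [hi hK hiK] := bh; have -> : x i = x (h (hi (i, Ordinal n0))).1 by rewrite hiK.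
by rewrite -hx -rmorphXn ha rmorph_nat.
Qed.

Lemma grid_root_y j : y j ^+ n = r%:A.
Proof.
have [hi hK hiK] := bh; have -> : y j = y (h (hi (Ordinal m0, j))).2 by rewrite hiK.
by rewrite -hy -rmorphXn hb embed_alg.
Qed.

Lemma embed_mx_grid (w : 'I_(\dim {:K}) -> K) (Y : 'I_n -> K)
    (T : 'I_m -> 'I_n -> 'I_n -> E) :
  (forall k, w k = a ^+ (h k).1 * Y (h k).2) ->
  (forall k l, s l (Y (h k).2) = T (h l).1 (h k).2 (h l).2) ->
  \det (embed_mx s w) = \det (vander x) ^+ n * \prod_i \det (\matrix_(j, t) T i j t).
Proof.
move=> hw hT; rewrite -(det_grid (fun i j => x j ^+ i) T bh).
congr (\det _); apply/matrixP => k l.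
by rewrite !mxE hw rmorphM rmorphXn hx hT.
Qed.

Variable u : E -> R.
Hypothesis eu : extends_abs (padic_abs R p) u.

Let hu := eu.1.
Let uu := extends_ultrametric pp eu.

Lemma grid_x_le1 i : u (x i) <= 1.
Proof.
rewrite -(expr_le1 (n := m)) ?av_ge0 // -(avX hu) grid_root_x; exact: ultra_nat.
Qed.

(** The square is the discriminant of X^m - 2, up to sign m^m 2^(m-1), and p > m is prime to it; for
    m = 1 the factor 2 is absent. *)
Lemma vander_x_unit : u (\det (vander x)) = 1.
Proof.
have unat k : (0 < k)%N -> (k < p)%N -> u k%:R = 1.
  move=> k0 kp; rewrite -av_nat_alg eu.2 padic_abs_coprime //.
  by apply/negP => /(dvdn_leq k0); rewrite leqNgt kp.
apply/eqP; rewrite -sqrp_eq1 ?av_ge0 //; apply/eqP.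
rewrite (vander_deriv hu (prod_XsubC_roots m0 xi grid_root_x)).
rewrite big1 // => i _; rewrite derivB derivXn derivC subr0 hornerMn hornerXn.
rewrite -mulr_natl (avM hu) unat // mul1r (avX hu).
have [m1|m1] := leqP m 1; first by rewrite (_ : m.-1 = 0%N) ?expr0 //; lia.
have ux : u (x i) = 1.
  apply/eqP; rewrite -(pexpr_eq1 (n := m)) ?av_ge0 // -(avX hu) grid_root_x unat //.
  exact: leq_ltn_trans m1 mp.
by rewrite ux expr1n.
Qed.

(** The differences have values at most 1 and their product has value 1. Thus distinct conjugates of
    a remain distinct modulo the places over p. *)
Lemma grid_x_sub i j : i != j -> u (x i - x j) = 1.
Proof.
move=> ij; have := vander_sq_abs x hu; rewrite vander_x_unit expr1n.
have b1 k l : 0 <= u (x k - x l) <= 1.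
  by rewrite av_ge0 //=; apply: le_trans (ultraB hu uu _ _) _; rewrite ge_max !grid_x_le1.
move=> /esym hp; have := prod_eq1_le1 _ hp (i := i) isT.
have b2 k : 0 <= \prod_(l | l != k) u (x k - x l) <= 1.
  by rewrite prodr_ge0 ?prodr_ile1 // => l _; apply: av_ge0.
move/(_ b2) => h2; apply: (prod_eq1_le1 (b1 i) h2).
by rewrite eq_sym.
Qed.

Lemma grid_y_value j : u (y j) ^+ n = p%:R^-1.
Proof. by rewrite -(avX hu) grid_root_y eu.2 hr. Qed.

Lemma grid_y_lt1 j : u (y j) < 1.
Proof.
rewrite -(expr_lt1 (n := n)) ?av_ge0 // grid_y_value invf_lt1 ?ltr0n ?prime_gt0 //.
by rewrite ltr1n prime_gt1.
Qed.

(** The derivative at a root is n y^(n-1). Its factor n may be divisible by p and is only bounded by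
    1, hence an inequality. *)
Lemma vander_y_le : u (\det (vander y)) ^+ 2 <= p%:R ^- n.-1.
Proof.
rewrite (vander_deriv hu (prod_XsubC_roots n0 yi grid_root_y)).
apply: (@le_trans _ _ (\prod_j u (y j) ^+ n.-1)).
  apply: ler_prod => j _; rewrite av_ge0 //= derivB derivXn derivC subr0 hornerMn hornerXn.
  rewrite -mulr_natl (avM hu) (avX hu) ler_piMl ?exprn_ge0 ?av_ge0 //.
  exact: ultra_nat.
have e j : u (y j) = u (y (Ordinal n0)).
  by apply/eqP; rewrite -(eqrXn2 n0) ?av_ge0 // !grid_y_value.
under eq_bigr do rewrite e.
by rewrite prodr_const card_ord exprAC grid_y_value exprVn.
Qed.

(** The a^i b^j span the integers locally at p. By non-cancellation each f_j b^j has value at most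
    1; as v(f_j) = p^z and v(b)^n = 1/p, this says z n <= j < n, so z <= 0. The rational
    coefficients of f_j are then integral at p because the Vandermonde matrix of the conjugates of a
    is invertible there. *)
Lemma radical_locally_maximal (w : K) : (forall k, u (s k w) <= 1) ->
  forall c : 'I_m * 'I_n -> rat, w = \sum_ij c ij *: radical_tuple a b ij ->
  forall ij, padic_abs R p (c ij) <= 1.
Proof.
move=> iw c wc [i j]; have [hi hK hiK] := bh.
have p1 : 1 < p%:R :> R by rewrite ltr1n prime_gt1.
pose f j := \sum_i c (i, j) *: a ^+ i.
have sf (k : 'I_(\dim {:K})) : u (s k (f j)) <= 1.
  have ev := extends_comp s eu k.
  have vb : (u \o s k) b ^+ n = p%:R^-1 by rewrite (av_root_value ev hb) hr.
  have fQ j' : rat_poly_values a (f j') := rat_poly_values_sum a _.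
  have := radical_coef_le m0 pp mp ha ev vb fQ j.
  rewrite -radical_tuple_split -wc (avM ev.1) => /le_trans/(_ (iw k)) hle.
  have [->|fj0] := eqVneq (f j) 0; first by rewrite rmorph0 av0.
  have [z hz] := radical_value m0 pp mp ha ev (fQ j) fj0.
  rewrite -[u (s k (f j))]/((u \o s k) (f j)) hz -[X in _ <= X](expr0z p%:R).
  rewrite ler_eXz2l // leNgt; apply/negP => z0.
  have bp : 0 < (u \o s k) b ^+ j.
    rewrite exprn_gt0 // av_gt0 //; first exact: ev.1.
    apply: contra_eq_neq vb => ->; rewrite (av0 ev.1) expr0n gtn_eqF //= eq_sym.
    by rewrite invr_eq0 pnatr_eq0 -lt0n prime_gt0.
  have : (p%:R ^ z * (u \o s k) b ^+ j) ^+ n <= 1.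
    apply: exprn_ile1; first by rewrite mulr_ge0 ?(ltW bp) // exprz_ge0 ?ler0n.
    by rewrite -hz -(avX ev.1).
  rewrite exprMn exprAC vb exprVn exprnN [X in X * _]exprnP exprz_exp -expfzDr; last first.
    by rewrite gt_eqF // (lt_trans ltr01).
  rewrite -[X in _ <= X](expr0z p%:R) ler_eXz2l //; have := ltn_ord j; nia.
have zx (i' : 'I_m) : u (\sum_i (c (i, j))%:A * x i' ^+ i) <= 1.
  have := sf (hi (i', Ordinal n0)); rewrite rmorph_sum.
  under eq_bigr do rewrite embedZ rmorphXn hx hiK -mulr_algl.
  by [].
pose C := \row_i (c (i, j))%:A : 'rV[E]_m.
have Vu : vander x \in unitmx.
  by rewrite unitmxE unitfE -(av_eq0 hu) vander_x_unit oner_eq0.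
have : C = (C *m vander x) *m invmx (vander x) by rewrite mulmxK.
move/rowP/(_ i); rewrite !mxE => e; rewrite -eu.2 e.
apply: (ultra_sum hu uu) => // k _; rewrite (avM hu).
have h1 : u ((C *m vander x) 0 k) <= 1.
  by rewrite !mxE; under eq_bigr do rewrite !mxE; apply: zx.
have h2 : u (invmx (vander x) k i) <= 1.
  rewrite /invmx Vu mxE (avM hu) (avV hu) vander_x_unit invr1 mul1r mxE.
  rewrite /cofactor (avM hu) (avX hu) avN // av1 // expr1n mul1r.
  apply: ultra_det_le1 => // k' l'; rewrite !mxE (avX hu).
  by apply: exprn_ile1; [apply: av_ge0 | apply: grid_x_le1].
by apply: mulr_ile1; rewrite ?av_ge0.
Qed.

(** By local maximality an integral basis is a p-integral combination of the a^i b^j, whose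
    discriminant splits into the n-th power of that of a and the m-th power of that of b. *)
Lemma radical_discriminant_le :
  padic_abs R p (discriminant K) <= p%:R ^- (m * n.-1).
Proof.
have [w [[iw _] w0 ->]] := discriminantP R hs.
pose W k := radical_tuple a b (h k).
have [hi hK hiK] := bh.
have [c hc] := choice (fun k => radical_span m0 n0 pp mp ha hb hr hd (w k)).
pose P : 'M[rat]_(\dim {:K}) := \matrix_(k, l) c k (h l).
have wP k : w k = \sum_l P k l *: W l.
  by rewrite hc (reindex h) /=; [apply: eq_bigr => l _; rewrite mxE | exact: onW_bij].
have P1 : padic_abs R p (\det P) <= 1.
  apply: ultra_det_le1; [exact: padic_abs_value|exact: padic_ultrametric|].
  move=> k l; rewrite mxE; apply: (radical_locally_maximal _ (hc k)) => k'.
  exact: integral_embed_le1 pp eu _ _ (iw k).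
have detW : \det (embed_mx s W) = \det (vander x) ^+ n * \det (vander y) ^+ m.
  rewrite (@embed_mx_grid W (fun j => b ^+ j) (fun _ j t => y t ^+ j)).
  - by rewrite prodr_const card_ord.
  - by [].
  - by move=> k l; rewrite rmorphXn hy.
rewrite -eu.2 (basis_discriminant_embed hs) (embed_mx_lincomb s wP) det_mulmx det_map_mx.
rewrite (avX hu) (avM hu) exprMn /= eu.2 detW (avM hu) !(avX hu) vander_x_unit expr1n mul1r.
apply: (@le_trans _ _ (1 * (u (\det (vander y)) ^+ m) ^+ 2)).
  rewrite ler_wpM2r ?exprn_ge0 ?av_ge0 //; apply: exprn_ile1 => //.
  exact: av_ge0 (padic_abs_value R pp) _.
rewrite mul1r exprAC mulnC exprM -exprVn.
apply: lerXn2r; rewrite ?nnegrE ?exprn_ge0 ?(av_ge0 hu) ?invr_ge0 ?ler0n //.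
  by rewrite exprn_ge0.
exact: vander_y_le.
Qed.

(** If two embeddings agree on a + b, a difference of conjugates of a equals one of conjugates of b.
    The first has value 1 unless it vanishes, the second has value below 1. *)
Lemma radical_sum_generator : <<1; a + b>>%VS = {:K}%VS.
Proof.
apply: (generator_of_distinct (s := s)) => k l; rewrite !rmorphD !hx !hy => e.
have e1 : x (h k).1 - x (h l).1 = y (h l).2 - y (h k).2.
  by apply/eqP; rewrite subr_eq addrAC eq_sym subr_eq addrC e addrC.
apply: (bij_inj bh); have [k1|k1] := eqVneq (h k).1 (h l).1.
  apply/eqP; rewrite -pair_eqE /= k1 eqxx /=; apply/eqP/yi/eqP.
  by rewrite eq_sym -subr_eq0 -e1 k1 subrr.
have := grid_x_sub k1; rewrite e1 => e2; have : u (y (h l).2 - y (h k).2) < 1.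
  by apply: le_lt_trans (ultraB hu uu _ _) _; rewrite gt_max !grid_y_lt1.
by rewrite e2 ltxx.
Qed.

End RadicalDiscriminant.

(** * Upper bound for the least height *)

Lemma padic_quotient (R : realType) p q : prime p -> prime q -> p != q ->
  padic_abs R p (p%:R / q%:R) = p%:R^-1.
Proof.
move=> pp pq npq; rewrite (avM (padic_abs_value R pp)) (avV (padic_abs_value R pp)).
rewrite padic_abs_prime // padic_abs_coprime ?invr1 ?mulr1 ?prime_gt0 //.
by rewrite dvdn_prime2.
Qed.

Lemma padic_abs_int_le (R : realType) p k (z : int) : prime p -> z != 0 ->
  (padic_abs R p z%:~R <= p%:R ^- k) = (p ^ k %| `|z|)%N.
Proof.
move=> pp z0; rewrite padic_abs_int // pfactor_dvdn ?absz_gt0 //.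
rewrite lef_pV2 ?posrE ?exprn_gt0 ?ltr0n ?prime_gt0 //.
by rewrite ler_eXn2l // ltr1n prime_gt1.
Qed.

Section RadicalUpperBound.
Variables (R : realType) (K : fieldExtType rat) (m n p q : nat) (a b : K).
Hypotheses (m0 : (0 < m)%N) (n0 : (0 < n)%N) (pp : prime p) (pq : prime q).
Hypotheses (mp : (m < p)%N) (ltpq : (p < q)%N).
Hypotheses (ha : a ^+ m = 2%:R) (hb : b ^+ n = p%:R / q%:R).
Hypothesis hd : \dim {:K} = (m * n)%N.

Let r : rat := p%:R / q%:R.

Lemma radical_ratio : b ^+ n = r%:A.
Proof. by rewrite hb /r -in_algE rmorphM fmorphV !rmorph_nat. Qed.

(** The estimate at q is the one at p applied to b^-1, whose n-th power q/p has q-adic value 1/q. *)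
Lemma radical_discriminant_ge :
  ((p * q) ^ (m * n.-1))%:R <= `|ratr (discriminant K) : R|.
Proof.
have [E [s hs]] := embeddings_exist K.
have neq : p != q by rewrite ltn_eqF.
have hr : padic_abs R p r = p%:R^-1 by apply: padic_quotient.
have hr' : padic_abs R q r^-1 = q%:R^-1 by rewrite /r invf_div; apply: padic_quotient; rewrite // eq_sym.
have hb' : b^-1 ^+ n = (r^-1)%:A by rewrite exprVn radical_ratio -!in_algE fmorphV.
have mq := ltn_trans mp ltpq.
have [u eu] := padic_extension_exists R E pp.
have [u' eu'] := padic_extension_exists R E pq.
have [x [y [h [xi yi bh hx hy]]]] := embedding_grid hs m0 n0 pp mp ha radical_ratio hr hd.
have dp := radical_discriminant_le hs m0 n0 pp mp ha radical_ratio hr hd xi yi bh hx hy eu.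
have yi' : injective (fun j => (y j)^-1) by apply: inj_comp yi; apply: invr_inj.
have hy' k : s k b^-1 = (y (h k).2)^-1 by rewrite fmorphV hy.
have dq := radical_discriminant_le hs m0 n0 pq mq ha hb' hr' hd xi yi' bh hx hy' eu'.
have [z hz] := discriminant_int R hs.
have z0 : z != 0 by have := discriminant_neq0 R hs; rewrite hz intr_eq0.
move: dp dq; rewrite hz !padic_abs_int_le // => dp dq.
rewrite ratr_int -intr_norm -pmulrn ler_nat expnMn dvdn_leq ?absz_gt0 // Gauss_dvd ?dp //.
by rewrite coprimeXl // coprimeXr // prime_coprime // dvdn_prime2.
Qed.

(** Every archimedean value of a is at most 2 and of b at most 1, whence 3 for each embedding; the
    finite part is the leading coefficient c, which divides q^m. *)
Lemma radical_sum_height : weil_height R (a + b) ^+ (m * n) <= 3%:R ^+ (m * n) * (q ^ m)%:R.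
Proof.
have [E [s hs]] := embeddings_exist K.
have [c [G hG]] := primitive_multiple_exists hs (a + b).
have [ui einf] := archimedean_extension_exists R E.
have hi := einf.1.
have := weil_height_exp hs hG einf; rewrite [X in _ ^+ X = _]hd => ->.
rewrite mulrC; apply: ler_pM.
- by apply: prodr_ge0 => k _; rewrite le_max ler01.
- exact: ler0n.
- have le3 k : ui (s k a) + ui (s k b) <= 3%:R.
    have -> : 3%:R = 2%:R + 1 :> R by rewrite natr1.
    apply: lerD.
      rewrite leNgt; apply/negP => lt2.
      have : ui (s k a) ^+ m = 2%:R.
        by rewrite -(avX hi) -rmorphXn ha rmorph_nat -av_nat_alg einf.2 ratr_nat ger0_norm ?ler0n.
      move=> e; have : 2%:R ^+ m < ui (s k a) ^+ m by rewrite (ltr_pXn2r m0) ?nnegrE ?(av_ge0 hi) ?ler0n.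
      by rewrite e ltNge -[X in X <= _]expr1 ler_eXn2l ?m0 // ltr1n.
    rewrite -(expr_le1 (n := n)) ?av_ge0 // -(avX hi) -rmorphXn radical_ratio embed_alg einf.2.
    rewrite rmorphM fmorphV !rmorph_nat ger0_norm ?divr_ge0 ?ler0n //.
    by rewrite ler_pdivrMr ?ltr0n ?prime_gt0 // mul1r ler_nat ltnW.
  have -> : 3%:R ^+ (m * n) = \prod_(k < \dim {:K}) 3%:R :> R by rewrite prodr_const card_ord hd.
  apply: ler_prod => k _; rewrite le_max ler01 ge_max ler1n /= rmorphD.
  exact: le_trans (avD hi _ _) (le3 k).
(* The comparison c <= q^m is made at each prime l: there a is integral and max(1, |b|)^n <=
   1/|q|_l, so the product over the mn embeddings is at most |q|_l^-m. *)
rewrite ler_nat; have [c0 _ _] := hG.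
apply: (@leq_of_padic R) => // [|l pl]; first by rewrite expn_gt0 prime_gt0.
have [u eu] := padic_extension_exists R E pl.
have hu := eu.1; have uu := extends_ultrametric pl eu.
have lv := padic_abs_value R pl.
have q0 : 0 < padic_abs R l q%:R by rewrite av_gt0 // pnatr_eq0 -lt0n prime_gt0.
have hk k : Num.max 1 (u (s k (a + b))) ^+ n <= (padic_abs R l q%:R)^-1.
  apply: (@le_trans _ _ (Num.max 1 (u (s k b)) ^+ n)).
    have max0 z : Num.max 1 z \is @Num.nneg R by rewrite nnegrE le_max ler01.
    apply: lerXn2r => //; rewrite ge_max le_max lexx /= rmorphD.
    apply: le_trans (uu _ _) _; rewrite ge_max !le_max lexx orbT andbT; apply/orP; left.
    rewrite -(expr_le1 (n := m)) ?av_ge0 // -(avX hu) -rmorphXn ha rmorph_nat.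
    exact: ultra_nat.
  have [_|_] := leP 1 (u (s k b)).
    rewrite -(avX hu) -rmorphXn radical_ratio embed_alg eu.2 (avM lv) (avV lv).
    by rewrite ler_piMl ?invr_ge0 ?(ltW q0) // padic_abs_nat_le1.
  by rewrite expr1n invf_ge1 // padic_abs_nat_le1.
have := prime_max_prod hG pl eu; set P := \prod_k _ => hP.
have Pn : P ^+ n <= (padic_abs R l q%:R)^-1 ^+ (m * n).
  have -> : (padic_abs R l q%:R)^-1 ^+ (m * n) = \prod_(k < \dim {:K}) (padic_abs R l q%:R)^-1.
    by rewrite prodr_const card_ord hd.
  rewrite /P -prodrXl.
  by apply: ler_prod => k _; rewrite hk andbT exprn_ge0 // le_max ler01.
have P0 : 0 < P by apply: prodr_gt0 => k _; rewrite lt_max ltr01.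
have cE : padic_abs R l c%:R = P^-1 by rewrite -[RHS]mul1r -hP mulfK ?gt_eqF.
rewrite cE natrX (avX lv) -[leLHS]invrK lef_pV2 ?posrE ?invr_gt0 ?exprn_gt0 //.
by rewrite -exprVn -(ler_pXn2r n0) ?nnegrE ?(ltW P0) ?exprn_ge0 ?invr_ge0 ?(ltW q0) // -exprM.
Qed.

End RadicalUpperBound.

(** After raising to the power 2d: H^(2d) <= 9^d q^(2m) <= 9^d 2^m (pq)^m by q < 2p, and (pq)^m is
    at most the 2d-th power of the discriminant term. Finally 9^d 2^m <= 18^d <= (2d)^(4d), since d
    >= 2. *)
Lemma radical_upper_bound (R : realType) (K : fieldExtType rat) (m n p q : nat) (a b : K) :
  (0 < m)%N -> (1 < n)%N -> prime p -> prime q -> (m < p)%N -> (p < q)%N -> (q < 2 * p)%N ->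
  a ^+ m = 2%:R -> b ^+ n = p%:R / q%:R -> \dim {:K} = (m * n)%N ->
  delta R K <= (2 * (m * n))%:R ^+ 2 *
    `|ratr (discriminant K)| `^ (2 * (m * n) * (n - 1))%:R^-1.
Proof.
move=> m0 n1 pp pq mp ltpq q2 ha hb hd; have n0 := ltnW n1.
have [E [s hs]] := embeddings_exist K.
have hr : padic_abs R p (p%:R / q%:R) = p%:R^-1 by apply: padic_quotient; rewrite // ltn_eqF.
have hb' := radical_ratio hb.
have [x [y [h [xi yi bh hx hy]]]] := embedding_grid hs m0 n0 pp mp ha hb' hr hd.
have [u eu] := padic_extension_exists R E pp.
have gen := radical_sum_generator m0 n0 pp mp ha hb' hr hd xi yi bh hx hy eu.
have [_ _ min] := delta_attained R K.
apply: le_trans (min _ gen) _.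
have := radical_discriminant_ge R m0 n0 pp pq mp ltpq ha hb hd.
have := radical_sum_height R m0 n0 pq ltpq ha hb hd.
set H := weil_height _ _; set X := `| _ |; set t := X `^ _ => hH hX.
have H0 : 0 <= H := weil_height_ge0 _ _.
have X0 : 0 < X by apply: lt_le_trans hX; rewrite ltr0n expn_gt0 muln_gt0 !prime_gt0.
have t0 : 0 <= t := powR_ge0 _ _.
have N0 : (0 < 2 * (m * n) * (n - 1))%N by rewrite !muln_gt0 m0 n0 /=; lia.
have tX : t ^+ (2 * (m * n) * (n - 1)) = X.
  by rewrite -powR_mulrn // -powRrM mulVf ?pnatr_eq0 -?lt0n // powRr1 // ltW.
have tpq : ((p * q) ^ m)%:R <= t ^+ (2 * (m * n)).
  have n10 : (0 < n - 1)%N by rewrite subn_gt0.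
  rewrite -(ler_pXn2r n10) ?nnegrE ?ler0n ?exprn_ge0 //.
  by rewrite -exprM tX -natrX -expnM subn1.
set d := (m * n)%N in hH tpq N0 tX *.
have d2 : (1 < d)%N by rewrite /d; nia.
have md : (m <= d)%N by rewrite /d leq_pmulr.
rewrite -(@ler_pXn2r _ (2 * d)) ?nnegrE ?mulr_ge0 ?exprn_ge0 ?ler0n //; last lia.
rewrite [X in H ^+ X]mulnC exprM; apply: (@le_trans _ _ ((3%:R ^+ d * (q ^ m)%:R) ^+ 2)).
  by apply: lerXn2r; rewrite ?nnegrE ?mulr_ge0 ?exprn_ge0 ?ler0n.
rewrite [X in _ <= X]exprMn.
apply: (@le_trans _ _ (9%:R ^+ d * 2%:R ^+ m * ((p * q) ^ m)%:R)).
  have : ((3 ^ d * q ^ m) ^ 2 <= 9 ^ d * 2 ^ m * (p * q) ^ m)%N.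
    rewrite expnMn -!expnM mulnC [(d * 2)%N]mulnC [(m * 2)%N]mulnC !expnM mulnC.
    by rewrite -mulnA -expnMn leq_mul2l leq_exp2r //; apply/orP; right; nia.
  by rewrite -(ler_nat R) !(natrX, natrM).
apply: ler_pM; rewrite ?mulr_ge0 ?exprn_ge0 ?ler0n //.
apply: (@le_trans _ _ (9%:R ^+ d * 2%:R ^+ d)).
  by rewrite ler_wpM2l ?exprn_ge0 ?ler0n // ler_eXn2l // ltr1n.
rewrite -exprMn -natrM exprM; apply: lerXn2r; rewrite ?nnegrE ?exprn_ge0 ?ler0n //.
by rewrite -!natrX ler_nat; nia.
Qed.

(** * Lower bound for the least height *)

(** The element is the sum of the e v z v with z v near 1 at v and small elsewhere; at each v the
    term e v dominates and, the value being ultrametric, fixes the value of the sum. *)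
Lemma weak_approximation_values (R : realType) (L : fieldExtType rat) p (vs : seq (L -> R))
    (e : (L -> R) -> L) : prime p ->
  (forall v, v \in vs -> extends_abs (padic_abs R p) v) -> (forall v, e v != 0) ->
  exists c, forall v, v \in vs -> v c = v (e v).
Proof.
move=> pp hvs e0.
have hp : std_abs_rat (padic_abs R p) by right; exists p.
wlog uvs : vs hvs / uniq vs.
  move=> /(_ (undup vs)); rewrite undup_uniq => h.
  have [v|//|c hc] := h; first by rewrite mem_undup; apply: hvs.
  by exists c => v vin; apply: hc; rewrite mem_undup.
have ep v u : u \in vs -> 0 < u (e v) by move=> /hvs[hu _]; rewrite av_gt0.
(* Small enough that e v z v is below e u at every other u, so the domination holds at all places at
   once. *)
pose eps v := \big[Num.min/1]_(u <- vs) (u (e u) / u (e v)).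
have eps0 v : 0 < eps v.
  rewrite /eps big_seq; elim/big_ind: _ => // [x y hx hy|u uin]; first by rewrite lt_min hx.
  by rewrite divr_gt0 ?ep.
have eps_le v u : u \in vs -> eps v * u (e v) <= u (e u).
  move=> uin; rewrite -ler_pdivlMr ?ep // /eps (perm_big _ (perm_to_rem uin)) big_cons.
  by rewrite ge_min lexx.
have eps1 v : eps v <= 1.
  rewrite /eps; elim/big_rec: _ => // u x _ hx; by rewrite ge_min hx orbT.
have /choice[z hz] v : exists z, v \in vs ->
    v (z - 1) < eps v /\ forall u, u \in vs -> u != v -> u z < eps v.
  have [vin|_] := boolP (v \in vs); last by exists 0.
  have [|||z [z1 z2]] := @weak_approximation R L _ hp v [seq u <- vs | u != v] (eps v) (hvs v vin).
  - by move=> u; rewrite mem_filter => /andP[_ /hvs].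
  - by rewrite mem_filter eqxx.
  - exact: eps0.
  by exists z => _; split=> // u uin uv; apply: z2; rewrite mem_filter uv.
exists (\sum_(v <- vs) e v * z v) => v vin; have [hv _] := hvs v vin.
have uv := extends_ultrametric pp (hvs v vin).
rewrite (perm_big _ (perm_to_rem vin)) big_cons /=.
rewrite (_ : e v * z v = e v + e v * (z v - 1)); last by rewrite mulrBr mulr1 addrC subrK.
rewrite -addrA ultra_eq //; apply: le_lt_trans (uv _ _) _; rewrite gt_max; apply/andP; split.
  rewrite (avM hv) gtr_pMr ?ep //; apply: lt_le_trans (hz v vin).1 (eps1 v).
rewrite big_seq; apply: ultra_sum_lt => //; first exact: ep.
move=> u; rewrite (rem_filter _ uvs) mem_filter => /andP[/= uv' uin].
rewrite (avM hv) mulrC; apply: lt_le_trans (eps_le u v vin).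
by rewrite ltr_pM2r ?ep //; apply: (hz u uin).2 => //; rewrite eq_sym.
Qed.

Section RelativeMinimalPolynomial.
Variables (K E : fieldExtType rat) (s : 'I_(\dim {:K}) -> {rmorphism K -> E}).
Hypothesis hs : forall i j, s i =1 s j -> i = j.
Variables (m n : nat) (a al : K).
Hypothesis n0 : (0 < n)%N.
Variables (x : 'I_m -> E) (h : 'I_(\dim {:K}) -> 'I_m * 'I_n) (hi : 'I_m * 'I_n -> 'I_(\dim {:K})).
Hypotheses (hK : cancel h hi) (hiK : cancel hi h).
Hypotheses (xi : injective x) (hx : forall k, s k a = x (h k).1).
Hypothesis gen : <<1; al>>%VS = {:K}%VS.

Let F : {subfield K} := <<1; a>>%AS.
Let f := minPoly F al.

Lemma embed_mx_block (Y : 'I_n -> K) :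
  \det (embed_mx s (fun k => a ^+ (h k).1 * Y (h k).2)) =
  \det (vander x) ^+ n * \prod_i \det (\matrix_(j, t) s (hi (i, t)) (Y j)).
Proof.
apply: (embed_mx_grid (Bijective hK hiK) hx (T := fun i j t => s (hi (i, t)) (Y j))) => // k l.
by rewrite -surjective_pairing hK.
Qed.

Lemma embed_subfield_eq k l z : (h k).1 = (h l).1 -> z \in F -> s k z = s l z.
Proof.
move=> kl zF; rewrite -(Fadjoin_poly_eq zF).
have /polyOver1P[g ->] := Fadjoin_polyOver 1 a z.
by rewrite !embed_horner !hx kl.
Qed.

(** An embedding of Q(a) depends on the first index alone, and [hi (i, Ordinal n0)] represents the
    i-th one. Over it [al] has n distinct conjugates, while deg f <= n because a has m distinct
    conjugates. *)
Lemma minPoly_embed i : map_poly (s (hi (i, Ordinal n0))) f = \prod_t ('X - (s (hi (i, t)) al)%:P).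
Proof.
have dm : \dim {:K} = (m * n)%N.
  by have := bij_eq_card (Bijective hK hiK); rewrite card_prod !card_ord.
have dF : (m <= \dim F)%N.
  have /polyOver1P[g hg] := minPolyOver 1 a.
  have g0 : g != 0 by rewrite -(map_poly_eq0 (in_alg K)) -hg monic_neq0 // monic_minPoly.
  rewrite /F /= dim_Fadjoin dimv1 muln1 -ltnS -size_minPoly hg size_map_poly.
  rewrite -(size_map_poly (in_alg E)) -[X in (X < _)%N]card_ord cardE -(size_map x).
  apply: max_poly_roots; rewrite ?map_poly_eq0 ?map_inj_uniq -?enumT ?enum_uniq //.
  apply/allP => _ /mapP[j _ ->]; have -> : x j = s (hi (j, Ordinal n0)) a by rewrite hx hiK.
  by rewrite rootE -embed_horner -hg minPolyxx rmorph0.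
have fF : <<F; al>>%VS = {:K}%VS.
  by apply/eqP; rewrite eqEsubv subvf /= -gen; apply: adjoinSl; apply: sub1v.
have szf : (size f <= n.+1)%N.
  have := dim_Fadjoin F al; rewrite fF dm /f size_minPoly => e.
  have mpos : (0 < m)%N by case: m i => [[]|].
  by rewrite ltnS -(leq_pmul2l mpos) e mulnC leq_mul2l dF orbT.
set rs := [seq s (hi (i, t)) al | t <- enum 'I_n].
have urs : uniq rs.
  rewrite map_inj_uniq ?enum_uniq // => t t' /(embed_gen_inj hs gen)/(can_inj hiK).
  by case.
have rrs : all (root (map_poly (s (hi (i, Ordinal n0))) f)) rs.
  apply/allP => _ /mapP[t _ ->]; rewrite rootE.
  have -> : map_poly (s (hi (i, Ordinal n0))) f = map_poly (s (hi (i, t))) f.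
    apply/polyP => j; rewrite !coef_map; apply: embed_subfield_eq; rewrite ?hiK //.
    exact: (polyOverP (minPolyOver F al)).
  by rewrite horner_map minPolyxx rmorph0.
have fm : map_poly (s (hi (i, Ordinal n0))) f \is monic by rewrite map_monic monic_minPoly.
rewrite (all_roots_prod_XsubC _ rrs) ?uniq_rootsE //.
  by rewrite (monicP fm) scale1r big_map big_enum.
apply/eqP; rewrite eqn_leq {1}size_map_poly {1}size_map size_enum_ord szf /=.
by apply: max_poly_roots => //; apply: monic_neq0.
Qed.

Lemma power_product_det :
  \det (embed_mx s (fun k => a ^+ (h k).1 * al ^+ (h k).2)) =
  \det (vander x) ^+ n * \prod_i \det (vander (fun t => s (hi (i, t)) al)).
Proof.
rewrite (embed_mx_block (fun j => al ^+ j)); congr (_ * _).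
apply: eq_bigr => i _; congr (\det _); apply/matrixP => j t.
by rewrite !mxE rmorphXn.
Qed.

End RelativeMinimalPolynomial.

Lemma prod_grid (R : comNzRingType) d m n (h : 'I_d -> 'I_m * 'I_n) hi (F : 'I_d -> R) :
  cancel h hi -> cancel hi h -> \prod_i \prod_t F (hi (i, t)) = \prod_k F k.
Proof.
move=> hK hiK; rewrite [RHS](reindex hi) /=; last by exists h => z _.
rewrite [RHS](eq_bigr (fun ij => F (hi (ij.1, ij.2)))); last by case.
by rewrite -(pair_bigA _ (fun i t => F (hi (i, t)))).
Qed.

Lemma gauss_map (R : realType) (L E : fieldType) (g : {rmorphism L -> E}) (u : E -> R) q :
  gauss u (map_poly g q) = gauss (u \o g) q.
Proof.
by rewrite /gauss size_map_poly; apply: eq_bigr => i _; rewrite coef_map.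
Qed.

Section LocalInequality.
Variables (R : realType) (K E : fieldExtType rat) (s : 'I_(\dim {:K}) -> {rmorphism K -> E}).
Hypothesis hs : forall i j, s i =1 s j -> i = j.
Variables (m n p : nat) (a al : K).
Hypotheses (n0 : (0 < n)%N) (pp : prime p).
Variables (x : 'I_m -> E) (h : 'I_(\dim {:K}) -> 'I_m * 'I_n) (hi : 'I_m * 'I_n -> 'I_(\dim {:K})).
Hypotheses (hK : cancel h hi) (hiK : cancel hi h).
Hypotheses (xi : injective x) (hx : forall k, s k a = x (h k).1).
Hypothesis gen : <<1; al>>%VS = {:K}%VS.
Variables (c0 : nat) (G : {poly int}).
Hypothesis hG : primitive_multiple s al c0 G.
Variable u : E -> R.
Hypotheses (eu : extends_abs (padic_abs R p) u) (a1 : forall k, u (s k a) <= 1).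

Let F : {subfield K} := <<1; a>>%AS.
Let f := minPoly F al.
Let hu := eu.1.
Let uu := extends_ultrametric pp eu.
Let o : 'I_n := Ordinal n0.

(** Weak approximation in Q(a) replaces a content: one number of Q(a) has the inverse of the Gauss
    norm of f as its value at every place over the single prime p. *)
Lemma inverse_content : exists2 c, c \in F &
  forall i, u (s (hi (i, o)) c) * gauss u (map_poly (s (hi (i, o))) f) = 1.
Proof.
have /polyOver_subvs[fp hfp] := minPolyOver F al.
have fp1 : lead_coef fp = 1.
  apply: (fmorph_inj vsval); rewrite -lead_coef_map -hfp rmorph1.
  exact: (monicP (monic_minPoly F al)).
pose v i : subvs_of F -> R := u \o (s (hi (i, o)) \o vsval).
pose vs := [seq v i | i <- enum 'I_m].
have evs w : w \in vs -> extends_abs (padic_abs R p) w.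
  case/mapP => i _ ->; split; first exact: (av_comp (s (hi (i, o)) \o vsval) hu).
  move=> r; rewrite -eu.2; congr (u _).
  by rewrite -[LHS]/(s (hi (i, o)) (vsval r%:A)) linearZ rmorph1 embed_alg.
have /choice[e he] (w : subvs_of F -> R) : exists e, e != 0 /\ (w \in vs -> w e * gauss w fp = 1).
  have [win|_] := boolP (w \in vs); last by exists 1; rewrite oner_neq0.
  have [hw _] := evs w win.
  have fp0 : fp != 0 by rewrite -lead_coef_eq0 fp1 oner_neq0.
  have [j gj _] := gauss_attained hw fp0.
  have fj0 : fp`_j != 0.
    rewrite -(av_eq0 hw) -gj gt_eqF //; apply: lt_le_trans ltr01 _.
    by rewrite -(av1 hw) -fp1; apply: gauss_ge.
  exists (fp`_j)^-1; split=> [|_]; first exact: invr_neq0.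
  by rewrite gj -(avM hw) mulVf ?av1.
have [c hc] := weak_approximation_values pp evs (fun w => (he w).1).
exists (vsval c) => [|i]; first exact: subvsP.
have vin : v i \in vs by apply: map_f; rewrite mem_enum.
rewrite -[u _]/(v i c) hc // /f hfp -map_poly_comp.
by rewrite (gauss_map (s (hi (i, o)) \o vsval)); apply: (he (v i)).2.
Qed.

Let root_al i t := s (hi (i, t)) al.

Lemma embed_minPoly k :
  map_poly (s k) f = \prod_t ('X - (root_al (h k).1 t)%:P).
Proof.
rewrite -(minPoly_embed hs n0 hK hiK xi hx gen); apply/polyP => j; rewrite !coef_map.
apply: (embed_subfield_eq hx); rewrite ?hiK //.
exact: (polyOverP (minPolyOver F al)).
Qed.

Lemma minPoly_cofactor : exists q : {poly K},
  [/\ f = ('X - al%:P) * q, size q = n & q`_n.-1 = 1].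
Proof.
have [q hq] := factor_theorem _ _ (root_minPoly F al); exists q.
have fq : f = ('X - al%:P) * q by rewrite mulrC.
have qm : q \is monic.
  by rewrite -(monicMl _ (monicXsubC al)) -fq monic_minPoly.
have szq : size q = n.
  have szf : size f = n.+1.
    have k : 'I_(\dim {:K}) := Ordinal (adim_gt0 {:K}).
    by rewrite -(size_map_poly (s k)) embed_minPoly -big_enum /= size_prod_XsubC size_enum_ord.
  by apply/eqP; rewrite -eqSS -szf fq size_monicM ?monicXsubC ?monic_neq0 // size_XsubC.
by split=> //; rewrite -szq; apply: (monicP qm).
Qed.

Section Cofactor.
Variable q : {poly K}.
Hypotheses (fq : f = ('X - al%:P) * q) (szq : size q = n) (q1 : q`_n.-1 = 1).

Lemma embed_cofactor k :
  map_poly (s k) q = \prod_(t | t != (h k).2) ('X - (root_al (h k).1 t)%:P).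
Proof.
have := embed_minPoly k; rewrite fq rmorphM /= map_polyXsubC (bigD1 (h k).2) //=.
by rewrite {1}/root_al -surjective_pairing hK => /mulfI; apply; rewrite polyXsubC_eq0.
Qed.

(** Euler's dual basis: a conjugate of q vanishes at all conjugates of al over Q(a) but its own,
    where it is the derivative of f. So the transpose of H times the Vandermonde matrix is diagonal,
    with determinant of value equal to the squared Vandermonde. *)
Lemma det_cofactor i :
  u (\det (\matrix_(j < n, t < n) s (hi (i, t)) q`_j)) = u (\det (vander (root_al i))).
Proof.
set H := \matrix_(j, t) _.
have ri : injective (root_al i).
  by move=> t t' /(embed_gen_inj hs gen)/(can_inj hiK)[].
have V0 := vander_det_neq0 hu ri.
apply: (mulIf (x := u (\det (vander (root_al i))))); first by rewrite (av_eq0 hu).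
rewrite -expr2 (vander_sq_abs _ hu) -(avM hu) -[\det H]det_tr -det_mulmx.
have -> : H^T *m vander (root_al i) =
    diag_mx (\row_t \prod_(t' | t' != t) (root_al i t - root_al i t')).
  apply/matrixP => t t'; rewrite !mxE.
  transitivity (map_poly (s (hi (i, t))) q).[root_al i t'].
    rewrite (horner_coef_wide _ (n := n)) ?size_map_poly ?szq //.
    by apply: eq_bigr => j _; rewrite !mxE coef_map.
  rewrite embed_cofactor hiK /= horner_prod; case: eqVneq => [<-|tt'].
    by rewrite mulr1n; apply: eq_bigr => k _; rewrite !hornerE.
  by rewrite mulr0n (bigD1 t') 1?eq_sym //= !hornerE subrr mul0r.
rewrite det_diag (av_prod hu); apply: eq_bigr => t _; rewrite mxE.
exact: av_prod.
Qed.

End Cofactor.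

Lemma prod_power_pred c : \prod_(j < n) (if (j < n.-1)%N then c else 1) = c ^+ n.-1 :> E.
Proof.
case: (n) n0 => // n' _; rewrite big_ord_recr /= ltnn mulr1.
under eq_bigr => j _ do rewrite ltn_ord.
by rewrite prodr_const card_ord.
Qed.

(* Silverman's argument: with f = (X - al) * q the minimal polynomial of al over
   Q(a), and c in Q(a) inverse to the content of f at every place over p, the
   c * q`_j are integral over p by Gauss's lemma. *)
Lemma power_product_local :
  padic_abs R p (basis_discriminant (fun k => a ^+ (h k).1 * al ^+ (h k).2)) *
    padic_abs R p c0%:R ^+ (2 * n.-1) <= padic_abs R p (discriminant K).
Proof.
have [c cF hc] := inverse_content.
have [q [fq szq q1]] := minPoly_cofactor.
(* The top coefficient of q is already 1. Leaving it unscaled gives c the exponent n - 1 in each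
   block. *)
pose th (j : 'I_n) := if (j < n.-1)%N then c * q`_j else 1.
pose y k := a ^+ (h k).1 * th (h k).2.
have ch k : s k c = s (hi ((h k).1, o)) c by apply: (embed_subfield_eq hx); rewrite ?hiK.
have fh k : map_poly (s (hi ((h k).1, o))) f = map_poly (s k) f.
  by rewrite !embed_minPoly hiK.
have th1 j k : u (s k (th j)) <= 1.
  rewrite /th; case: ifP => _; last by rewrite rmorph1 av1.
  rewrite rmorphM (avM hu) ch -(hc (h k).1) ler_wpM2l ?(av_ge0 hu) // fh fq.
  rewrite rmorphM /= map_polyXsubC gauss_linear // -coef_map.
  apply: le_trans (gauss_ge hu _ _) _; rewrite ler_peMl ?gauss_ge0 //.
  by rewrite le_max lexx.
have iy j k : u (s k (y j)) <= 1.
  rewrite rmorphM (avM hu) rmorphXn (avX hu) mulr_ile1 ?exprn_ge0 ?(av_ge0 hu) //.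
  by rewrite exprn_ile1 ?(av_ge0 hu).
have := padic_disc_le hs pp eu iy; apply: le_trans.
rewrite -!eu.2 !(basis_discriminant_embed hs).
have dW := power_product_det al hK hiK hx.
have dy : u (\det (embed_mx s y)) = u (\det (vander x) ^+ n * \prod_i \det (vander (root_al i)))
    * padic_abs R p c0%:R ^+ n.-1.
  rewrite (embed_mx_block hK hiK hx th) !(avM hu) -mulrA; congr (_ * _).
  have cc : padic_abs R p c0%:R = \prod_i u (s (hi (i, o)) c).
    have h1 : \prod_i u (s (hi (i, o)) c) * \prod_i gauss u (map_poly (s (hi (i, o))) f) = 1.
      by rewrite -big_split /= big1.
    have h2 : \prod_i gauss u (map_poly (s (hi (i, o))) f) = \prod_k Num.max 1 (u (s k al)).
      rewrite -(prod_grid (fun k => Num.max 1 (u (s k al))) hK hiK).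
      apply: eq_bigr => i _; rewrite (minPoly_embed hs n0 hK hiK xi hx gen).
      by rewrite gauss_prod.
    have h3 := prime_max_prod hG pp eu.
    apply: (mulIf (x := \prod_k Num.max 1 (u (s k al)))); last by rewrite h3 -h2 h1.
    by apply/prodf_neq0 => k _; rewrite gt_eqF // lt_max ltr01.
  rewrite cc -prodrXl !(av_prod hu) -big_split; apply: eq_bigr => i _ /=.
  rewrite -(det_cofactor fq szq) mulrC -(avX hu) -(avM hu) -prod_power_pred; congr (u _).
  pose dc : 'rV[E]_n := \row_j (if (j < n.-1)%N then s (hi (i, o)) c else 1).
  have -> : \prod_(j < n) (if (j < n.-1)%N then s (hi (i, o)) c else 1) = \det (diag_mx dc).
    by rewrite det_diag; apply: eq_bigr => j _; rewrite mxE.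
  rewrite -det_mulmx; congr (\det _); apply/matrixP => j t.
  rewrite mul_diag_mx !mxE /th; case: ifP => jn; first by rewrite rmorphM ch hiK.
  rewrite mul1r rmorph1 (_ : nat_of_ord j = n.-1) ?q1 ?rmorph1 //.
  by have := ltn_ord j; lia.
by rewrite !(avX hu) dW dy exprMn [(2 * _)%N]mulnC exprM eu.2.
Qed.

End LocalInequality.

(** Each of the n(n-1) ordered pairs obeys |y - z| <= 2 max(1, |y|) max(1, |z|), and each index lies
    in 2(n-1) of them. *)
Lemma vander_sq_le (R : realType) (E : fieldType) (u : E -> R) n (y : 'I_n -> E) :
  is_absolute_value u ->
  u (\det (vander y)) ^+ 2 <= 2%:R ^+ (n * n.-1) * (\prod_t Num.max 1 (u (y t))) ^+ (2 * n.-1).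
Proof.
move=> hu; rewrite (vander_sq_abs _ hu); set M := fun t => Num.max 1 (u (y t)).
have M1 t : 1 <= M t by rewrite le_max lexx.
have M0 t : 0 <= M t := le_trans ler01 (M1 t).
have uM t : u (y t) <= M t by rewrite le_max lexx orbT.
have card_ne (t : 'I_n) : #|[pred t' | t' != t]| = n.-1.
  by have := cardC1 t; rewrite card_ord => <-; apply: eq_card.
apply: (@le_trans _ _ (\prod_t \prod_(t' | t' != t) (2%:R * M t * M t'))).
  apply: ler_prod => t _; rewrite prodr_ge0 => [|t' _]; last exact: av_ge0.
  apply: ler_prod => t' _; rewrite av_ge0 //=; apply: le_trans (avD hu _ _) _; rewrite avN //.
  apply: le_trans (lerD (uM t) (uM t')) _; have := M1 t; have := M1 t'; nra.
under eq_bigr => t _ do rewrite big_split /= prodr_const card_ne.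
rewrite big_split /=.
have -> : \prod_t \prod_(t' | t' != t) M t' = (\prod_t M t) ^+ n.-1.
  rewrite (exchange_big_dep xpredT) //= -prodrXl; apply: eq_bigr => t' _.
  rewrite prodr_const; congr (_ ^+ _); rewrite -(card_ne t').
  by apply: eq_card => i; rewrite !inE eq_sym.
rewrite !prodrXl big_split /= prodr_const card_ord exprMn -exprM -mulrA -exprD.
by rewrite mulnC mul2n addnn.
Qed.

Section DiscriminantBound.
Variables (R : realType) (K : fieldExtType rat) (m n p : nat) (a b al : K) (r : rat).
Hypotheses (m0 : (0 < m)%N) (n0 : (0 < n)%N) (pp : prime p) (mp : (m < p)%N).
Hypotheses (ha : a ^+ m = 2%:R) (hb : b ^+ n = r%:A) (hr : padic_abs R p r = p%:R^-1).
Hypothesis hd : \dim {:K} = (m * n)%N.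
Hypothesis gen : <<1; al>>%VS = {:K}%VS.

(** m^m 2^(m-1) is the absolute discriminant of X^m - 2, entering once for each of the n powers of
    al; the other power of 2 is the loss of [vander_sq_le] over m blocks. *)
Lemma discriminant_le_height :
  `|ratr (discriminant K)| <= (m ^ m * 2 ^ m.-1)%:R ^+ n * 2%:R ^+ (m * (n * n.-1)) *
     weil_height R al ^+ (m * n * (2 * n.-1)).
Proof.
have [E [s hs]] := embeddings_exist K.
have [x [y [h [xi _ bh hx _]]]] := embedding_grid hs m0 n0 pp mp ha hb hr hd.
have [hi hK hiK] := bh.
have hxm := grid_root_x n0 ha bh hx.
have [ui einf] := archimedean_extension_exists R E; have hui := einf.1.
have [c [G hG]] := primitive_multiple_exists hs al; have [c0 _ _] := hG.
pose root i t := s (hi (i, t)) al.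
pose D := basis_discriminant (fun k => a ^+ (h k).1 * al ^+ (h k).2).
have DE : D%:A = \det (vander x) ^+ n ^+ 2 * (\prod_i \det (vander (root i))) ^+ 2 :> E.
  by rewrite (basis_discriminant_embed hs) (power_product_det al hK hiK hx) exprMn.
have D0 : D != 0.
  suff : D%:A != 0 :> E by apply: contra_neq => ->; rewrite scale0r.
  rewrite DE mulf_neq0 ?expf_neq0 ?(vander_det_neq0 hui) //.
  apply/prodf_neq0 => i _; apply: (vander_det_neq0 hui) => t t'.
  by move=> /(embed_gen_inj hs gen)/(can_inj hiK)[].
have Dl0 : discriminant K != 0 := discriminant_neq0 R hs.
have cQ : (c%:R : rat) != 0 by rewrite pnatr_eq0 -lt0n.
(* The local inequalities at all primes say that the discriminant divides this integer multiple of
   D; the quotient is nonzero, hence at least 1 in absolute value. *)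
have [z hz] : exists z : int, D * c%:R ^+ (2 * n.-1) / discriminant K = z%:~R.
  apply: (@rat_int_of_padic R) => l pl.
  have [u eu] := padic_extension_exists R E pl.
  have hl := padic_abs_value R pl.
  have a1 k : u (s k a) <= 1.
    rewrite -(expr_le1 (n := m)) ?(av_ge0 eu.1) // -(avX eu.1) -rmorphXn ha rmorph_nat.
    exact: ultra_nat eu.1 (extends_ultrametric pl eu) _.
  rewrite !(avM hl) (avX hl) (avV hl) ler_pdivrMr ?av_gt0 // mul1r.
  have := power_product_local hs n0 pl hK hiK xi hx gen hG eu a1; rewrite -/D; apply.
have z0 : z != 0.
  by rewrite -(intr_eq0 rat) -hz !mulf_neq0 ?invr_neq0 ?expf_neq0.
have le1 : `|discriminant K| <= `|D * c%:R ^+ (2 * n.-1)|.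
  rewrite -[X in _ <= `|X|](divfK Dl0) hz normrM ler_peMl ?normr_ge0 //.
  by rewrite -intr_norm ler1z; lia.
apply: (@le_trans _ _ (`|ratr D| * c%:R ^+ (2 * n.-1))).
  rewrite -[X in _ * X]ger0_norm ?exprn_ge0 ?ler0n // -(ratr_nat R c) -rmorphXn -normrM -rmorphM.
  by rewrite -!ratr_norm ler_rat.
have VX : ui (\det (vander x)) ^+ 2 = (m ^ m * 2 ^ m.-1)%:R.
  rewrite (vander_deriv hui (prod_XsubC_roots m0 xi hxm)).
  have x2 i : ui (x i) ^+ m = 2%:R.
    by rewrite -(avX hui) hxm -av_nat_alg einf.2 ratr_nat ger0_norm ?ler0n.
  have xe i : ui (x i) = ui (x (Ordinal m0)).
    by apply/eqP; rewrite -(eqrXn2 m0) ?(av_ge0 hui) // !x2.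
  under eq_bigr => i _.
    rewrite derivB derivXn derivC subr0 hornerMn hornerXn -mulr_natl (avM hui) (avX hui).
    rewrite -av_nat_alg einf.2 ratr_nat ger0_norm ?ler0n // xe.
  over.
  by rewrite big_split /= !prodr_const card_ord exprAC x2 natrM !natrX.
have -> : `|ratr D| = ui D%:A by rewrite einf.2.
rewrite DE (avM hui) !(avX hui) (av_prod hui).
rewrite exprAC VX -mulrA -[leLHS]mulrA ler_wpM2l ?exprn_ge0 ?ler0n //.
have -> : weil_height R al ^+ (m * n * (2 * n.-1)) =
    c%:R ^+ (2 * n.-1) * \prod_i (\prod_t Num.max 1 (ui (root i t))) ^+ (2 * n.-1).
  rewrite exprM; have := weil_height_exp hs hG einf; rewrite [X in _ ^+ X = _]hd => ->.
  by rewrite exprMn prodrXl (prod_grid (fun k => Num.max 1 (ui (s k al))) hK hiK).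
rewrite [leLHS]mulrC [leRHS]mulrCA ler_wpM2l ?exprn_ge0 ?ler0n //.
have -> : 2%:R ^+ (m * (n * n.-1)) = \prod_(i < m) (2%:R ^+ (n * n.-1)) :> R.
  by rewrite prodr_const card_ord -exprM mulnC.
rewrite -big_split -prodrXl /=; apply: ler_prod => i _.
by rewrite exprn_ge0 ?(av_ge0 hui) //=; apply: vander_sq_le.
Qed.

End DiscriminantBound.

(** The power 2d(n-1) of sqrt(2d) is (2d)^(d(n-1)), whose powers of 2 match the loss 2^(mn(n-1)).
    What remains is (m^m 2^(m-1))^n <= (m^m n^m)^n = d^d <= d^(d(n-1)), by n >= 2. *)
Lemma radical_lower_bound (R : realType) (K : fieldExtType rat) (m n p : nat) (a b : K) (r : rat) :
  (0 < m)%N -> (1 < n)%N -> prime p -> (m < p)%N ->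
  a ^+ m = 2%:R -> b ^+ n = r%:A -> padic_abs R p r = p%:R^-1 -> \dim {:K} = (m * n)%N ->
  (Num.sqrt (2 * (m * n))%:R)^-1 *
    `|ratr (discriminant K)| `^ (2 * (m * n) * (n - 1))%:R^-1 <= delta R K.
Proof.
move=> m0 n1 pp mp ha hb hr hd; have n0 := ltnW n1.
have [al [gen ->] _] := delta_attained R K.
have := discriminant_le_height m0 n0 pp mp ha hb hr hd gen.
set H := weil_height _ _; set X := `| _ |; set t := X `^ _ => hX.
have H0 : 0 <= H := weil_height_ge0 _ _.
have X0 : 0 <= X by apply: normr_ge0.
have t0 : 0 <= t := powR_ge0 _ _.
have N0 : (0 < 2 * (m * n) * (n - 1))%N by rewrite !muln_gt0 m0 n0 /=; lia.
have tX : t ^+ (2 * (m * n) * (n - 1)) = X.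
  by rewrite -powR_mulrn // -powRrM mulVf ?pnatr_eq0 -?lt0n // powRr1.
have d0 : 0 < (2 * (m * n))%:R :> R by rewrite ltr0n !muln_gt0 m0 n0.
rewrite mulrC ler_pdivrMr ?sqrtr_gt0 // mulrC.
rewrite -(ler_pXn2r N0) ?nnegrE ?mulr_ge0 ?sqrtr_ge0 // tX; apply: le_trans hX _.
have eN : (2 * (m * n) * (n - 1) = 2 * (m * n * (n - 1)))%N by lia.
have -> : (m * n * (2 * n.-1) = 2 * (m * n * (n - 1)))%N by lia.
rewrite exprMn eN [X in _ <= X * _]exprM sqr_sqrtr ?(ltW d0) //.
rewrite ler_wpM2r ?exprn_ge0 // -!natrX -natrM ler_nat.
have -> : ((2 * (m * n)) ^ (m * n * (n - 1)) =
   (m * n) ^ (m * n * (n - 1)) * 2 ^ (m * (n * n.-1)))%N.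
  by rewrite [(2 * _)%N]mulnC expnMn subn1 mulnA.
rewrite leq_mul2r; apply/orP; right.
apply: (@leq_trans ((m * n) ^ (m * n))); last first.
  by apply: leq_pexp2l; [rewrite muln_gt0 m0 | apply: leq_pmulr; rewrite subn_gt0].
rewrite [leqRHS]expnM leq_exp2r // expnMn leq_mul //.
by apply: (@leq_trans (2 ^ m)); [rewrite leq_exp2l ?leq_pred|rewrite leq_exp2r].
Qed.

(** * Primes p < q < 2p *)

Section PrimePairs.
Local Open Scope nat_scope.

(** In Legendre's formula each power p^i contributes 0 or 1 to the exponent, and 0 as soon as p^i >
    2k. *)
Lemma logn_central_binomial p k : prime p -> 0 < k -> p ^ logn p 'C(2 * k, k) <= 2 * k.
Proof.
move=> pp k0; have p1 := prime_gt1 pp.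
apply: leq_trans (trunc_logP p1 _); last by rewrite muln_gt0.
rewrite leq_exp2l //; set t := trunc_log p (2 * k).
have C0 : 0 < 'C(2 * k, k) by rewrite bin_gt0; lia.
have k2 : k <= 2 * k by lia.
have := bin_fact k2; rewrite (_ : 2 * k - k = k); last by lia.
move=> /(congr1 (logn p)).
rewrite !lognM ?muln_gt0 ?fact_gt0 // !logn_fact //.
have -> : \sum_(1 <= i < k.+1) k %/ p ^ i = \sum_(1 <= i < (2 * k).+1) k %/ p ^ i.
  rewrite [RHS](big_cat_nat _ (n := k.+1)) //=.
  rewrite [X in _ + X]big_nat_cond [X in _ + X]big1 ?addn0 // => i /andP[/andP[ki _] _].
  by rewrite divn_small // (ltn_trans ki) // ltn_expl.
have le i : (2 * k) %/ p ^ i <= k %/ p ^ i + k %/ p ^ i + (i <= t).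
  have q0 : 0 < p ^ i by rewrite expn_gt0 prime_gt0.
  have [_|ti] := leqP i t.
    rewrite addn1 -ltnS ltn_divLR //.
    have := divn_eq k (p ^ i); have := ltn_pmod k q0.
    by set Q := p ^ i; move: (k %/ Q) (k %% Q) => x y; nia.
  have lt : 2 * k < p ^ i.
    by apply: leq_trans (trunc_log_ltn (2 * k) p1) _; rewrite leq_exp2l.
  by rewrite divn_small.
have cnt N : \sum_(1 <= i < N.+1) (i <= t) <= t /\ \sum_(1 <= i < N.+1) (i <= t) <= N.
  elim: N => [|N [IH1 IH2]]; first by rewrite big_geq.
  by rewrite big_nat_recr //=; case: leqP; lia.
have : \sum_(1 <= i < (2 * k).+1) (2 * k) %/ p ^ i <=
    \sum_(1 <= i < (2 * k).+1) (k %/ p ^ i + k %/ p ^ i + (i <= t)).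
  by apply: leq_sum => i _; apply: le.
rewrite !big_split /=; have [h _] := cnt (2 * k); lia.
Qed.

(** 'C(2k, k) is the sum of the squares of the 'C(k, j), and their plain sum is 2^k. *)
Lemma central_binomial_ge k : 2 ^ k <= 'C(2 * k, k).
Proof.
have -> : 2 ^ k = \sum_(j < k.+1) 'C(k, j).
  by rewrite -[2]/(1 + 1) expnDn; apply: eq_bigr => j _; rewrite !exp1n !muln1.
rewrite mul2n -addnn -binomial.Vandermonde; apply: leq_sum => j _.
by rewrite leq_pmulr // bin_gt0 leq_subr.
Qed.

(* If each prime above B were at least twice the preceding one, pi(2^j) would
   grow linearly in j, and 'C(2k, k) <= (2k)^(pi(2k)) would be less than 2^k. *)
Lemma prime_pair_exists B : exists p q, [/\ prime p, prime q, B < p, p < q & q < 2 * p].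
Proof.
apply: contrapT => none.
have dbl p q : prime p -> prime q -> B < p -> p < q -> 2 * p <= q.
  by move=> pp pq Bp ltpq; rewrite leqNgt; apply/negP => q2; apply: none; exists p, q.
pose pi N := \sum_(0 <= i < N.+1) prime i.
pose C := 2 ^ B + 1.
have step j : B <= 2 ^ j -> pi (2 ^ j.+1) <= (pi (2 ^ j)).+1.
  move=> Bj; rewrite /pi (big_cat_nat _ (n := (2 ^ j).+1)) //=; last by rewrite ltnS leq_exp2l.
  rewrite -[leqRHS]addn1 leq_add2l.
  have [/hasP[p pin pp]|/hasPn np] := boolP (has prime (index_iota (2 ^ j).+1 (2 ^ j.+1).+1)).
    rewrite (bigD1_seq p) ?iota_uniq //= pp big1_seq // => q /andP[qp qin].
    apply/eqP; rewrite eqb0; apply/negP => pq.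
    move: pin qin; rewrite !mem_index_iota !ltnS expnS => /andP[p1 p2] /andP[q1 q2].
    by case: (ltngtP p q) qp => // h _; [have := dbl p q pp pq | have := dbl q p pq pp]; lia.
  by rewrite big1_seq // => q /andP[_ /np/negPf->].
have count i : pi (2 ^ (B + i)) <= C + i.
  elim: i => [|i IH].
    rewrite !addn0 /pi /C; apply: (@leq_trans (\sum_(0 <= i < (2 ^ B).+1) 1)).
      by apply: leq_sum => k _; case: prime.
    by rewrite sum_nat_const_nat; lia.
  rewrite addnS; apply: leq_trans (step _ _) _; last by lia.
  by apply: ltnW; apply: leq_trans (ltn_expl B (isT : 1 < 2)) _; rewrite leq_exp2l // leq_addr.
(* For k = 2^(B + i) this compares the exponents of 2 in 2^k <= 'C(2k, k) <= (2k)^(pi(2k)). *)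
have bnd i : 2 ^ (B + i) <= (B + i.+1) * (C + i.+1).
  pose k := 2 ^ (B + i); have k0 : 0 < k by rewrite expn_gt0.
  have k2 : 2 * k = 2 ^ (B + i.+1) by rewrite addnS expnS.
  rewrite -(leq_exp2l (m := 2)) //; apply: leq_trans (central_binomial_ge k) _.
  have C0 : 0 < 'C(2 * k, k) by rewrite bin_gt0; lia.
  have -> : 'C(2 * k, k) = \prod_(0 <= p < (2 * k).+1 | prime p) p ^ logn p 'C(2 * k, k).
    rewrite -[LHS](partnT C0) (widen_partn (m := 'C(2 * k, k) + 2 * k)) ?leq_addr //.
    rewrite (big_cat_nat _ (n := (2 * k).+1)) //=; last by rewrite ltnS leq_addl.
    rewrite [X in _ * X]big_nat_cond [X in _ * X]big1 ?muln1 => [|q /andP[/andP[kq _] _]].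
      rewrite [RHS]big_mkcond; apply: eq_bigr => q _; case: ifP => // /negbT npq.
      by rewrite lognE (negPf npq).
    have [pq|npq] := boolP (prime q); last by rewrite lognE (negPf npq).
    have := logn_central_binomial pq k0; case: (logn q _) => // e le.
    suff : q <= 2 * k by rewrite leqNgt kq.
    by apply: leq_trans le; rewrite expnS leq_pmulr // expn_gt0 prime_gt0.
  apply: (@leq_trans (\prod_(0 <= p < (2 * k).+1 | prime p) (2 * k))).
    by apply: leq_prod => p pp; apply: logn_central_binomial.
  rewrite big_const_seq iter_muln_1 k2 -expnM leq_exp2l // leq_mul2l; apply/orP; right.
  rewrite -k2 -sum1_count big_mkcond; apply: leq_trans (count i.+1); rewrite -k2; apply: leq_sum => q _.
  by case: (prime q).
have big N : (N + 5) ^ 2 < 128 * 2 ^ N.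
  elim: N => [//|N]; rewrite [2 ^ N.+1]expnS mulnCA -!mulnn; move: (128 * 2 ^ N) => X IH.
  have : (N.+1 + 5) * (N.+1 + 5) <= 2 * ((N + 5) * (N + 5)) by nia.
  lia.
have BC : B < C by rewrite /C addn1 ltnS ltnW // ltn_expl.
(* The bound is used at i = C + 9, where 4 * 128 * 2^C = 2^(C + 9) and both factors on the right are
   at most 2 (C + 5). *)
have := big C; rewrite ltnNge => /negP; apply.
rewrite -(leq_pmul2l (isT : 0 < 4)); apply: (@leq_trans (2 ^ (B + (C + 9)))).
  apply: (@leq_trans (2 ^ (C + 9))); last by rewrite leq_exp2l // leq_addl.
  by rewrite mulnA mulnC expnD leq_mul2l; apply/orP; right.
apply: leq_trans (bnd _) _; apply: (@leq_trans ((2 * (C + 5)) * (2 * (C + 5)))).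
  by apply: leq_mul; lia.
by rewrite mulnn expnMn.
Qed.

End PrimePairs.

(** * The radical fields and their infinitude *)

Lemma radical_field_exists m n (c d : algC) : (0 < m)%N -> (0 < n)%N ->
  exists (K : fieldExtType rat) (f : {rmorphism K -> algC}) (a b : K),
    [/\ f a ^+ m = c, f b ^+ n = d & <<1 & [:: a; b]>>%VS = {:K}%VS].
Proof.
move=> m0 n0; have [K [f [t ft gen]]] := num_field_exists [:: m.-root c; n.-root d].
case: t ft gen => [|a [|b [|? ?]]] //= [fa fb] gen.
by exists K, f, a, b; split=> //; rewrite ?fa ?fb rootCK.
Qed.

Definition radical_field (m n p q : nat) (K : fieldExtType rat) (a b : K) :=
  [/\ a ^+ m = 2%:R, b ^+ n = p%:R / q%:R & <<1 & [:: a; b]>>%VS = {:K}%VS].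

Lemma radical_field_of_primes m n p q : (0 < m)%N -> (0 < n)%N ->
  exists (K : fieldExtType rat) (a b : K), radical_field m n p q a b.
Proof.
move=> m0 n0.
have [K [f [a [b [fa fb gen]]]]] := radical_field_exists 2%:R (p%:R / q%:R) m0 n0.
exists K, a, b; split=> //; apply: (fmorph_inj f); first by rewrite rmorphXn rmorph_nat.
by rewrite rmorphXn rmorphM fmorphV !rmorph_nat.
Qed.

Section RadicalFieldBounds.
Variables (R : realType) (K : fieldExtType rat) (m n p q : nat) (a b : K).
Hypotheses (m0 : (0 < m)%N) (n1 : (1 < n)%N) (pp : prime p) (pq : prime q).
Hypotheses (mp : (m < p)%N) (ltpq : (p < q)%N) (q2 : (q < 2 * p)%N).
Hypothesis hab : radical_field m n p q a b.

Lemma radical_field_bounds :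
  [/\ \dim {:K} = (m * n)%N,
      (Num.sqrt (2 * (m * n))%:R)^-1 *
        `|ratr (discriminant K)| `^ (2 * (m * n) * (n - 1))%:R^-1 <= delta R K
    & delta R K <= (2 * (m * n))%:R ^+ 2 *
        `|ratr (discriminant K)| `^ (2 * (m * n) * (n - 1))%:R^-1].
Proof.
have [ha hb gen] := hab; have n0 := ltnW n1.
have hr : padic_abs R p (p%:R / q%:R) = p%:R^-1 by apply: padic_quotient; rewrite // ltn_eqF.
have hb' := radical_ratio hb.
have hd := radical_degree m0 n0 pp mp ha hb' hr gen.
split=> //; first exact: radical_lower_bound m0 n1 pp mp ha hb' hr hd.
exact: radical_upper_bound m0 n1 pp pq mp ltpq q2 ha hb hd.
Qed.

(** A field of degree mn containing the two radicals has discriminant at least (pq)^(m(n-1)) >= p.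
    [g] is a bare function so that the inverse of an isomorphism can be used as well. *)
Lemma radical_field_not_hom (L : fieldExtType rat) (g : K -> L) :
  \dim {:L} = (m * n)%N -> `|ratr (discriminant L) : R| < p%:R ->
  g a ^+ m = 2%:R -> g b ^+ n = p%:R / q%:R -> False.
Proof.
move=> dL small ga gb.
have := radical_discriminant_ge R m0 (ltnW n1) pp pq mp ltpq ga gb dL.
move/le_lt_trans => /(_ _ small); rewrite ltr_nat ltnNge => /negP; apply.
apply: (@leq_trans (p * q)); first by rewrite leq_pmulr ?prime_gt0.
rewrite -[leqLHS]expn1 leq_exp2l; last by rewrite (leq_trans (prime_gt1 pp)) // leq_pmulr // prime_gt0.
by rewrite muln_gt0 m0 /= -subn1 subn_gt0.
Qed.

End RadicalFieldBounds.

(** Each prime p j is chosen beyond the discriminants of all earlier fields, which is what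
    [radical_field_not_hom] asks for. *)
Lemma radical_field_sequence (R : realType) m n : (0 < m)%N -> (1 < n)%N ->
  exists (p q : nat -> nat) (K : nat -> fieldExtType rat) (a b : forall i, K i),
    (forall i, [/\ prime (p i), prime (q i), m < p i, p i < q i & q i < 2 * p i]%N /\
               radical_field m n (p i) (q i) (a i) (b i)) /\
    forall i j, (i < j)%N -> `|ratr (discriminant (K i)) : R| < (p j)%:R.
Proof.
move=> m0 n1; have n0 := ltnW n1.
have /choice[pq hpq] (B : nat) : exists pq : nat * nat,
    [/\ prime pq.1, prime pq.2, B < pq.1, pq.1 < pq.2 & pq.2 < 2 * pq.1]%N.
  by have [p [q h]] := prime_pair_exists B; exists (p, q).
have /choice[F hF] (B : nat) : exists F : {K : fieldExtType rat & (K * K)%type},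
    radical_field m n (pq B).1 (pq B).2 (projT2 F).1 (projT2 F).2.
  have [K [a [b h]]] := radical_field_of_primes (pq B).1 (pq B).2 m0 n0.
  by exists (existT _ K (a, b)).
pose next B := (maxn B (Num.trunc (`|ratr (discriminant (projT1 (F B)))| : R)).+1).
pose B i := iter i next m.
have Bm i j : (i <= j)%N -> (B i <= B j)%N.
  move=> ij; rewrite -(subnK ij); elim: (j - i)%N => // k IH.
  by apply: leq_trans IH _; rewrite addSn /= leq_maxl.
exists (fun i => (pq (B i)).1), (fun i => (pq (B i)).2), (fun i => projT1 (F (B i))).
exists (fun i => (projT2 (F (B i))).1), (fun i => (projT2 (F (B i))).2); split=> [i|i j ij].
  have [? ? h ? ?] := hpq (B i); split; last exact: hF.
  by split=> //; apply: leq_ltn_trans h; apply: (Bm 0%N).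
have [_ _ h _ _] := hpq (B j); apply: lt_trans (truncnS_gt _) _.
rewrite ltr_nat; apply: leq_ltn_trans h; apply: leq_trans (Bm i.+1 j ij).
exact: leq_maxr.
Qed.

Unset Implicit Arguments.
Set Strict Implicit.
Set Printing Implicit Defensive.

Theorem theorem2 (R : realType) (m n d : nat)
    (hm : (0 < m)%N) (hn : (1 < n)%N) (hd : d = (m * n)%N) :
  (exists K : nat -> fieldExtType rat,
     (forall i j : nat, i <> j ->
        ~ exists f : {rmorphism K i -> K j}, bijective f) /\
     forall i : nat,
       [/\ \dim {:K i} = d,
           (Num.sqrt (2 * d)%:R)^-1 *
             `|ratr (discriminant (K i))| `^ (2 * d * (n - 1))%:R^-1
             <= delta R (K i)
         & delta R (K i) <=
           (2 * d)%:R ^+ 2 *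
             `|ratr (discriminant (K i))| `^ (2 * d * (n - 1))%:R^-1]) /\
  (forall (p q : nat) (K : fieldExtType rat) (a b : K),
     prime p -> prime q -> (m < p)%N -> (p < q)%N -> (q < 2 * p)%N ->
     a ^+ m = 2%:R -> b ^+ n = p%:R / q%:R ->
     <<1 & [:: a; b]>>%VS = {:K}%VS ->
     [/\ \dim {:K} = d,
         (Num.sqrt (2 * d)%:R)^-1 *
           `|ratr (discriminant K)| `^ (2 * d * (n - 1))%:R^-1
           <= delta R K
       & delta R K <=
         (2 * d)%:R ^+ 2 *
           `|ratr (discriminant K)| `^ (2 * d * (n - 1))%:R^-1]).
Proof.
subst d; split; last first.
  move=> p q K a b pp pq mp ltpq q2 ha hb gen.
  exact: (radical_field_bounds R hm hn pp pq mp ltpq q2 (And3 ha hb gen)).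
have [p [q [K [a [b [hK lt]]]]]] := radical_field_sequence R hm hn.
have bounds i : _ := let: conj (And5 pp pq mp ltpq q2) hab := hK i in
  radical_field_bounds R hm hn pp pq mp ltpq q2 hab.
(* The radicals of the later field must be carried into the earlier one, so for i < j it is the
   inverse map that transports them. *)
exists K; split=> // i j; case: (ltngtP i j) => // ij _ [f [g fK gK]].
  have [[pp pq mp ltpq q2] hab] := hK j; have [ha hb _] := hab; have [dK _ _] := bounds i.
  apply: (radical_field_not_hom hm hn pp pq mp ltpq (L := K i) (g := g) (a := a j) (b := b j)) dK _ _ _.
  - exact: lt i j ij.
  - by apply: (can_inj fK); rewrite rmorphXn gK rmorph_nat.
  - by apply: (can_inj fK); rewrite rmorphXn gK rmorphM fmorphV !rmorph_nat.
have [[pp pq mp ltpq q2] hab] := hK i; have [ha hb _] := hab; have [dK _ _] := bounds j.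
apply: (radical_field_not_hom hm hn pp pq mp ltpq (L := K j) (g := f) (a := a i) (b := b i)) dK _ _ _.
- exact: lt j i ij.
- by rewrite -rmorphXn ha rmorph_nat.
- by rewrite -rmorphXn hb rmorphM fmorphV !rmorph_nat.
Qed.
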